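(* Let $Q\to+\infty$. Then for integers $r\geqslant 1$ with $r=o\bigl((Q/\ln Q)^{1/3}\bigr)$ the asymptotic formula $$\nu(Q;r,3,0)=\nu(r;3,0)+O\Bigl(\frac{\ln Q}{Q}\Bigr)$$ holds, where the implied constant is absolute and $\nu(r)=\nu(r;3,0)=\lim_{Q\to+\infty}\nu(Q;r,3,0)$ is as follows. For $1\leqslant r\leqslant 7$: $$\nu(1)=6-2\Bigl(\frac{\pi}{\sqrt3}+\ln 3\Bigr),\quad \nu(2)=4\Bigl(\frac{\pi}{\sqrt3}-\ln 3\Bigr)-\frac{87}{35},\quad \nu(3)=12\ln 3-\frac{53132}{4095},$$ $$\nu(4)=\frac{528904}{45045}-4\Bigl(\frac{\pi}{\sqrt3}+\ln3\Bigr),\quad \nu(5)=2\Bigl(\frac{\pi}{\sqrt3}-\ln 3\Bigr)-\frac{4164383}{3063060},$$ $$\nu(6)=\frac{3089}{85085},\quad \nu(7)=\frac{54097}{3879876}.$$ If $r\geqslant 8$, write $r=5m+i$ with $m\geqslant 1$, $0\leqslant i\leqslant 4$. Then $$\nu(r)=\sum_{j=1}^{n(i)}P_{ij}(m),\qquad n(3)=3,\quad n(i)=2 \text{ for } i\neq 3,$$ where $$P_{01}(m)=\frac{6(8m-1)}{(3m-1)(6m-1)(12m-1)(12m+1)},\quad P_{02}(m)=\frac{2}{(6m-1)(6m+1)(12m-1)},$$ $$P_{11}(m)=\frac{6(8m+1)}{(3m+1)(6m+1)(12m-1)(12m+1)},\quad P_{12}(m)=\frac{2}{(6m-1)(6m+1)(12m+1)},$$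 $$P_{21}(m)=\frac{6(4m+1)}{(3m+1)(6m+1)(12m+1)(12m+5)},\quad P_{22}(m)=\frac{2(9m+4)}{3(2m+1)(3m+1)(6m+1)(12m+7)},$$ $$P_{31}(m)=\frac{6(2m+1)}{(3m+1)(3m+2)(12m+5)(12m+7)},\quad P_{32}(m)=\frac{2}{3(2m+1)(6m+1)(12m+5)},$$ $$P_{33}(m)=\frac{2}{3(2m+1)(6m+5)(12m+7)},$$ $$P_{41}(m)=\frac{6(4m+3)}{(3m+2)(6m+5)(12m+7)(12m+11)},\quad P_{42}(m)=\frac{2(9m+5)}{3(2m+1)(3m+2)(6m+5)(12m+5)}.$$
   Context: For an integer $Q\geqslant 1$, the Farey sequence $\Phi_Q$ of order $Q$ is the set of irreducible fractions $a/q$ with $0\leqslant a\leqslant q\leqslant Q$, $\gcd(a,q)=1$, arranged in ascending order. It is extended periodically to the real line (all integer translates of its elements are included), and configurations differing by an integer translation are identified (so $0/1$ and $1/1$ count as one element, and one may normalise a tuple by requiring $0<a_0/q_0\leqslant 1$). For integers $D\geqslant 2$, $0\leqslant c_0\leqslant D-1$, $r\geqslant 1$: $N(Q;D,c_0)$ is the number of elements $a/q$ of $\Phi_Q$ with $q\equiv c_0\pmod D$; $N(Q;r,D,c_0)$ is the number of $(r+2)$-tuples of consecutive fractions $$\frac{a_0}{q_0}<\frac{a_1}{q_1}<\dots<\frac{a_r}{q_r}<\frac{a_{r+1}}{q_{r+1}}$$ of the extended sequence such that $q_0\equiv q_{r+1}\equiv c_0\pmod D$ and $q_i\not\equiv c_0\pmod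 D$ for $i=1,\dots,r$. Finally $$\nu(Q;r,D,c_0)=\frac{N(Q;r,D,c_0)}{N(Q;D,c_0)},\qquad \nu(r;D,c_0)=\lim_{Q\to+\infty}\nu(Q;r,D,c_0).$$ *)

(* Defs.v *)
From HB Require Import structures.
From mathcomp Require Import all_boot all_order all_algebra finmap.
From mathcomp Require Import all_classical all_reals all_analysis.

Set Implicit Arguments.
Unset Strict Implicit.
Unset Printing Implicit Defensive.

Import Order.TTheory GRing.Theory Num.Theory.
Import numFieldNormedType.Exports.

Local Open Scope classical_set_scope.
Local Open Scope ring_scope.

Definition farey (Q : nat) : set rat :=
  [set x | exists a q : nat,
    [/\ (0 < q)%N, (a <= q <= Q)%N, coprime a q & x = a%:Q / q%:Q]].

Definition farey_ext (Q : nat) : set rat :=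
  [set x | exists2 y, farey Q y & exists k : int, x = y + k%:Q].

(* The denominator of the irreducible form of [x : rat] is [denq x : int]. *)
Definition denq_cong (D c0 : nat) (x : rat) : Prop :=
  (denq x = c0 %[mod D])%Z.

Definition farey_consecutive (Q : nat) (x y : rat) : Prop :=
  [/\ farey_ext Q x, farey_ext Q y, x < y
    & forall z, farey_ext Q z -> ~ (x < z < y)].

(* Elements and tuples are counted modulo integer translations: the condition
   [0 < x <= 1] selects one representative in each class. *)
Definition farey_cong (Q D c0 : nat) : set rat :=
  [set x | [/\ farey_ext Q x, 0 < x <= 1 & denq_cong D c0 x]].

Definition farey_gap (Q r D c0 : nat) : set (r.+2.-tuple rat) :=
  [set t | [/\ forall i, (i <= r)%N -> farey_consecutive Q t`_i t`_i.+1,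
               0 < t`_0 <= 1,
               denq_cong D c0 t`_0,
               denq_cong D c0 t`_r.+1
             & forall i, (1 <= i <= r)%N -> ~ denq_cong D c0 t`_i]].
Arguments farey_gap : clear implicits.

(* [fset_set A] is the finite set of elements of [A] when [A] is finite; the
   lemmas [finite_farey_cong] and [finite_farey_gap] below show that this is
   the case here. *)
Definition N_cong (Q D c0 : nat) : nat :=
  #|` fset_set (farey_cong Q D c0) |.

Definition N_gap (Q r D c0 : nat) : nat :=
  #|` fset_set (farey_gap Q r D c0) |.

Definition nuQ (R : realType) (Q r D c0 : nat) : R :=
  (N_gap Q r D c0)%:R / (N_cong Q D c0)%:R.

Definition nu (R : realType) (r D c0 : nat) : R :=
  limn (fun Q : nat => nuQ R Q r D c0).

Definition nterms (i : nat) : nat := (if i == 3 then 3 else 2)%N.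

Definition Pterm (R : realType) (i j m : nat) : R :=
  let x : R := m%:R in
  match i, j with
  | 0%N, 1%N => (6 * (8 * x - 1)) /
            ((3 * x - 1) * (6 * x - 1) * (12 * x - 1) * (12 * x + 1))
  | 0%N, 2%N => 2 / ((6 * x - 1) * (6 * x + 1) * (12 * x - 1))
  | 1%N, 1%N => (6 * (8 * x + 1)) /
            ((3 * x + 1) * (6 * x + 1) * (12 * x - 1) * (12 * x + 1))
  | 1%N, 2%N => 2 / ((6 * x - 1) * (6 * x + 1) * (12 * x + 1))
  | 2%N, 1%N => (6 * (4 * x + 1)) /
            ((3 * x + 1) * (6 * x + 1) * (12 * x + 1) * (12 * x + 5))
  | 2%N, 2%N => (2 * (9 * x + 4)) /
            (3 * (2 * x + 1) * (3 * x + 1) * (6 * x + 1) * (12 * x + 7))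
  | 3%N, 1%N => (6 * (2 * x + 1)) /
            ((3 * x + 1) * (3 * x + 2) * (12 * x + 5) * (12 * x + 7))
  | 3%N, 2%N => 2 / (3 * (2 * x + 1) * (6 * x + 1) * (12 * x + 5))
  | 3%N, 3%N => 2 / (3 * (2 * x + 1) * (6 * x + 5) * (12 * x + 7))
  | 4%N, 1%N => (6 * (4 * x + 3)) /
            ((3 * x + 2) * (6 * x + 5) * (12 * x + 7) * (12 * x + 11))
  | 4%N, 2%N => (2 * (9 * x + 5)) /
            (3 * (2 * x + 1) * (3 * x + 2) * (6 * x + 5) * (12 * x + 5))
  | _, _ => 0
  end.

Lemma farey_ext_addz (Q : nat) (x : rat) (k : int) :
  farey_ext Q x -> farey_ext Q (x + k%:Q).
Proof.
move=> [y Fy [l ->]]; exists y => //; exists (l + k).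
by rewrite rmorphD /= addrA.
Qed.

Lemma finite_farey_ext (Q B : nat) :
  finite_set [set x | farey_ext Q x /\ 0 < x <= B%:Q].
Proof.
apply: (@sub_finite_set _ _ ((fun p : nat * nat => p.1%:Q / p.2%:Q) @`
  (`I_(B * Q).+1 `*` `I_Q.+1))); last first.
  by apply: finite_image; apply: finite_setX; exact: finite_II.
move=> x [[y [a [q [q0 /andP[aq qQ] _ ->]]] [k ->]]] /andP[x0 xB].
have qq0 : (0 : rat) < q%:Q by rewrite ltr0z.
have e : a%:Q / q%:Q + k%:Q = (a%:Z + k * q%:Z)%:Q / q%:Q.
  by rewrite rmorphD rmorphM /= mulrDl mulfK // gt_eqF.
move: x0 xB; rewrite {}e.
case: (a%:Z + k * q%:Z) => [p|p] x0 xB; last first.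
  by move: x0; rewrite pmulr_lgt0 ?invr_gt0 // ltr0z.
exists (p, q) => //; split => //=.
move: xB; rewrite ler_pdivrMr // -rmorphM /= ler_int lez_nat => pB.
by rewrite ltnS (leq_trans pB) // leq_mul2l qQ orbT.
Qed.

Lemma finite_farey_cong (Q D c0 : nat) : finite_set (farey_cong Q D c0).
Proof. by apply: sub_finite_set (finite_farey_ext Q 1) => x [? ? _]; split. Qed.

Lemma finite_farey_gap (Q r D c0 : nat) : finite_set (farey_gap Q r D c0).
Proof.
pose A := [set x | farey_ext Q x /\ 0 < x <= r.+2%:Q].
have /finite_fsetP[X AX] : finite_set A by exact: finite_farey_ext.
apply: (@sub_finite_set _ _ ((fun g : {ffun 'I_r.+2 -> X} =>
  [tuple val (g i) | i < r.+2]) @` setT)); last first.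
  by apply: finite_image; exact: finite_finset.
move=> t [cons /andP[t0 t1] _ _ _].
have inA i : (i <= r.+1)%N -> farey_ext Q t`_i /\ 0 < t`_i <= i.+1%:Q.
  elim: i => [_|i IH ir]; first by have [Ft _ _ _] := cons 0 isT; rewrite t0 t1.
  have [Fx /andP[x0 x1]] := IH (ltnW ir).
  have [_ Fy xy nz] := cons i ir.
  split=> //; rewrite (lt_trans x0 xy) /=.
  rewrite leNgt; apply/negP => h.
  apply: (nz (t`_i + 1)); first exact: (@farey_ext_addz _ _ 1).
  rewrite ltrDl ltr01 /=; apply: le_lt_trans h.
  by rewrite -[i.+2]addn1 PoszD rmorphD /= lerD2r.
have inX (i : 'I_r.+2) : tnth t i \in X.
  suff : A (tnth t i) by rewrite AX.
  rewrite (tnth_nth 0); have [Fx /andP[x0 x1]] := inA i (ltn_ord i).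
  split=> //; rewrite x0 (le_trans x1) // ler_int lez_nat.
  exact: (ltn_ord i).
exists [ffun i => [` inX i]%fset] => //.
by apply: eq_from_tnth => i; rewrite tnth_mktuple ffunE.
Qed.

(* Main.v *)
Require Import Defs.
From HB Require Import structures.
From mathcomp Require Import all_boot all_order all_algebra finmap.
From mathcomp Require Import all_classical all_reals all_analysis.
From mathcomp Require Import zify ring lra.

Set Implicit Arguments.
Unset Strict Implicit.
Unset Printing Implicit Defensive.

Import Order.TTheory GRing.Theory Num.Theory.
Import numFieldNormedType.Exports.

Local Open Scope classical_set_scope.
Local Open Scope ring_scope.

(** Write [z] for the denominator of a Farey fraction [x] with [3 %| z].  The
denominators of the fractions that form a determinant one with [x] on its right
fill one residue class modulo [z], and there is exactly one [y] of that class
with [Q - z < 3 * y <= Q + 2 * z].  So the fractions counted by [N_cong] are the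
coprime pairs [(z, y)], [3 %| z], of a triangle of area [1/2] dilated by [Q]
([N_cong_pairs]).  The window for [y] is chosen so that the number of fractions
up to the next denominator divisible by 3 is an explicit function [gaplen] of
[(z, y)] ([walk_window]): in the interval from [x] to its neighbour of
denominator [y] all denominators are [p * z + q * y], and those with [3 %| q]
exceed [Q]; past that neighbour the first denominator divisible by 3 is read off
in the same way.

Hence [N_gap Q r 3 0] counts coprime pairs on which [gaplen] is [r].  In the
coordinates [z / Q], [y / Q] this level set is a finite union of trapezoids with
rational equations, plus, for [r <= 5], an infinite sequence of triangles that
shrink to the corner [(1, 0)].  Counting lattice points with Moebius inversion
over the common divisors [d] of [z] and [y] (none of which is divisible by 3)
shows that each region of area [A] contributes
[2 / 9 * A * Q ^ 2 * mobius_density Q] pairs, up to a multiple of [Q * ln Q]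
that does not depend on the region ([card_pairs_cell], [card_pairs_tail]).
The factor [mobius_density Q] is the same for the numerator and for the
denominator of [nuQ], and it is at least [1/4], so it cancels.  Therefore [nu r] is twice the area of the level set, with an error
[O(ln Q / Q)] that is uniform in [r] because the number of trapezoids is bounded
([gap_ratio], [nuE]).

Three facts make the areas computable.  Reading a gap from right to left gives
involutions of the window that preserve area and [gaplen], so half of the window
is enough ([card_upper_mirror], [card_lower_mirror]).  Adding 6 to [Q / z] in
that half adds 5 to [gaplen], whence two tables of trapezoids that depend on a
parameter [m], about [r / 5] ([upper_table], [lower_table]); their areas are
rational functions of [m] ([half_area_large]).  The triangles of index congruent
to [s] modulo 3 have areas [4 / ((h - 1) * h * (h + 1))]; after partial fractions
their sum is a combination of
[1 - 1/2 + 1/4 - 1/5 + ... = pi / (3 * sqrt 3)] and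
[1 + 1/2 - 2/3 + 1/4 + 1/5 - 2/6 + ... = ln 3]
([tail_series1], [tail_series2], [tail_series3]). *)

(** * From gaps to pairs of denominators *)

Lemma denq_frac (a z k l : int) : 0 < z -> k * z - l * a = 1 -> denq (a%:Q / z%:Q) = z.
Proof.
move=> z0 e; have c : coprime `|a| `|z|.
  rewrite -coprimezE; apply/coprimezP; exists (- l, k) => /=.
  by rewrite -e; ring.
by rewrite (coprimeq_den c) gt_eqF // gtr0_norm.
Qed.

Lemma numq_frac (a z k l : int) : 0 < z -> k * z - l * a = 1 -> numq (a%:Q / z%:Q) = a.
Proof.
move=> z0 e; have c : coprime `|a| `|z|.
  rewrite -coprimezE; apply/coprimezP; exists (- l, k) => /=.
  by rewrite -e; ring.
by rewrite (coprimeq_num c) gtr0_sg // mul1r.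
Qed.

(** A reduced fraction belongs to the extended Farey sequence as soon as its
denominator is small: translating by the integer part brings it to [[0, 1]]. *)
Lemma farey_extP (Q : nat) (x : rat) : farey_ext Q x <-> denq x <= Q%:Z.
Proof.
split.
  move=> [y [a [q [q0 /andP[aq qQ] cop ->]]] [k ->]].
  have -> : a%:Q / q%:Q + k%:Q = (a%:Z + k * q%:Z)%:Q / q%:Z%:Q.
    by rewrite rmorphD rmorphM /= mulrDl mulfK // gt_eqF // ltr0z.
  rewrite (coprimeq_den _); last first.
    rewrite -coprimezE /coprimez; have := gcdzMDl k q%:Z a%:Z.
    rewrite gcdzC addrC => ->; rewrite gcdzC.
    by move: cop; rewrite /coprime /gcdz /=.
  by rewrite gt_eqF ?ltz_nat //= lez_nat.
move=> dQ.
pose a := (numq x %% denq x)%Z; pose k := (numq x %/ denq x)%Z.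
have d0 : 0 < denq x by exact: denq_gt0.
have a0 : 0 <= a by rewrite modz_ge0 // gt_eqF.
have ad : a < denq x by exact: ltz_pmod.
exists (a%:Q / (denq x)%:Q).
  exists `|a|%N, `|denq x|%N; split.
  - by rewrite absz_gt0 gt_eqF.
  - by apply/andP; split; lia.
  - have := coprime_num_den x.
    rewrite /a -!coprimezE /coprimez gcdz_modl //.
  - by rewrite !gez0_abs // ltW.
exists k.
have d0q : (denq x)%:Q != 0 by rewrite intr_eq0 gt_eqF.
have E : numq x = k * denq x + a := divz_eq _ _.
rewrite -[LHS]divq_num_den {1}E rmorphD rmorphM /= [LHS]mulrDl addrC.
by rewrite mulfK.
Qed.

(** A fraction [w] strictly between the two has denominator [z * s + u * t] with
[s], [t] positive integers (the determinants of [w] with the ends), hence larger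
than [Q]. *)
Lemma consecutive_of_det (Q : nat) (a z b u : int) :
  0 < z <= Q%:Z -> 0 < u <= Q%:Z -> b * z - a * u = 1 -> Q%:Z < z + u ->
  farey_consecutive Q (a%:Q / z%:Q) (b%:Q / u%:Q).
Proof.
move=> /andP[z0 zQ] /andP[u0 uQ] e big.
have z0q : (0 : rat) < z%:Q by rewrite ltr0z.
have u0q : (0 : rat) < u%:Q by rewrite ltr0z.
split.
- by apply/farey_extP; rewrite (@denq_frac a z b u) // -e; ring.
- by apply/farey_extP; rewrite (@denq_frac b u (- a) (- z)) // -e; ring.
- rewrite ltr_pdivrMr // mulrAC ltr_pdivlMr // -!rmorphM /= ltr_int; lia.
move=> w /farey_extP wQ /andP[].
have q0 := denq_gt0 w; have q0q : (0 : rat) < (denq w)%:Q by rewrite ltr0z.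
rewrite -{1 2}[w]divq_num_den.
rewrite ltr_pdivrMr // mulrAC ltr_pdivlMr // -!rmorphM /= ltr_int => h1.
rewrite ltr_pdivrMr // mulrAC ltr_pdivlMr // -!rmorphM /= ltr_int => h2.
have : denq w = z * (b * denq w - numq w * u) + u * (numq w * z - a * denq w).
  by rewrite -[LHS]mulr1 -e; ring.
nia.
Qed.

(** [walk Q n x y]: [y] is reached from [x] in [n] steps of the Farey sequence,
all the fractions strictly in between having a denominator prime to 3. *)
Inductive walk (Q : nat) : nat -> rat -> rat -> Prop :=
| walk1 x y : farey_consecutive Q x y -> walk Q 1 x y
| walkS n x w y : farey_consecutive Q x w -> ~ denq_cong 3 0 w ->
    walk Q n w y -> walk Q n.+1 x y.

Lemma walk_cat (Q m n : nat) (x w y : rat) :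
  walk Q m x w -> ~ denq_cong 3 0 w -> walk Q n w y -> walk Q (m + n) x y.
Proof.
elim=> [{}x {}w c nw h|k {}x v {}w c nv _ IH nw h]; first exact: walkS c nw h.
by rewrite addSn; apply: walkS c nv (IH nw h).
Qed.

(** When [3 %| z], [~~ (3 %| u)] and [z + 3 * u > Q], the Farey fractions strictly
between two fractions of denominators [z] and [u] and determinant one have
denominators [p * z + q * u <= Q] with [p] and [q] coprime and [q] equal to 1 or
2.  The first term counts [q = 1], the second one counts [q = 2] with [p] odd. *)
Definition hits (Q z u : nat) : nat :=
  ((Q - u) %/ z + uphalf ((Q - 2 * u) %/ z))%N.

Lemma hits_eq0 (Q z u : nat) : (0 < z)%N -> (Q < z + u)%N -> hits Q z u = 0%N.
Proof. by move=> z0 h; rewrite /hits !divn_small //; lia. Qed.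

(** Effect of inserting the mediant of denominator [z + u]: the interval on the
side of [z] keeps the same shape, and the side of [u] contains at most one more
fraction, of denominator [z + 2 * u]. *)
Lemma hitsS (Q z u : nat) : (0 < z)%N -> (z + u <= Q)%N ->
  hits Q z u = (hits Q z (z + u) + (z + 2 * u <= Q) + 1)%N.
Proof.
move=> z0 h; rewrite /hits.
have -> : (Q - u = Q - (z + u) + z)%N by lia.
rewrite divnDr // divnn z0.
have [h2|h2] := leqP (2 * z + 2 * u) Q.
  have -> : (Q - 2 * u = Q - 2 * (z + u) + z * 2)%N by lia.
  rewrite divnDr ?dvdn_mulr // mulKn // !uphalf_half oddD addbF halfD andbF /=.
  by lia.
have -> : (Q - 2 * (z + u) = 0)%N by lia.
rewrite div0n.
have [h3|h3] := leqP (z + 2 * u) Q.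
  have -> : ((Q - 2 * u) %/ z = 1)%N.
    have -> : (Q - 2 * u = Q - 2 * u - z + z)%N by lia.
    by rewrite divnDr // divnn z0 divn_small //; lia.
  by rewrite /=; lia.
by rewrite (@divn_small (Q - 2 * u)) //=; lia.
Qed.

Lemma ncong_frac (a z k l : int) : 0 < z -> k * z - l * a = 1 ->
  ~~ (3 %| z)%Z -> ~ denq_cong 3 0 (a%:Q / z%:Q).
Proof.
move=> z0 e h; rewrite /denq_cong (denq_frac z0 e) => /eqP.
by rewrite eqz_mod_dvd subr0; apply/negP.
Qed.

(** Induction on [Q - u] along [hitsS]: split at the mediant, recurse towards the
denominator divisible by 3. *)
Lemma walk_from_zero (Q z u : nat) (a b : int) :
  (0 < z <= Q)%N -> (0 < u <= Q)%N -> (3 %| z)%N -> ~~ (3 %| u)%N ->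
  (Q < z + 3 * u)%N -> b * z%:Z - a * u%:Z = 1 ->
  walk Q (hits Q z u).+1 (a%:Q / z%:Q) (b%:Q / u%:Q).
Proof.
move=> hz; have [k] := ubnP (Q - u)%N.
elim: k u b => // k IH u b hk hu z3 u3 big e.
have [h|h] := ltnP Q (z + u).
  by rewrite hits_eq0 //; [apply: walk1; apply: consecutive_of_det; lia | lia].
rewrite (hitsS _ h); last lia.
have IHw := IH (z + u)%N (a + b).
have e2 : (a + b) * z%:Z - a * (z + u)%N%:Z = 1 by lia.
have nc : ~ denq_cong 3 0 ((a + b)%:Q / (z + u)%N%:Q).
  apply: (@ncong_frac _ _ (- a) (- z%:Z)); [lia| rewrite -e2; ring | lia].
have {IHw} := IHw _ _ z3 _ _ e2.
move=> /(_ ltac:(lia) ltac:(lia) ltac:(lia) ltac:(lia)) W.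
have [h2|h2] := leqP (z + 2 * u)%N Q.
  have -> : ((hits Q z (z + u) + true + 1).+1 = (hits Q z (z + u)).+1 + 2)%N by lia.
  apply: walk_cat W nc _.
  have e3 : (a + b + b) * (z + u)%N%:Z - (a + b) * (z + 2 * u)%N%:Z = 1.
    by lia.
  have e4 : b * (z + 2 * u)%N%:Z - (a + b + b) * u%:Z = 1.
    by lia.
  apply: (@walkS _ _ _ ((a + b + b)%:Q / (z + 2 * u)%N%:Q)).
  - by apply: consecutive_of_det => //; lia.
  - by apply: (@ncong_frac _ _ b u) => //; lia.
  - by apply: walk1; apply: consecutive_of_det => //; lia.
have -> : ((hits Q z (z + u) + false + 1).+1 = (hits Q z (z + u)).+1 + 1)%N by lia.
apply: walk_cat W nc _; apply: walk1; apply: consecutive_of_det => //; try lia.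
Qed.

(** Mirror image of [walk_from_zero], with the denominator divisible by 3 at the
right end. *)
Lemma walk_to_zero (Q z u : nat) (a b : int) :
  (0 < z <= Q)%N -> (0 < u <= Q)%N -> (3 %| z)%N -> ~~ (3 %| u)%N ->
  (Q < z + 3 * u)%N -> a * u%:Z - b * z%:Z = 1 ->
  walk Q (hits Q z u).+1 (b%:Q / u%:Q) (a%:Q / z%:Q).
Proof.
move=> hz; have [k] := ubnP (Q - u)%N.
elim: k u b => // k IH u b hk hu z3 u3 big e.
have [h|h] := ltnP Q (z + u).
  by rewrite hits_eq0 //; [apply: walk1; apply: consecutive_of_det; lia | lia].
rewrite (hitsS _ h); last lia.
have IHw := IH (z + u)%N (a + b).
have e2 : a * (z + u)%N%:Z - (a + b) * z%:Z = 1 by lia.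
have nc : ~ denq_cong 3 0 ((a + b)%:Q / (z + u)%N%:Q).
  apply: (@ncong_frac _ _ a z); [lia| rewrite -e2; ring | lia].
have {IHw} := IHw _ _ z3 _ _ e2.
move=> /(_ ltac:(lia) ltac:(lia) ltac:(lia) ltac:(lia)) W.
have [h2|h2] := leqP (z + 2 * u)%N Q.
  have -> : ((hits Q z (z + u) + true + 1).+1 = 2 + (hits Q z (z + u)).+1)%N by lia.
  apply: walk_cat _ nc W.
  have e3 : (a + b) * (z + 2 * u)%N%:Z - (a + b + b) * (z + u)%N%:Z = 1.
    by lia.
  have e4 : (a + b + b) * u%:Z - b * (z + 2 * u)%N%:Z = 1.
    by lia.
  apply: (@walkS _ _ _ ((a + b + b)%:Q / (z + 2 * u)%N%:Q)).
  - by apply: consecutive_of_det => //; lia.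
  - by apply: (@ncong_frac _ _ (a + b) (z + u)%N) => //; lia.
  - by apply: walk1; apply: consecutive_of_det => //; lia.
have -> : ((hits Q z (z + u) + false + 1).+1 = 1 + (hits Q z (z + u)).+1)%N by lia.
apply: walk_cat _ nc W; apply: walk1; apply: consecutive_of_det => //; lia.
Qed.

(** A set of representatives modulo [z] for the denominators of right neighbours
of a fraction of denominator [z]; the bound [Q - z] makes [p * z + 3 * y] larger
than [Q] for all [p > 0]. *)
Definition window (Q z y : nat) : bool :=
  (Q < z + 3 * y)%N && (3 * y <= Q + 2 * z)%N.

(** Number of fractions strictly between a fraction of denominator [z] and the
next one with a denominator divisible by 3, when [y] is the representative of
[window].  After the fraction of denominator [y] the next candidates have
denominators [n * (3 * y) - z]: if one of them is at most [Q], the largest one is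
the end of the gap.  Otherwise the gap passes through [2 * y - z] and ends at
[3 * y - 2 * z]; which of the two intervals next to the middle is subdivided
depends on the sign of [y - z]. *)
Definition gaplen (Q z y : nat) : nat :=
  if (3 * y <= Q + z)%N then
    (hits Q z y + hits Q (3 * ((Q + z) %/ (3 * y)) * y - z) y).+1
  else if (z < y)%N then (hits Q z y).+2
  else (hits Q (3 * y - 2 * z) (2 * y - z)).+2.

Lemma cong_frac (a z k l : int) : 0 < z -> k * z - l * a = 1 ->
  (3 %| z)%Z -> denq_cong 3 0 (a%:Q / z%:Q).
Proof.
move=> z0 e h; rewrite /denq_cong (denq_frac z0 e); apply/eqP.
by rewrite eqz_mod_dvd subr0.
Qed.

(** Concatenation of the walk from denominator [z] to denominator [y] with a walk
to the end of the gap; the end is [n * (3 * b) - a] over [n * (3 * y) - z],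
respectively [3 * b - 2 * a] over [3 * y - 2 * z], if [a] and [b] are the
numerators. *)
Lemma walk_window (Q z y : nat) (a b : int) :
  (0 < z <= Q)%N -> (3 %| z)%N -> window Q z y -> b * z%:Z - a * y%:Z = 1 ->
  exists2 x, denq_cong 3 0 x & walk Q (gaplen Q z y).+1 (a%:Q / z%:Q) x.
Proof.
move=> hz z3 /andP[w1 w2] e.
have y3 : ~~ (3 %| y)%N.
  apply/negP => y3; move: e; have [y' ->] := dvdnP y3; have [z' ->] := dvdnP z3.
  by rewrite !PoszM; lia.
have nc : ~ denq_cong 3 0 (b%:Q / y%:Q).
  by apply: (@ncong_frac _ _ (- a) (- z%:Z)); [lia | lia | lia].
rewrite /gaplen; case: ifP => [h|/negbT]; last rewrite -ltnNge => h.
  set n := (_ %/ _)%N; set z' := (_ - z)%N.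
  have [n1 n2] : (n * (3 * y) <= Q + z /\ Q + z < n.+1 * (3 * y))%N.
    by split; [exact: leq_divM | apply: ltn_ceil; lia].
  have n3 : (3 * y <= n * (3 * y))%N by rewrite leq_pmull // divn_gt0 //; lia.
  have ez : (z + z' = n * (3 * y))%N by rewrite /z'; lia.
  exists ((3 * n%:Z * b - a)%:Q / z'%:Q).
    apply: (@cong_frac _ _ (- b) (- y%:Z)); [lia| |lia].
    rewrite (_ : z'%:Z = n%:Z * (3 * y%:Z) - z%:Z); last lia.
    lia.
  have -> : ((hits Q z y + hits Q z' y).+2 = (hits Q z y).+1 + (hits Q z' y).+1)%N by lia.
  apply: walk_cat (walk_from_zero _ _ _ _ _ e) nc (walk_to_zero _ _ _ _ _ _) => //; try lia.
case: ifP => [h2|h2].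
  exists ((3 * b - 2 * a)%:Q / (3 * y%:Z - 2 * z%:Z)%:Q).
    apply: (@cong_frac _ _ (a - 2 * b) (z%:Z - 2 * y%:Z)); [lia|lia|lia].
  have -> : ((hits Q z y).+3 = (hits Q z y).+1 + 2)%N by lia.
  apply: walk_cat (walk_from_zero _ _ _ _ _ e) nc _ => //; try lia.
  apply: (@walkS _ _ _ ((2 * b - a)%:Q / (2 * y%:Z - z%:Z)%:Q)).
  - by apply: consecutive_of_det; [lia|lia|lia|lia].
  - by apply: (@ncong_frac _ _ (- b) (- y%:Z)); [lia|lia|lia].
  - by apply: walk1; apply: consecutive_of_det; [lia|lia|lia|lia].
have zy : z <> y.
  by move=> zy; move: y3; rewrite -zy z3.
have E1 : ((3 * y - 2 * z)%N%:Z = 3 * y%:Z - 2 * z%:Z) by lia.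
have E2 : ((2 * y - z)%N%:Z = 2 * y%:Z - z%:Z) by lia.
exists ((3 * b - 2 * a)%:Q / (3 * y - 2 * z)%N%:Q).
  by rewrite E1; apply: (@cong_frac _ _ (a - 2 * b) (z%:Z - 2 * y%:Z)); [lia|lia|lia].
have -> : ((hits Q (3 * y - 2 * z) (2 * y - z)).+3 = 1 + (1 + (hits Q (3 * y - 2 * z) (2 * y - z)).+1))%N by lia.
apply: walk_cat (walk1 _) nc _.
  by apply: consecutive_of_det => //; lia.
apply: (@walk_cat _ _ _ _ ((2 * b - a)%:Q / (2 * y - z)%N%:Q) _ (walk1 _)).
- by rewrite E2; apply: consecutive_of_det; [lia|lia|lia|lia].
- by rewrite E2; apply: (@ncong_frac _ _ (- b) (- y%:Z)); [lia|lia|lia].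
- by apply: walk_to_zero; lia.
Qed.

Lemma consecutive_inj (Q : nat) (x y y' : rat) :
  farey_consecutive Q x y -> farey_consecutive Q x y' -> y = y'.
Proof.
move=> [_ Fy xy n1] [_ Fy' xy' n2]; apply/eqP; rewrite eq_le !leNgt.
by apply/andP; split; apply/negP => h; [apply: (n1 y')|apply: (n2 y)] => //; rewrite ?xy ?xy'.
Qed.

(** Successors are unique, so two walks that start together and stop at their
first denominator divisible by 3 have the same length. *)
Lemma walk_inj (Q m n : nat) (x y y' : rat) : denq_cong 3 0 y -> denq_cong 3 0 y' ->
  walk Q m x y -> walk Q n x y' -> m = n.
Proof.
move=> cy cy' W; elim: W n cy => {m x y} [x y c|m x w y c nw _ IH] n cy W.
  case: W c cy => {n x} [x w c' c _|n x w z c' nw _ c].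
    by [].
  by rewrite (consecutive_inj c c').
case: W cy' c nw IH => {n x y'} [x v c' cv c nw _|n x v y' c' nv W cv c nw IH].
  by case: nw; rewrite (consecutive_inj c c').
by congr _.+1; apply: IH => //; rewrite (consecutive_inj c c').
Qed.

Lemma walk_of_gap (Q r : nat) (t : r.+2.-tuple rat) : farey_gap Q r 3 0 t ->
  walk Q r.+1 t`_0 t`_r.+1.
Proof.
move=> [cons _ _ _ nc]; move: (tval t) cons nc => s cons nc {t}.
suff H k i : (i + k.+1 = r.+1)%N -> walk Q k.+1 s`_i s`_r.+1 by apply: (H r 0%N).
elim: k i => [|k IH] i e.
  by rewrite -e addn1;  apply: walk1; apply: cons; lia.
apply: (@walkS _ _ _ s`_i.+1); [by apply: cons; lia|by apply: nc; lia|].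
by apply: IH; lia.
Qed.

Lemma gap_of_walk (Q r : nat) (x y : rat) : 0 < x <= 1 -> denq_cong 3 0 x ->
  denq_cong 3 0 y -> walk Q r.+1 x y -> exists2 t, farey_gap Q r 3 0 t & t`_0 = x.
Proof.
move=> x01 cx cy W.
have [s [ss hs ls ns]] : exists s : seq rat, [/\ size s = r.+2,
    forall i, (i <= r)%N -> farey_consecutive Q s`_i s`_i.+1,
    s`_0 = x /\ s`_r.+1 = y & forall i, (1 <= i <= r)%N -> ~ denq_cong 3 0 s`_i].
  move: r W {cx cy x01}; suff H n : walk Q n x y -> exists s : seq rat, [/\ size s = n.+1,
    forall i, (i < n)%N -> farey_consecutive Q s`_i s`_i.+1,
    s`_0 = x /\ s`_n = y & forall i, (1 <= i < n)%N -> ~ denq_cong 3 0 s`_i].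
    by move=> r; exact: H.
  elim=> {x y} [x y c|k x w y c nw _ [s [ss hs [s0 sk] ns]]].
    exists [:: x; y]; split => //; first by case=> [|[]].
    by move=> i; case: i => [|[]].
  exists (x :: s); split => //=; first by rewrite ss.
    by case=> [|i] hi /=; [rewrite s0 | apply: hs].
  case=> [|[|i]] //= hi; first by rewrite s0.
  by apply: ns; lia.
have sz : size s == r.+2 by rewrite ss.
exists (Tuple sz); last by case: ls.
by case: ls => s0 sr; split; rewrite /= ?s0 ?sr.
Qed.

Lemma gap_tuple_inj (Q r : nat) (t t' : r.+2.-tuple rat) :
  farey_gap Q r 3 0 t -> farey_gap Q r 3 0 t' -> t`_0 = t'`_0 -> t = t'.
Proof.
move=> [c _ _ _ _] [c' _ _ _ _] e; apply: val_inj => /=.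
apply: (@eq_from_nth _ 0); first by rewrite !size_tuple.
move=> i; rewrite size_tuple; elim: i => [//|i IH] hi.
have := c i hi; rewrite IH; last by lia.
by move/consecutive_inj; apply; apply: c'.
Qed.

(** Counting a finite set of fractions or of tuples through a relation that is a
bijection; this avoids writing the correspondence as a function. *)
Lemma card_fset_rel (T : choiceType) (I : finType) (A : set T) (B : {set I})
  (rel : T -> I -> Prop) : finite_set A ->
  (forall x, A x -> exists2 i, i \in B & rel x i) ->
  (forall i, i \in B -> exists2 x, A x & rel x i) ->
  (forall x i j, A x -> rel x i -> rel x j -> i = j) ->
  (forall x y i, A x -> A y -> rel x i -> rel y i -> x = y) ->
  #|` fset_set A | = #|B|.
Proof.
move=> fA AB BA injI injT.
have [f fP] : exists f : I -> option T, forall i, i \in B ->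
    exists2 x, f i = Some x & A x /\ rel x i.
  exists (fun i => match pselect (exists x, A x /\ rel x i) with
    left h => Some (projT1 (cid h)) | right _ => None end) => i iB.
  case: pselect => [h|]; last by case; have [x ? ?] := BA i iB; exists x.
  by exists (projT1 (cid h)) => //; case: (cid h).
have -> : #|B| = #|` [fset f i | i in B]%fset|.
  rewrite card_in_imfset /=; first by rewrite cardE.
  move=> i j iB jB; have [x -> [Ax ri]] := fP i iB; have [y -> [_ rj]] := fP j jB.
  by move=> [xy]; apply: injI Ax ri _; rewrite xy.
have -> : #|` fset_set A| = #|` [fset Some x | x in fset_set A]%fset|.
  by rewrite card_imfset //= => x y [].
congr #|` _ |; apply/fsetP => o; apply/imfsetP/imfsetP => /=.
  move=> [x]; rewrite in_fset_set // inE => Ax ->.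
  have [i iB ri] := AB x Ax; exists i => //.
  by have [y -> [Ay ry]] := fP i iB; congr Some; apply: injT ri ry.
move=> [i iB ->]; have [x -> [Ax _]] := fP i iB; exists x => //.
by rewrite in_fset_set // inE.
Qed.

Definition pairs (Q : nat) (P : nat -> nat -> bool) : {set 'I_Q.+1 * 'I_Q.+1} :=
  [set p : 'I_Q.+1 * 'I_Q.+1 | [&& (3 %| p.1)%N, coprime p.1 p.2 & P p.1 p.2]].

(** [p] is the pair of [x]: the denominator of [x] and the normalized denominator
of the fractions of determinant one with [x] on its right. *)
Definition right_neighbour (Q : nat) (x : rat) (p : 'I_Q.+1 * 'I_Q.+1) : Prop :=
  [/\ p \in pairs Q (window Q), denq x = p.1%:Z &
      exists b : int, b * p.1%:Z - numq x * p.2%:Z = 1].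

Lemma eq_of_dvd_small (k z d : int) : d = z * k -> `|d| < z -> d = 0.
Proof. by move=> ->; have [->|k0] := eqVneq k 0; [rewrite mulr0 | nia]. Qed.

(** Two admissible [y] for the same [x] are congruent modulo [z], and the window
has length [z]. *)
Lemma right_neighbour_inj (Q : nat) (x : rat) (p p' : 'I_Q.+1 * 'I_Q.+1) :
  right_neighbour x p -> right_neighbour x p' -> p = p'.
Proof.
case: p p' => [z y] [z' y'] [/=]; rewrite !inE /= => /and3P[_ _ /andP[w1 w2]] dz [b e].
move=> [/=]; rewrite !inE /= => /and3P[_ _ /andP[w1' w2']] dz' [b' e'].
have ezz : z = z' by apply: val_inj; rewrite /=; lia.
subst z'; congr (_, _); apply: val_inj => /=.
suff : y%:Z - y'%:Z = 0 by lia.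
apply: (@eq_of_dvd_small ((y%:Z - y'%:Z) * b - (b - b') * y%:Z) z%:Z); last by lia.
rewrite -[LHS]mulr1 -{1}e; move: e e'; set a := numq x => e e'.
have -> : (y%:Z - y'%:Z) * (b * z%:Z - a * y%:Z) =
  z%:Z * ((y%:Z - y'%:Z) * b) - (a * y%:Z - a * y'%:Z) * y%:Z by ring.
have -> : a * y%:Z - a * y'%:Z = (b - b') * z%:Z by lia.
by ring.
Qed.

(** Conversely [y] determines the numerator of [x] modulo [z]. *)
Lemma right_neighbour_inj_frac (Q : nat) (x x' : rat) (p : 'I_Q.+1 * 'I_Q.+1) :
  0 < x <= 1 -> 0 < x' <= 1 -> right_neighbour x p -> right_neighbour x' p -> x = x'.
Proof.
have H w : 0 < w <= 1 -> 0 < numq w <= denq w.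
  rewrite -{1 2}[w]divq_num_den => /andP[h1 h2].
  have d0 : (0 : rat) < (denq w)%:Q by rewrite ltr0z denq_gt0.
  rewrite ler_pdivrMr // mul1r ler_int in h2; rewrite h2 andbT.
  by rewrite pmulr_lgt0 ?invr_gt0 // ltr0z in h1.
case: p => z y /H hx /H hx' [_ /= dz [b e]] [_ /= dz' [b' e']].
rewrite -[x]divq_num_den -[x']divq_num_den dz dz'; congr (_%:Q / _).
apply/eqP; rewrite -subr_eq0; apply/eqP.
apply: (@eq_of_dvd_small ((numq x - numq x') * b - (b - b') * numq x) z%:Z); last by lia.
rewrite -[LHS]mulr1 -{1}e; move: e e'; set a := numq x; set a' := numq x' => e e'.
have -> : (a - a') * (b * z%:Z - a * y%:Z) =
  z%:Z * ((a - a') * b) - (a * y%:Z - a' * y%:Z) * a by ring.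
have -> : a * y%:Z - a' * y%:Z = (b - b') * z%:Z by lia.
by ring.
Qed.

Lemma right_neighbour_ex (Q : nat) (x : rat) : farey_cong Q 3 0 x ->
  exists2 p, p \in pairs Q (window Q) & right_neighbour x p.
Proof.
move=> [/farey_extP dQ _ cx].
have d0 := denq_gt0 x.
have [u [v e]] := Bezoutz (numq x) (denq x).
have g1 : gcdz (numq x) (denq x) = 1.
  by have := coprime_num_den x; rewrite -coprimezE /coprimez => /eqP.
rewrite {}g1 in e.
have [z ez] : exists z : nat, denq x = z%:Z by exists `|denq x|%N; rewrite gez0_abs // ltW.
pose N : int := ((Q - z) %/ 3).+1%:Z.
pose y : int := N + ((- u - N) %% z%:Z)%Z.
pose k : int := - ((- u - N) %/ z%:Z)%Z.
have z0 : 0 < z%:Z by rewrite -ez.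
have yk : y = - u + k * z%:Z.
  by rewrite /y /k; have := divz_eq (- u - N) z%:Z; lia.
have m0 : 0 <= ((- u - N) %% z%:Z)%Z by rewrite modz_ge0 // gt_eqF.
have mz : ((- u - N) %% z%:Z)%Z < z%:Z by exact: ltz_pmod.
have [n [n1 n2]] : exists n : nat, N = n%:Z /\ (n = ((Q - z) %/ 3).+1)%N by eexists.
have zQ : (z <= Q)%N by lia.
have yw : Q%:Z - z%:Z < 3 * y <= Q%:Z + 2 * z%:Z.
  by rewrite /y n1 n2; move: m0 mz; lia.
have [w yE] : exists w : nat, y = w%:Z by exists `|y|%N; lia.
have wQ : (w < Q.+1)%N by lia.
have zQ1 : (z < Q.+1)%N by [].
have ee : (v + k * numq x) * z%:Z - numq x * w%:Z = 1.
  by rewrite -yE yk -e ez; ring.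
have pin : (Ordinal zQ1, Ordinal wQ) \in pairs Q (window Q).
  rewrite inE /=; apply/and3P; split.
  - by move: cx; rewrite /denq_cong ez => /eqP; rewrite eqz_mod_dvd subr0.
  - change (coprimez z w); apply/coprimezP.
    by exists (v + k * numq x, - numq x) => /=; lia.
  - by apply/andP; lia.
exists (Ordinal zQ1, Ordinal wQ) => //; split=> //=.
by exists (v + k * numq x).
Qed.

Lemma right_neighbour_ex_frac (Q : nat) (p : 'I_Q.+1 * 'I_Q.+1) :
  p \in pairs Q (window Q) -> exists2 x, farey_cong Q 3 0 x & right_neighbour x p.
Proof.
move=> pin; have := pin; case: p pin => z y pin; rewrite inE /= => /and3P[z3 cop /andP[w1 w2]].
have z0 : 0 < z%:Z.
  by case: (posnP z) => // z0; move: w1 w2; rewrite z0; lia.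
have [u [v e]] := Bezoutz y%:Z z%:Z.
have g1 : gcdz y%:Z z%:Z = 1.
  by move: cop; rewrite coprime_sym /coprime /gcdz /= => /eqP ->.
rewrite {}g1 in e.
pose a : int := 1 + ((- u - 1) %% z%:Z)%Z.
pose k : int := - ((- u - 1) %/ z%:Z)%Z.
have ak : a = - u + k * z%:Z.
  by rewrite /a /k; have := divz_eq (- u - 1) z%:Z; lia.
have m0 : 0 <= ((- u - 1) %% z%:Z)%Z by rewrite modz_ge0 // gt_eqF.
have mz : ((- u - 1) %% z%:Z)%Z < z%:Z by exact: ltz_pmod.
have a1 : 1 <= a <= z%:Z by rewrite /a; lia.
have ee : (v + k * y%:Z) * z%:Z - y%:Z * a = 1 by rewrite ak -e; ring.
have zq : (0 : rat) < z%:Q by rewrite ltr0z.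
exists (a%:Q / z%:Q).
  split.
  - by apply/farey_extP; rewrite (denq_frac z0 ee) lez_nat -ltnS.
  - rewrite divr_gt0 ?ltr0z //=; last by lia.
    by rewrite ler_pdivrMr // mul1r ler_int; lia.
  - by apply: cong_frac ee _ => //.
split=> //=; first by rewrite (denq_frac z0 ee).
by exists (v + k * y%:Z); rewrite (numq_frac z0 ee) -[RHS]ee; lia.
Qed.

Lemma N_cong_pairs (Q : nat) : N_cong Q 3 0 = #|pairs Q (window Q)|.
Proof.
rewrite /N_cong; apply: (card_fset_rel (rel := @right_neighbour Q) (finite_farey_cong Q 3 0)).
- by move=> x /right_neighbour_ex.
- by move=> p /right_neighbour_ex_frac.
- by move=> x i j _; apply: right_neighbour_inj.
- by move=> x y i [_ hx _] [_ hy _]; apply: right_neighbour_inj_frac.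
Qed.

Lemma walk_right_neighbour (Q : nat) (x : rat) (p : 'I_Q.+1 * 'I_Q.+1) :
  right_neighbour x p ->
  exists2 y, denq_cong 3 0 y & walk Q (gaplen Q p.1 p.2).+1 x y.
Proof.
case: p => z y [/=]; rewrite inE /= => /and3P[z3 _ w] dz [b e].
rewrite -[x]divq_num_den dz; apply: (@walk_window _ _ _ _ b) => //.
by have := denq_gt0 x; rewrite dz ltz_nat => ->; have := ltn_ord z; rewrite ltnS.
Qed.

(** A gap is determined by its first fraction, so tuples are counted by the pairs
of their first entries; [walk_inj] identifies the number of intermediate
fractions with [gaplen]. *)
Lemma N_gap_pairs (Q r : nat) : N_gap Q r 3 0 =
  #|pairs Q (fun z y => window Q z y && (gaplen Q z y == r))|.
Proof.
rewrite /N_gap; pose rel (t : r.+2.-tuple rat) p := @right_neighbour Q t`_0 p.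
apply: (card_fset_rel (rel := rel) (finite_farey_gap Q r 3 0)).
- move=> t gt; have [c x01 cx cy _] := gt.
  have [|p pin np] := @right_neighbour_ex Q t`_0.
    by split => //; have [] := c 0%N isT.
  exists p => //; have [y cy' W] := walk_right_neighbour np.
  have := walk_inj cy cy' (walk_of_gap gt) W => -[->].
  by move: pin; rewrite !inE eqxx andbT.
- move=> p; rewrite inE => /and4P[h1 h2 h3 /eqP h4].
  have [|x [_ x01 cx] np] := @right_neighbour_ex_frac Q p; first by rewrite inE h1 h2.
  have [y cy] := walk_right_neighbour np; rewrite h4 => W.
  by have [t gt tx] := gap_of_walk x01 cx cy W; exists t => //; rewrite /rel tx.
- by move=> t i j _; apply: right_neighbour_inj.
- move=> t t' i gt gt' h h'; have [_ x01 _ _ _] := gt; have [_ x01' _ _ _] := gt'.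
  exact: gap_tuple_inj gt gt' (right_neighbour_inj_frac x01 x01' h h').
Qed.

(** * Moebius inversion *)

(** The Moebius function, as a product over prime divisors: adding a prime to [n]
adds one factor. *)
Definition mobius (n : nat) : int :=
  \prod_(p <- primes n) (if (p ^ 2 %| n)%N then 0 else -1).

Lemma mobius_bound (n : nat) : `|mobius n| <= 1.
Proof.
rewrite /mobius; elim/big_rec: _ => [|p x _ h]; first by [].
by case: ifP; lia.
Qed.

Lemma mobius_mul_prime (p e : nat) : prime p -> (0 < e)%N ->
  mobius (p * e) = if (p %| e)%N then 0 else - mobius e.
Proof.
move=> pp e0; have p0 := prime_gt0 pp; have pe0 : (0 < p * e)%N by rewrite muln_gt0 p0.
case: ifP => pe.
  rewrite /mobius (big_rem p) /=; last by rewrite mem_primes pp pe0 dvdn_mulr.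
  by rewrite expnS expn1 dvdn_pmul2l // pe mul0r.
have cpe : coprime p e by rewrite prime_coprime // pe.
have pr : perm_eq (primes (p * e)) (p :: primes e).
  apply: uniq_perm; rewrite /= ?primes_uniq ?mem_primes ?pe ?andbF // => q.
  by rewrite primesM // !inE primes_prime // inE.
rewrite /mobius (perm_big _ pr) /= big_cons expnS expn1 dvdn_pmul2l // pe mulN1r.
congr (- _); apply: eq_big_seq => q; rewrite mem_primes => /and3P[qp _ qe].
rewrite Gauss_dvdr // expnS expn1 -/(_ ^ 2)%N; apply: (@coprimeXl 2).
rewrite prime_coprime // dvdn_prime2 //; apply: contraFN pe => /eqP <- //.
Qed.

(** The divisors [d] of [n] prime to its least prime factor [p] cancel against the
divisors [p * d]; the remaining ones are divisible by [p ^ 2]. *)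
Lemma mobius_sum (N n : nat) : (0 < n <= N)%N ->
  \sum_(1 <= d < N.+1 | (d %| n)%N) mobius d = (n == 1%N)%:Z.
Proof.
move=> /andP[n0 nN].
have [->|n1] := eqVneq n 1%N.
  have N1 : (1 < N.+1)%N by lia.
  rewrite big_ltn_cond ?N1 // dvd1n big_nat_cond big_pred0 ?addr0.
    by rewrite /mobius /= big_nil.
  by move=> d; rewrite dvdn1; lia.
have pp : prime (pdiv n) by apply: pdiv_prime; lia.
set p := pdiv n in pp; have pn : (p %| n)%N := pdiv_dvd n.
have p0 := prime_gt0 pp.
rewrite big_add1 /= big_mkord (bigID (fun d : 'I_N => (p %| d.+1)%N)) /=.
apply/eqP; rewrite addr_eq0 -sumrN; apply/eqP.
pose f (e : 'I_N) : 'I_N := insubd e (p * e.+1).-1.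
pose g (d : 'I_N) : 'I_N := insubd d (d.+1 %/ p).-1.
have fE (e : 'I_N) : (p * e.+1 <= N)%N -> (f e).+1 = (p * e.+1)%N.
  move=> h; rewrite /f val_insubd; case: ifP; lia.
have gE (d : 'I_N) : (p %| d.+1)%N -> ((g d).+1 * p = d.+1)%N.
  move=> h; have q0 : (0 < d.+1 %/ p)%N by rewrite divn_gt0 // dvdn_leq.
  have qd : (d.+1 %/ p <= d.+1)%N by exact: leq_div.
  rewrite /g val_insubd; case: ifP; have := ltn_ord d; first by rewrite prednK // divnK.
  by lia.
rewrite (reindex_onto f g) /=; last first.
  move=> d /andP[_ pd]; apply: val_inj; apply: succn_inj.
  by rewrite fE; rewrite mulnC gE.
rewrite (bigID (fun e : 'I_N => (p %| e.+1)%N)) /= big1 ?add0r; last first.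
  move=> e /andP[/andP[/andP[fn pf] /eqP gf] pe].
  have h : (p * e.+1)%N = (f e).+1 by rewrite -(gE _ pf) gf mulnC.
  by rewrite -h mobius_mul_prime // pe.
apply: eq_big => [e|e /andP[/andP[/andP[fn pf] /eqP gf] pe]]; last first.
  have h : (p * e.+1)%N = (f e).+1 by rewrite -(gE _ pf) gf mulnC.
  by rewrite -h mobius_mul_prime // (negbTE pe).
case pe : (p %| e.+1)%N; rewrite ?andbF //= !andbT.
have cpe : coprime p e.+1 by rewrite prime_coprime // pe.
apply/idP/idP => [/andP[/andP[fn pf] /eqP gf]|en].
  have h : (p * e.+1)%N = (f e).+1 by rewrite -(gE _ pf) gf mulnC.
  by apply: dvdn_trans fn; rewrite -h dvdn_mull.
have pen : (p * e.+1 %| n)%N by rewrite Gauss_dvd // pn.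
have h : (p * e.+1 <= N)%N by apply: leq_trans nN; apply: dvdn_leq.
rewrite fE // pen dvdn_mulr //=; apply/eqP; apply: val_inj; apply: succn_inj.
apply/eqP; rewrite -(eqn_pmul2r p0) gE fE ?dvdn_mulr // mulnC; exact: eqxx.
Qed.

Section Moebius.
Variable R : realType.

(** Points of [P] both of whose coordinates are multiples of [d], when [3] does
not divide [d]; the conditions [3 %| z] and [~~ (3 %| y)] are those satisfied by
the coprime pairs of [pairs]. *)
Definition lattice_count (Q d : nat) (P : nat -> nat -> bool) : R :=
  \sum_(1 <= z < Q.+1 | (3 * d %| z)%N)
    \sum_(1 <= y < Q.+1 | (d %| y)%N && ~~ (3 %| y)%N) (P z y)%:R.

Lemma card_pairs_mobius (Q : nat) (P : nat -> nat -> bool) :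
  (forall y, P 0%N y = false) ->
  #|pairs Q P|%:R = \sum_(1 <= d < Q.+1 | ~~ (3 %| d)%N)
                      (mobius d)%:~R * lattice_count Q d P :> R.
Proof.
move=> P0.
have drop0 (F : nat -> R) : F 0%N = 0 -> \sum_(i < Q.+1) F i = \sum_(1 <= i < Q.+1) F i.
  by move=> F0; rewrite -(big_mkord xpredT) big_ltn // F0 add0r.
have -> : #|pairs Q P|%:R = \sum_(1 <= z < Q.+1) \sum_(1 <= y < Q.+1)
    ([&& (3 %| z)%N, ~~ (3 %| y)%N & P z y] && coprime z y)%:R :> R.
  rewrite -sum1_card natr_sum big_mkcond /=.
  rewrite (eq_bigr (fun p => if (p.1, p.2) \in pairs Q P then 1 else 0 : R)); last by case.
  rewrite -(pair_bigA _ (fun z y : 'I_Q.+1 => if (z, y) \in pairs Q P then 1 else 0 : R)) /=.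
  rewrite -drop0; last by rewrite big1 // => y _; rewrite P0 !andbF.
  apply: eq_bigr => z _.
  have drop0z (F : nat -> R) : F 0%N = 0 -> \sum_(i < Q.+1) F i = \sum_(1 <= i < Q.+1) F i.
    exact: drop0.
  rewrite -drop0; last by rewrite dvdn0 /= andbF.
  apply: eq_bigr => y _; rewrite inE /=.
  case z3 : (3 %| z)%N => //=; case: (P z y) => //=; rewrite ?andbF //= ?andbT.
  case cop : (coprime z y) => //=; rewrite ?andbF // andbT.
  suff -> : ~~ (3 %| y)%N by [].
  apply/negP => y3; have := dvdn_gcd 3 z y; rewrite z3 y3 /=.
  by move: cop; rewrite /coprime => /eqP ->.
transitivity (\sum_(1 <= z < Q.+1) \sum_(1 <= y < Q.+1) \sum_(1 <= d < Q.+1)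
   (if [&& (3 %| z)%N, ~~ (3 %| y)%N, (d %| z)%N & (d %| y)%N]
    then (mobius d)%:~R * (P z y)%:R else 0 : R)).
  apply: eq_big_nat => z /andP[z0 zQ]; apply: eq_big_nat => y /andP[y0 yQ].
  have := @mobius_sum Q (gcdn z y); rewrite gcdn_gt0 z0 /= => /(_ _)/(congr1 (fun i : int => i%:~R : R)) H.
  have gQ : (gcdn z y <= Q)%N by apply: leq_trans (dvdn_leq z0 (dvdn_gcdl z y)) _.
  move: (H gQ); rewrite /coprime rmorph_sum /= big_mkcond /= => E.
  case z3 : (3 %| z)%N => /=; last by rewrite big1.
  case y3 : (3 %| y)%N => /=; first by rewrite big1.
  have -> : (P z y && (gcdn z y == 1%N))%:R = (gcdn z y == 1%N)%:~R * (P z y)%:R :> R.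
    by case: (P z y); case: (_ == _); rewrite /= ?mulr1 ?mulr0.
  rewrite -E mulr_suml; apply: eq_bigr => d _; rewrite dvdn_gcd.
  by case: ifP; rewrite ?mul0r.
transitivity (\sum_(1 <= d < Q.+1) \sum_(1 <= z < Q.+1) \sum_(1 <= y < Q.+1)
   (if [&& (3 %| z)%N, ~~ (3 %| y)%N, (d %| z)%N & (d %| y)%N]
    then (mobius d)%:~R * (P z y)%:R else 0 : R)).
  rewrite exchange_big /= [RHS](eq_bigr (fun d => \sum_(1 <= y < Q.+1) \sum_(1 <= z < Q.+1)
     (if [&& (3 %| z)%N, ~~ (3 %| y)%N, (d %| z)%N & (d %| y)%N]
    then (mobius d)%:~R * (P z y)%:R else 0 : R))); last by move=> d _; rewrite exchange_big.
  rewrite [RHS]exchange_big /=; apply: eq_bigr => y _; exact: exchange_big.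
rewrite [RHS]big_mkcond /=; apply: eq_bigr => d _.
case: ifP => d3; last first.
  rewrite big1 // => z _; rewrite big1 // => y _; case: ifP => // /and4P[_ y3 _ dy].
  by move: y3; rewrite (dvdn_trans _ dy) //; move: d3; case: (3 %| d)%N.
rewrite /lattice_count mulr_sumr [RHS]big_mkcond /=; apply: eq_bigr => z _.
have -> : (3 * d %| z)%N = (3 %| z)%N && (d %| z)%N.
  by rewrite Gauss_dvd // prime_coprime.
case: ifP => [/andP[z3 dz]|h].
  rewrite mulr_sumr [RHS]big_mkcond /=; apply: eq_bigr => y _.
  by rewrite z3 dz /= andbC.
rewrite big1 // => y _; move: h; case: (3 %| z)%N => //=; case: (d %| z)%N => //=.
by rewrite andbF.
Qed.

(** Partial sum of [(8/9 * zeta 2)^-1], the density that coprimality imposes at the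
primes other than 3. *)
Definition mobius_density (Q : nat) : R :=
  \sum_(1 <= d < Q.+1 | ~~ (3 %| d)%N) (mobius d)%:~R / d%:R ^+ 2.

Lemma harmonic_ln (Q : nat) : (0 < Q)%N ->
  \sum_(1 <= d < Q.+1) (d%:R)^-1 <= 1 + ln Q%:R :> R.
Proof.
elim: Q => // -[|Q] IH _; first by rewrite big_nat1 ln1 invr1 addr0.
rewrite big_nat_recr //=; have := IH isT; set S := \sum_(_ <= _ < _) _ => h.
apply: le_trans (lerD h (lexx _)) _; rewrite -addrA lerD2l.
have q0 : (0 : R) < Q.+1%:R by [].
have q0' : (0 : R) < Q.+2%:R by [].
have -> : (Q.+1%:R : R) = Q.+2%:R * (1 + - Q.+2%:R^-1).
  by rewrite mulrDr mulr1 mulrN mulfV ?gt_eqF // -[X in _ = X - 1]natr1 addrK.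
have v1 : - 1 < - (Q.+2%:R^-1) :> R by rewrite ltrN2 invf_lt1 // ltr1n.
rewrite lnM ?posrE //; last by rewrite -ltrBlDl sub0r.
by rewrite -addrA gerDl -lerBrDr sub0r; exact: le_ln1Dx v1.
Qed.

(** Summing the main terms [A / d ^ 2] against the Moebius function gives the
density, and the errors [B / d] add up to a harmonic sum. *)
Lemma card_pairs_approx (Q : nat) (P : nat -> nat -> bool) (A B : R) :
  (0 < Q)%N -> (forall y, P 0%N y = false) -> 0 <= B ->
  (forall d, (0 < d <= Q)%N -> ~~ (3 %| d)%N ->
     `|lattice_count Q d P - A / d%:R ^+ 2| <= B / d%:R) ->
  `| #|pairs Q P|%:R - A * mobius_density Q| <= B * (1 + ln Q%:R).
Proof.
move=> Q0 P0 B0 H; rewrite card_pairs_mobius // /mobius_density mulr_sumr -sumrB.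
apply: le_trans (ler_norm_sum _ _ _) _.
apply: le_trans (ler_wpM2l B0 (harmonic_ln Q0)).
rewrite mulr_sumr big_mkcond /= big_nat [leRHS]big_nat; apply: ler_sum => d dQ.
case: ifP => d3; last by rewrite divr_ge0.
have -> : (mobius d)%:~R * lattice_count Q d P - A * ((mobius d)%:~R / d%:R ^+ 2) =
  (mobius d)%:~R * (lattice_count Q d P - A / d%:R ^+ 2) by ring.
rewrite normrM; apply: le_trans (H d _ d3); last by lia.
apply: ler_piMl; first exact: normr_ge0.
by rewrite -intr_norm lerz1 mobius_bound.
Qed.

(** The term [d = 1] dominates: by telescoping, the sum of [1 / d ^ 2] over
[d >= 2] is at most [3 / 4]. *)
Lemma mobius_density_ge (Q : nat) : (0 < Q)%N -> 4^-1 <= mobius_density Q.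
Proof.
move=> Q0; rewrite /mobius_density big_mkcond /= big_ltn //= /mobius big_nil expr1n divr1.
have H N : (2 <= N)%N -> \sum_(2 <= i < N) (i%:R ^+ 2)^-1 <= 3 / 4 - (N.-1)%:R^-1 + (N == 2%N)%:R / 4 :> R.
  elim: N => // N IH; rewrite leq_eqVlt => /orP[/eqP <-|N2].
    by rewrite big_geq //= invr1; lra.
  have {}N2 : (2 <= N)%N by [].
  rewrite big_nat_recr //=; apply: le_trans (lerD (IH N2) (lexx _)) _.
  have -> : (N.+1 == 2)%N = false by lia.
  move: N2; rewrite leq_eqVlt => /orP[/eqP <-|N2]; first by rewrite /=; lra.
  have -> : (N == 2)%N = false by lia.
  case: N N2 {IH} => // N N2 /=; rewrite mul0r !addr0 -addrA lerD2l.
  have a0 : (0 : R) < N%:R by rewrite ltr0n; lia.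
  rewrite -natr1; set x : R := N%:R in a0 *.
  rewrite -subr_ge0.
  have -> : - (x + 1)^-1 - (- x^-1 + ((x + 1) ^+ 2)^-1) = (x * (x + 1) ^+ 2)^-1.
    by field; lra.
  by rewrite invr_ge0; apply: mulr_ge0; [exact: ltW | apply: exprn_ge0; lra].
set S := \sum_(_ <= _ < _) _.
suff h : `|S| <= 3 / 4 by rewrite ler_norml in h; lra.
apply: le_trans (ler_norm_sum _ _ _) _.
case: (ltnP Q 2) => Q2; first by rewrite big_geq //; lra.
apply: le_trans (_ : \sum_(2 <= i < Q.+1) (i%:R ^+ 2)^-1 <= _).
  apply: ler_sum => d _; case: ifP => _; last by rewrite normr0 invr_ge0 exprn_ge0.
  rewrite normrM [X in _ * X]ger0_norm ?invr_ge0 ?exprn_ge0 //.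
  apply: ler_piMl; first by rewrite invr_ge0 exprn_ge0.
  by rewrite -intr_norm lerz1 mobius_bound.
apply: le_trans (H _ _) _; first by lia.
have -> : (Q.+1 == 2)%N = false by lia.
by rewrite mul0r addr0 gerDl oppr_le0 invr_ge0.
Qed.
End Moebius.

(** * Lattice points in trapezoids *)
Section Cells.
Variable R : realType.

Lemma sum_multiples (e N : nat) (F : nat -> R) : (0 < e)%N ->
  \sum_(1 <= z < N.+1 | (e %| z)%N) F z = \sum_(1 <= i < (N %/ e).+1) F (e * i)%N.
Proof.
move=> e0; elim: N => [|N IH]; first by rewrite div0n !big_geq.
rewrite big_mkcond big_nat_recr //= -big_mkcond /= IH divnS //.
case: (boolP (e %| N.+1)%N) => h; rewrite ?add0n ?addr0 //=.
have E : (e * (N %/ e).+1)%N = N.+1 by rewrite -[RHS](divnK h) divnS // h mulnC.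
by rewrite add1n [RHS]big_nat_recr //= E.
Qed.

Lemma sum_le_cut (n l : nat) (G : nat -> R) : (l <= n)%N ->
  \sum_(1 <= i < n.+1) (i <= l)%:R * G i = \sum_(1 <= i < l.+1) G i.
Proof.
move=> ln; rewrite (@big_cat_nat _ _ _ l.+1) //=.
rewrite [X in _ + X]big_nat_cond [X in _ + X]big1 ?addr0; last first.
  by move=> i /andP[/andP[h _] _]; rewrite leqNgt h mul0r.
by apply: eq_big_nat => i /andP[_ h]; rewrite -ltnS h mul1r.
Qed.

Lemma floor_div (e N : nat) (b : R) : (0 < e)%N -> 0 <= b <= N%:R ->
  exists l : nat, [/\ (l <= N %/ e)%N, (e * l)%:R <= b < (e * l.+1)%:R &
    forall i : nat, ((e * i)%:R <= b) = (i <= l)%N].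
Proof.
move=> e0 /andP[b0 bN]; exists (Num.truncn b %/ e)%N.
have tn i : (i%:R <= b) = (i <= Num.truncn b)%N by rewrite truncn_ge_nat.
have tN : (Num.truncn b <= N)%N.
  by have := truncn_le b; rewrite b0 => h; rewrite -(ler_nat R); apply: le_trans bN.
split; first exact: leq_div2r.
  rewrite tn mulnC leq_divM /= ltNge tn -ltnNge mulnC; exact: ltn_ceil.
by move=> i; rewrite tn leq_divRL // mulnC.
Qed.

Lemma count_multiples (e N : nat) (a b : R) : (0 < e)%N -> 0 <= a <= b -> b <= N%:R ->
  `|\sum_(1 <= y < N.+1 | (e %| y)%N) (a < y%:R <= b)%R%:R - (b - a) / e%:R| <= 1 :> R.
Proof.
move=> e0 /andP[a0 ab] bN.
have [l [lN /andP[l1 l2] lP]] : exists l : nat, [/\ (l <= N %/ e)%N, (e * l)%:R <= b < (e * l.+1)%:R &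
    forall i : nat, ((e * i)%:R <= b) = (i <= l)%N] by apply: floor_div => //; rewrite (le_trans a0).
have [k [kN /andP[k1 k2] kP]] : exists l : nat, [/\ (l <= N %/ e)%N, (e * l)%:R <= a < (e * l.+1)%:R &
    forall i : nat, ((e * i)%:R <= a) = (i <= l)%N] by apply: floor_div => //; rewrite a0 (le_trans ab).
have kl : (k <= l)%N by rewrite -lP; apply: le_trans ab.
rewrite sum_multiples //.
under eq_bigr => i _.
  have -> : (a < (e * i)%:R <= b)%R%:R = (i <= l)%:R * 1 - (i <= k)%:R * 1 :> R.
    rewrite !mulr1 ltNge kP lP.
    by case: (leqP i k) => h; case: (leqP i l) => h' /=; rewrite ?subrr ?subr0 //; lia.
  over.
rewrite sumrB !sum_le_cut // !sumr_const_nat !subn1 /=.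
have ep : (0 : R) < e%:R by rewrite ltr0n.
rewrite -(ler_pM2r ep) mul1r -[X in _ * X <= _](gtr0_norm ep) -normrM.
have -> : (l%:R - k%:R - (b - a) / e%:R) * e%:R = (e * l)%:R - (e * k)%:R - (b - a) :> R.
  by rewrite !natrM; field; rewrite gt_eqF.
rewrite ler_norml.
move: l1 l2 k1 k2; rewrite !mulnSr !natrD; lra.
Qed.

(** Comparison of an affine sum over the multiples of [e] in [(a, b]] with the
integral of the affine function.  The trapezoidal rule is exact between the first
and the last multiple, so only boundary terms remain. *)
Lemma sum_affine_multiples (e N : nat) (a b p q M : R) : (0 < e)%N -> 0 <= a <= b -> b <= N%:R ->
  (forall x, a <= x <= b -> `|p + q * x| <= M) ->
  `|e%:R * \sum_(1 <= z < N.+1 | (e %| z)%N) (a < z%:R <= b)%R%:R * (p + q * z%:R)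
    - (p * (b - a) + q * (b ^+ 2 - a ^+ 2) / 2)| <= 4 * e%:R * M.
Proof.
move=> e0 /andP[a0 ab] bN HM.
have [l [lN /andP[l1 l2] lP]] : exists l : nat, [/\ (l <= N %/ e)%N, (e * l)%:R <= b < (e * l.+1)%:R &
    forall i : nat, ((e * i)%:R <= b) = (i <= l)%N] by apply: floor_div => //; rewrite (le_trans a0).
have [k [kN /andP[k1 k2] kP]] : exists l : nat, [/\ (l <= N %/ e)%N, (e * l)%:R <= a < (e * l.+1)%:R &
    forall i : nat, ((e * i)%:R <= a) = (i <= l)%N] by apply: floor_div => //; rewrite a0 (le_trans ab).
have kl : (k <= l)%N by rewrite -lP; apply: le_trans ab.
rewrite sum_multiples //.
under eq_bigr => i _.
  have -> : (a < (e * i)%:R <= b)%R%:R * (p + q * (e * i)%:R) =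
     (i <= l)%:R * (p + q * (e * i)%:R) - (i <= k)%:R * (p + q * (e * i)%:R) :> R.
    rewrite -mulrBl; congr (_ * _).
    rewrite ltNge kP lP.
    by case: (leqP i k) => h; case: (leqP i l) => h' /=; rewrite ?subrr ?subr0 //; lia.
  over.
rewrite sumrB !sum_le_cut //.
have ar n : \sum_(1 <= i < n.+1) (p + q * (e * i)%:R) = p * n%:R + q * e%:R * n%:R * (n%:R + 1) / 2 :> R.
  elim: n => [|n IH]; first by rewrite big_geq // !mulr0 mul0r mul0r addr0.
  by rewrite big_nat_recr //= IH natrM -natr1; field.
rewrite !ar.
have ep : (0 : R) < e%:R by rewrite ltr0n.
have M0 : 0 <= M by apply: le_trans (HM a _); rewrite ?normr_ge0 ?lexx.
move: l1 l2 k1 k2; rewrite !mulnSr !natrD !natrM; set E : R := e%:R in ep * => l1 l2 k1 k2.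
have mid u v : a <= u -> u <= v -> v <= b -> v - u <= E ->
   `|(v - u) * (p + q * ((u + v) / 2))| <= E * M.
  move=> h1 h2 h3 h4; rewrite normrM; apply: ler_pM => //.
    by rewrite ger0_norm; lra.
  by apply: HM; lra.
have [kl'|kl'] := eqVneq k l.
  rewrite kl' subrr mulr0 sub0r normrN.
  have -> : p * (b - a) + q * (b ^+ 2 - a ^+ 2) / 2 = (b - a) * (p + q * ((a + b) / 2)) by field.
  apply: le_trans (mid a b _ _ _ _) _ => //; first by rewrite kl' in k1 k2; lra.
  by have := mulr_ge0 (ltW ep) M0; lra.
have {kl kl'} : k.+1%:R <= l%:R :> R by rewrite ler_nat ltn_neqAle kl' kl.
rewrite -natr1 => kl.
set K : R := k%:R in k1 k2 kl *; set L : R := l%:R in l1 l2 kl *.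
have kle : E * K + E <= E * L.
  by have := ler_wpM2l (ltW ep) kl; rewrite mulrDr mulr1.
pose x := E * K + E; pose y := E * L.
have -> : E * (p * L + q * E * L * (L + 1) / 2 - (p * K + q * E * K * (K + 1) / 2)) -
   (p * (b - a) + q * (b ^+ 2 - a ^+ 2) / 2) =
   E * ((p + q * x) / 2) + E * ((p + q * y) / 2) - (x - a) * (p + q * ((a + x) / 2))
   - (b - y) * (p + q * ((y + b) / 2)).
  by rewrite /x /y; field.
have h1 := mid a x; have h2 := mid y b.
have {}h1 : `|(x - a) * (p + q * ((a + x) / 2))| <= E * M by apply: h1; rewrite /x; lra.
have {}h2 : `|(b - y) * (p + q * ((y + b) / 2))| <= E * M by apply: h2; rewrite /y; lra.
have hv w : a <= w <= b -> `|E * ((p + q * w) / 2)| <= E * M.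
  move=> hw; rewrite normrM gtr0_norm // ler_pM2l // normrM.
  by have := HM w hw; have := normr_ge0 (p + q * w); rewrite (@ger0_norm R 2^-1) ?invr_ge0 //; lra.
have h3 : `|E * ((p + q * x) / 2)| <= E * M by apply: hv; rewrite /x; lra.
have h4 : `|E * ((p + q * y) / 2)| <= E * M by apply: hv; rewrite /y; lra.
have -> : 4 * E * M = 4 * (E * M) by ring.
move: h1 h2 h3 h4; rewrite !ler_norml; lra.
Qed.

(** Multiples of [d] minus multiples of [3 * d]. *)
Lemma count_multiples_ndiv3 (d N : nat) (a b : R) :
  (0 < d)%N -> ~~ (3 %| d)%N -> 0 <= a <= b -> b <= N%:R ->
  `|\sum_(1 <= y < N.+1 | (d %| y)%N && ~~ (3 %| y)%N) (a < y%:R <= b)%R%:R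
    - 2 / 3 * (b - a) / d%:R| <= 2 :> R.
Proof.
move=> d0 d3 ab bN.
have h1 := count_multiples d0 ab bN.
have h2 : (0 < 3 * d)%N by lia.
have {}h2 := count_multiples h2 ab bN.
have -> : \sum_(1 <= y < N.+1 | (d %| y)%N && ~~ (3 %| y)%N) (a < y%:R <= b)%R%:R =
   \sum_(1 <= y < N.+1 | (d %| y)%N) (a < y%:R <= b)%R%:R -
   \sum_(1 <= y < N.+1 | (3 * d %| y)%N) (a < y%:R <= b)%R%:R :> R.
  rewrite [LHS]big_mkcond [X in _ = X - _]big_mkcond [X in _ = _ - X]big_mkcond -sumrB /=; apply: eq_bigr => y _.
  rewrite Gauss_dvd ?prime_coprime // andbC.
  by case: (3 %| y)%N; case: (d %| y)%N; rewrite /= ?subr0 ?subrr.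
move: h1 h2; rewrite natrM.
have dp : (0 : R) < d%:R by rewrite ltr0n.
have -> : (b - a) / (3%:R * d%:R) = (b - a) / d%:R / 3 by field; rewrite gt_eqF.
have -> : 2 / 3 * (b - a) / d%:R = 2 / 3 * ((b - a) / d%:R) by rewrite mulrA.
rewrite !ler_norml; set X := \sum_(_ <= _ < _ | _) _; set Y := \sum_(_ <= _ < _ | _) _; set Z := _ / d%:R; lra.
Qed.

(** The trapezoid [dz1 / cz1 < x <= dz2 / cz2],
[(fy1 + gy1 * x) / ey1 < t <= (fy2 + gy2 * x) / ey2] in the coordinates
[x = z / Q], [t = y / Q].  Integer coefficients make membership of [(z, y)] a
linear condition in [Q], [z] and [y], so that it can be decided by linear
arithmetic. *)
Record cell := Cell { cz1 : int; dz1 : int; cz2 : int; dz2 : int;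
  ey1 : int; fy1 : int; gy1 : int; ey2 : int; fy2 : int; gy2 : int }.

Definition incell (c : cell) (Q z y : nat) : bool :=
  [&& dz1 c * Q%:Z < cz1 c * z%:Z, cz2 c * z%:Z <= dz2 c * Q%:Z,
      fy1 c * Q%:Z + gy1 c * z%:Z < ey1 c * y%:Z & ey2 c * y%:Z <= fy2 c * Q%:Z + gy2 c * z%:Z].

Definition low (c : cell) (x : R) : R := ((fy1 c)%:~R + (gy1 c)%:~R * x) / (ey1 c)%:~R.
Definition high (c : cell) (x : R) : R := ((fy2 c)%:~R + (gy2 c)%:~R * x) / (ey2 c)%:~R.
Definition left (c : cell) : R := (dz1 c)%:~R / (cz1 c)%:~R.
Definition right (c : cell) : R := (dz2 c)%:~R / (cz2 c)%:~R.

(** The integral of [high c - low c] from [left c] to [right c]. *)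
Definition area (c : cell) : R :=
  let p := (fy2 c)%:~R / (ey2 c)%:~R - (fy1 c)%:~R / (ey1 c)%:~R in
  let q := (gy2 c)%:~R / (ey2 c)%:~R - (gy1 c)%:~R / (ey1 c)%:~R in
  p * (right c - left c) + q * (right c ^+ 2 - left c ^+ 2) / 2.

Definition good_cell (c : cell) : Prop :=
  [/\ 0 < cz1 c, 0 < cz2 c, 0 < ey1 c, 0 < ey2 c & 0 <= dz1 c] /\
  [/\ left c <= right c, right c <= 1 &
   forall x : R, left c <= x <= right c -> [/\ 0 <= low c x, low c x <= high c x & high c x <= 1]].

Lemma incellE (c : cell) (Q z y : nat) : good_cell c -> (0 < Q)%N ->
  incell c Q z y = (left c * Q%:R < z%:R <= right c * Q%:R) &&
    (Q%:R * low c (z%:R / Q%:R) < y%:R <= Q%:R * high c (z%:R / Q%:R)).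
Proof.
move=> [[c1 c2 e1 e2 _] _] Q0; have q0 : (0 : R) < Q%:R by rewrite ltr0n.
have cc1 : (0 : R) < (cz1 c)%:~R by rewrite ltr0z.
have cc2 : (0 : R) < (cz2 c)%:~R by rewrite ltr0z.
have ee1 : (0 : R) < (ey1 c)%:~R by rewrite ltr0z.
have ee2 : (0 : R) < (ey2 c)%:~R by rewrite ltr0z.
rewrite /incell /left /right /low /high -andbA.
congr [&& _, _, _ & _].
- by rewrite mulrAC ltr_pdivrMr // -(ltr_int R) !rmorphM /= [RHS]/= mulrC [in RHS]mulrC mulrC [X in _ = (_ < X)]mulrC.
- by rewrite mulrAC ler_pdivlMr // -(ler_int R) !rmorphM /= [X in (X <= _)]mulrC.
- rewrite mulrA ltr_pdivrMr // mulrDr mulrCA [Q%:R * (_ / _)]mulrC mulfVK ?gt_eqF //.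
  by rewrite -(ltr_int R) rmorphD !rmorphM /= [X in _ = (_ < X)]mulrC [X in _ = (X + _ < _)]mulrC.
- rewrite mulrA ler_pdivlMr // mulrDr mulrCA [Q%:R * (_ / _)]mulrC mulfVK ?gt_eqF //.
  by rewrite -(ler_int R) rmorphD !rmorphM /= [X in _ = (X <= _)]mulrC [X in _ = (_ <= X + _)]mulrC.
Qed.

(** Sum over the columns: each column of abscissa [z] contains about
[2 / (3 * d)] times its length, and there is one column out of [3 * d]. *)
Lemma lattice_count_cell (c : cell) (Q d : nat) : good_cell c ->
  (0 < d <= Q)%N -> ~~ (3 %| d)%N ->
  `|lattice_count R Q d (incell c Q) - 2 / 9 * area c * Q%:R ^+ 2 / d%:R ^+ 2| <= 4 * Q%:R / d%:R.
Proof.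
move=> gc /andP[d0 dQ] d3; have Q0 : (0 < Q)%N by exact: leq_trans dQ.
have q0 : (0 : R) < Q%:R by rewrite ltr0n.
have dp : (0 : R) < d%:R by rewrite ltr0n.
have [[c1 c2 e1 e2 p1] [lr r1 H]] := gc.
have l0 : 0 <= left c by rewrite /left divr_ge0 ?ler0z // ltW.
pose p := ((fy2 c)%:~R / (ey2 c)%:~R - (fy1 c)%:~R / (ey1 c)%:~R) * Q%:R : R.
pose q := (gy2 c)%:~R / (ey2 c)%:~R - (gy1 c)%:~R / (ey1 c)%:~R : R.
have pq x : p + q * x = Q%:R * (high c (x / Q%:R) - low c (x / Q%:R)).
  rewrite /p /q /high /low; field.
  by rewrite ?gt_eqF ?ltr0z.
have e3 : (0 < 3 * d)%N by lia.
have hA : 0 <= left c * Q%:R <= right c * Q%:R.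
  by apply/andP; split; [apply: mulr_ge0 => //; exact: ltW | apply: ler_wpM2r => //; exact: ltW].
have hB : right c * Q%:R <= Q%:R by rewrite ger_pMl.
have hx x : left c * Q%:R <= x <= right c * Q%:R -> left c <= x / Q%:R <= right c.
  by rewrite ler_pdivlMr // ler_pdivrMr.
have hM x : left c * Q%:R <= x <= right c * Q%:R -> `|p + q * x| <= Q%:R.
  move=> /hx/H[h1 h2 h3]; rewrite pq normrM gtr0_norm // ger_pMr //.
  by rewrite ger0_norm; lra.
have S := sum_affine_multiples e3 hA hB hM.
set T := \sum_(_ <= _ < _ | _) _ in S.
have D : `|lattice_count R Q d (incell c Q) - 2 / 3 / d%:R * T| <= 2 * (Q%:R / (3 * d)%:R).
  rewrite /lattice_count /T mulr_sumr -sumrB.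
  apply: le_trans (ler_norm_sum _ _ _) _.
  apply: le_trans (_ : \sum_(1 <= z < Q.+1 | (3 * d %| z)%N) 2 <= _); last first.
    rewrite -[X in \sum_(_ <= _ < _ | _) X]mulr1 -mulr_sumr ler_pM2l //.
    rewrite sum_multiples // sumr_const_nat subn1 /=.
    by rewrite ler_pdivlMr ?ltr0n // -natrM ler_nat leq_divM.
  rewrite big_nat_cond [leRHS]big_nat_cond; apply: ler_sum => z /andP[/andP[z0 zQ] _].
  under eq_bigr => y _ do rewrite incellE //.
  case hz : (left c * Q%:R < z%:R <= right c * Q%:R); last first.
    by rewrite /= big1 // mul0r mulr0 subr0 normr0.
  have hz' : left c * Q%:R <= z%:R <= right c * Q%:R by case/andP: hz => /ltW -> ->.
  have [h1 h2 h3] := H _ (hx _ hz').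
  rewrite mul1r /= pq.
  have -> : 2 / 3 / d%:R * (Q%:R * (high c (z%:R / Q%:R) - low c (z%:R / Q%:R))) =
     2 / 3 * (Q%:R * high c (z%:R / Q%:R) - Q%:R * low c (z%:R / Q%:R)) / d%:R by field; rewrite gt_eqF.
  apply: count_multiples_ndiv3 => //.
    by apply/andP; split; [apply: mulr_ge0 => //; exact: ltW | apply: ler_wpM2l => //; exact: ltW].
  by rewrite ger_pMr.
set K := lattice_count _ _ _ _ in D *.
rewrite natrM in S D.
have -> : K - 2 / 9 * area c * Q%:R ^+ 2 / d%:R ^+ 2 =
  (K - 2 / 3 / d%:R * T) + 2 / 9 / d%:R ^+ 2 * (3%:R * d%:R * T - area c * Q%:R ^+ 2).
  by field; rewrite gt_eqF.
have -> : area c * Q%:R ^+ 2 = p * (right c * Q%:R - left c * Q%:R) +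
     q * ((right c * Q%:R) ^+ 2 - (left c * Q%:R) ^+ 2) / 2.
  by rewrite /area /p /q /=; field; rewrite ?intr_eq0 ?gt_eqF.
apply: le_trans (ler_normD _ _) _.
have k0 : 0 <= 2 / 9 / d%:R ^+ 2 :> R by rewrite divr_ge0 ?exprn_ge0 // divr_ge0.
rewrite [X in _ + X]normrM (ger0_norm k0).
apply: le_trans (lerD D (ler_wpM2l k0 S)) _.
have -> : 2 * (Q%:R / (3%:R * d%:R)) + 2 / 9 / d%:R ^+ 2 * (4 * (3%:R * d%:R) * Q%:R) =
  10 / 3 * (Q%:R / d%:R) :> R by field; rewrite gt_eqF.
rewrite -[leRHS]mulrA; apply: ler_wpM2r; first by rewrite divr_ge0 // ltW.
lra.
Qed.

Lemma card_pairs_cell (c : cell) (Q : nat) : good_cell c -> (0 < Q)%N ->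
  `| #|pairs Q (incell c Q)|%:R - 2 / 9 * area c * Q%:R ^+ 2 * mobius_density R Q|
  <= 4 * Q%:R * (1 + ln Q%:R).
Proof.
move=> gc Q0; apply: card_pairs_approx => //.
- move=> y; have [[_ _ _ _ h] _] := gc; apply/negbTE/negP => /and4P[h1 _ _ _].
  by move: h1; rewrite mulr0 ltNge mulr_ge0.
- by move=> d dQ d3; apply: lattice_count_cell.
Qed.
End Cells.

(** * Lattice points in the triangles of the corner *)
Section Tents.
Variable R : realType.

(** Near the corner [(1, 0)] of the window the gap ends at the denominator
[z' = 3 * n * y - z] with [n >= 2], and the two ends are constrained by
[i * y <= Q - z < i.+1 * y] and [j * y <= Q - z' < j.+1 * y].  For fixed [i], [j]
this is a union of regions indexed by [n]. *)
Definition tail_cell (i j Q z y : nat) : bool :=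
  let n := ((Q + z) %/ (3 * y))%N in
  [&& (2 <= n)%N, (i * y + z <= Q)%N, (Q < i.+1 * y + z)%N,
      (j * y + 3 * n * y <= Q + z)%N & (Q + z < j.+1 * y + 3 * n * y)%N].

(** For given [y] and [n], the length of the interval of [z] allowed by
[tail_cell i j], with [h = 3 * n + i + j + 1]: the intersection of two intervals
of length [y] whose centres are at distance [|2 * Q - h * y|]. *)
Definition tent (Q h y : R) : R := Num.max 0 (y - `|2 * Q - h * y|).

(** A tent is a second difference of hinge functions, for which sums over
multiples are easy to evaluate. *)
Lemma tent_hinge (Q h y : R) : 0 <= y ->
  tent Q h y = Num.max 0 ((h + 1) * y - 2 * Q) - 2 * Num.max 0 (h * y - 2 * Q)
    + Num.max 0 ((h - 1) * y - 2 * Q).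
Proof.
move=> y0; rewrite /tent.
have -> : (h + 1) * y = h * y + y by ring.
have -> : (h - 1) * y = h * y - y by ring.
move: (h * y) => w.
case: (lerP 0 (2 * Q - w)) => h1; case: (lerP 0 (y - _)) => h2;
 case: (lerP 0 (w + y - 2 * Q)) => h3; case: (lerP 0 (w - 2 * Q)) => h4;
 case: (lerP 0 (w - y - 2 * Q)) => h5;
 move: h2; rewrite ?(ger0_norm h1) ?(ltr0_norm h1) => h2; lra.
Qed.

(** The summands form an arithmetic progression from the first multiple past the
hinge on, and the position of the hinge between two multiples costs at most
[p * e ^ 2]. *)
Lemma hinge_sum (p e c : R) (N : nat) : 0 < p -> 0 < e -> 0 <= c -> c <= p * (e * N%:R) ->
  `|e * \sum_(1 <= i < N.+1) Num.max 0 (p * (e * i%:R) - c)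
    - (e * (p * (e * N%:R) - c) / 2 + (p * (e * N%:R) - c) ^+ 2 / p / 2)| <= p * e ^+ 2.
Proof.
move=> p0 e0 c0 cN.
have pe0 : 0 < p * e by exact: mulr_gt0.
have [k [kc1 kc2]] : exists k : nat, (p * e) * k%:R <= c < (p * e) * k%:R + p * e /\ (k <= N)%N.
  have x0 : 0 <= c / (p * e) by rewrite divr_ge0 // ltW.
  have /andP[h1 h2] := truncn_itv x0; exists (Num.truncn (c / (p * e))).
  move: (Num.truncn _) h1 h2 => k h1 h2.
  rewrite ler_pdivlMr // in h1; rewrite ltr_pdivrMr // -natr1 in h2.
  split; first by apply/andP; split; lra.
  rewrite -(ler_nat R) -(ler_pM2l pe0).
  by apply: (@le_trans _ _ c); lra.
pose t := c - p * e * k%:R.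
have [t0 t1] : 0 <= t /\ t < p * e by rewrite /t; split; lra.
have -> : \sum_(1 <= i < N.+1) Num.max 0 (p * (e * i%:R) - c) =
   (N%:R - k%:R) * (p * e * (N%:R - k%:R + 1) / 2 - t).
  rewrite (@big_cat_nat _ _ _ k.+1) //= [X in X + _]big_nat_cond [X in X + _]big1 ?add0r; last first.
    move=> i /andP[/andP[_ ik] _]; apply/max_idPl; rewrite subr_le0.
    apply: le_trans (_ : p * e * k%:R <= _); last by case/andP: kc1.
    by rewrite mulrA ler_pM2l // ler_nat.
  have -> : \sum_(k.+1 <= i < N.+1) Num.max 0 (p * (e * i%:R) - c) =
            \sum_(k.+1 <= i < N.+1) (p * e * i%:R - c).
    apply: eq_big_nat => i /andP[ki _]; rewrite mulrA; apply/max_idPr; rewrite subr_ge0.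
    apply: le_trans (_ : p * e * k.+1%:R <= _); last by rewrite ler_pM2l // ler_nat.
    by rewrite -natr1; case/andP: kc1 => _ /ltW; lra.
  rewrite /t; elim: {cN} N kc2 => [|N IH].
    by rewrite leqn0 => /eqP ->; rewrite big_geq // subrr mul0r.
  rewrite leq_eqVlt => /orP[/eqP ->|]; first by rewrite big_geq // subrr mul0r.
  by rewrite ltnS => kN; rewrite big_nat_recr //= IH // -natr1; field.
set n := N%:R - k%:R; set X := p * (e * N%:R).
have -> : X - c = p * e * n - t by rewrite /X /t /n; ring.
have -> : e * (n * (p * e * (n + 1) / 2 - t)) -
   (e * (p * e * n - t) / 2 + (p * e * n - t) ^+ 2 / p / 2) = t * (p * e - t) / p / 2.
  by field; rewrite gt_eqF.
have h0 : 0 <= t * (p * e - t) by apply: mulr_ge0; lra.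
rewrite ger0_norm; last by rewrite !divr_ge0 // ltW.
rewrite -mulrA -invfM ler_pdivrMr; last by rewrite mulr_gt0.
have : t * (p * e - t) <= (p * e) * (p * e) by apply: ler_pM; lra.
have : 0 <= (p * e) * (p * e) by apply: mulr_ge0; exact: ltW.
rewrite expr2; lra.
Qed.

(** Area of the triangle [0 <= x <= tent 1 h t]. *)
Definition tri_area (h : R) : R := 4 / ((h - 1) * h * (h + 1)).

Lemma tent_sum (Q e h : nat) : (0 < e <= Q)%N -> (7 <= h)%N ->
  `|e%:R * (\sum_(1 <= y < Q.+1 | (e %| y)%N) tent Q%:R h%:R y%:R)
     - Q%:R ^+ 2 * tri_area h%:R| <= 4 * h%:R * e%:R ^+ 2 :> R.
Proof.
move=> /andP[e0 eQ] h7; rewrite sum_multiples //.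
set N := (Q %/ e)%N.
have ep : (0 : R) < e%:R by rewrite ltr0n.
have hp : (7 : R) <= h%:R by rewrite (ler_nat R 7).
have qp : (0 : R) <= 2 * Q%:R by rewrite mulr_ge0.
have NQ : Q%:R <= 2 * (e%:R * N%:R) :> R.
  rewrite -natrM -(natrM R 2) ler_nat.
  have := ltn_ceil Q e0; have := divn_gt0 Q e0; rewrite eQ -/N; nia.
have eN : 0 <= e%:R * N%:R :> R by rewrite mulr_ge0 // ltW.
have H (p : R) : 6 <= p -> `|e%:R * \sum_(1 <= i < N.+1) Num.max 0 (p * (e%:R * i%:R) - 2 * Q%:R)
    - (e%:R * (p * (e%:R * N%:R) - 2 * Q%:R) / 2 + (p * (e%:R * N%:R) - 2 * Q%:R) ^+ 2 / p / 2)| <= p * e%:R ^+ 2.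
  move=> p6; apply: hinge_sum => //; first by lra.
  have := ler_wpM2r eN p6; lra.
have H1 := H (h%:R + 1); have H2 := H h%:R; have H3 := H (h%:R - 1).
have {}H1 := H1 ltac:(lra); have {}H2 := H2 ltac:(lra); have {}H3 := H3 ltac:(lra).
have -> : \sum_(1 <= i < N.+1) tent Q%:R h%:R (e * i)%:R =
   \sum_(1 <= i < N.+1) Num.max 0 ((h%:R + 1) * (e%:R * i%:R) - 2 * Q%:R)
   - 2 * \sum_(1 <= i < N.+1) Num.max 0 (h%:R * (e%:R * i%:R) - 2 * Q%:R)
   + \sum_(1 <= i < N.+1) Num.max 0 ((h%:R - 1) * (e%:R * i%:R) - 2 * Q%:R) :> R.
  rewrite mulr_sumr -sumrB -big_split; apply: eq_bigr => i _ /=.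
  by rewrite tent_hinge ?natrM.
move: H1 H2 H3.
set S1 := \sum_(_ <= _ < _) _; set S2 := \sum_(_ <= _ < _) _; set S3 := \sum_(_ <= _ < _) _.
set X := e%:R * N%:R; set q := Q%:R; set E := e%:R in ep *.
have -> : q ^+ 2 * tri_area h%:R =
  (E * ((h%:R + 1) * X - 2 * q) / 2 + ((h%:R + 1) * X - 2 * q) ^+ 2 / (h%:R + 1) / 2)
  - 2 * (E * (h%:R * X - 2 * q) / 2 + (h%:R * X - 2 * q) ^+ 2 / h%:R / 2)
  + (E * ((h%:R - 1) * X - 2 * q) / 2 + ((h%:R - 1) * X - 2 * q) ^+ 2 / (h%:R - 1) / 2).
  rewrite /tri_area; field; apply/and3P; split; apply/eqP; lra.
set M1 := (_ / 2 + _ / 2); set M2 := (_ / 2 + _ / 2); set M3 := (_ / 2 + _ / 2).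
rewrite !ler_norml; lra.
Qed.

(** [S] is the sum over [n >= 2] of the areas of the triangles of index
[h = 3 * n + s], stated with a rate of convergence. *)
Definition tail_series (s : nat) (S : R) : Prop := forall M : nat, (2 <= M)%N ->
  0 <= S - \sum_(2 <= n < M) tri_area (3 * n + s)%:R <= (M%:R ^+ 2)^-1.

Lemma tent_support (s Q n y : nat) : (1 <= s)%N -> tent Q%:R (3 * n + s)%:R y%:R != 0 :> R ->
  ((3 * n + s).-1 * y <= 2 * Q)%N /\ (2 * Q <= (3 * n + s).+1 * y)%N.
Proof.
move=> s1; rewrite /tent; case: leP => [h _|h]; last by rewrite eqxx.
have {h} : `|2 * Q%:R - (3 * n + s)%:R * y%:R| <= y%:R :> R by rewrite subr_ge0 in h.
have [h ->] : exists h, (3 * n + s = h.+1)%N by exists (3 * n + s).-1; lia.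
rewrite /= -!(ler_nat R) !natrM -(natr1 h.+1) -(natr1 h) ler_norml => /andP[h1 h2].
by split; lra.
Qed.

Lemma tent_le (Q h y : R) : 0 <= y -> 0 <= tent Q h y <= y.
Proof.
move=> y0; have := normr_ge0 (2 * Q - h * y); rewrite /tent.
by case: (lerP 0 (y - _)); lra.
Qed.

(** The supports of the tents of indices congruent modulo 3 do not overlap: [h]
is confined to an interval of length 2 around [2 * Q / y]. *)
Lemma tent_disjoint (s Q a b y : nat) : (1 <= s)%N -> (0 < y)%N ->
  \sum_(a <= n < b) ((((3 * n + s).-1 * y <= 2 * Q) && (2 * Q <= (3 * n + s).+1 * y))%N)%:R <= 1 :> R.
Proof.
move=> s1 y0; pose k := ((2 * Q) %/ y)%N.
apply: le_trans (_ : \sum_(a <= n < b) (n == (k.+1 - s) %/ 3)%N%:R <= _).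
  apply: ler_sum => n _; rewrite ler_nat.
  case h : (_ && _) => //; move/andP: h => [h1 h2].
  suff -> : n == ((k.+1 - s) %/ 3)%N by [].
  have k1 : ((3 * n + s).-1 <= k)%N by rewrite leq_divRL.
  have k2 : (k <= (3 * n + s).+1)%N.
    by rewrite -ltnS ltn_divLR // mulSn; lia.
  by lia.
rewrite -natr_sum (lern1 R _) /=; set m := (_ %/ _)%N.
have [h|h] := boolP (a <= m < b)%N.
  rewrite (bigD1_seq m) ?mem_index_iota ?iota_uniq //= eqxx big1 // => i; case: eqP => //.
rewrite big_nat_cond big1 //= => i /andP[hi _]; case: eqP => // e; move: h; by rewrite -e hi.
Qed.
End Tents.

Section TailCells.
Variable R : realType.

Lemma sum_natr_eq_le1 (N : nat) (P : pred nat) (a : R) :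
  \sum_(1 <= z < N.+1 | P z) (z%:R == a)%:R <= 1 :> R.
Proof.
elim: N => [|N IH]; first by rewrite big_geq.
rewrite big_mkcond big_nat_recr //= -big_mkcond /=.
case: ifP => _; last by rewrite addr0.
case: eqP => [<-|_]; last by rewrite addr0.
rewrite big_nat_cond big1 ?add0r // => z /andP[/andP[_ zN] _].
by rewrite eqr_nat ltn_eqF.
Qed.

Lemma count_between (e N : nat) (a b : R) (P : nat -> bool) : (0 < e)%N ->
  0 <= a <= b -> b <= N%:R -> (forall z, P z -> a <= z%:R <= b) ->
  (forall z, a < z%:R < b -> P z) ->
  `|\sum_(1 <= z < N.+1 | (e %| z)%N) (P z)%:R - (b - a) / e%:R| <= 2 :> R.
Proof.
move=> e0 ab bN h1 h2.
have h3 := count_multiples e0 ab bN.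
have hu : \sum_(1 <= z < N.+1 | (e %| z)%N) (P z)%:R <= \sum_(1 <= z < N.+1 | (e %| z)%N) (a < z%:R <= b)%R%:R + 1 :> R.
  apply: le_trans (lerD (lexx _) (sum_natr_eq_le1 N (fun z => e %| z)%N a)).
  rewrite -big_split; apply: ler_sum => z _ /=.
  case hP : (P z); last by rewrite addr_ge0.
  have /andP[az zb] := h1 _ hP; rewrite zb andbT lt_neqAle az andbT eq_sym.
  by case: eqP; rewrite /= ?addr0 ?add0r.
have hl : \sum_(1 <= z < N.+1 | (e %| z)%N) (a < z%:R <= b)%R%:R <= \sum_(1 <= z < N.+1 | (e %| z)%N) (P z)%:R + 1 :> R.
  apply: le_trans (lerD (lexx _) (sum_natr_eq_le1 N (fun z => e %| z)%N b)).
  rewrite -big_split; apply: ler_sum => z _ /=.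
  case hz : (a < z%:R <= b)%R; last by rewrite addr_ge0.
  move/andP: hz => [az]; rewrite le_eqVlt => /orP[->|zb]; first by rewrite lerDr.
  by rewrite h2 ?az // lerDl.
move: h3; rewrite !ler_norml; lra.
Qed.

Definition tail_index (i j Q n z y : nat) : bool :=
  [&& (i * y + z <= Q)%N, (Q < i.+1 * y + z)%N,
      (j * y + 3 * n * y <= Q + z)%N & (Q + z < j.+1 * y + 3 * n * y)%N].

(** The index [n] of [tail_cell] can be made a free variable, since at most one
value fits. *)
Lemma tail_cell_index (i j Q z y : nat) : (j <= 2)%N -> (0 < y)%N ->
  (tail_cell i j Q z y)%:R = \sum_(2 <= n < Q.+2) (tail_index i j Q n z y)%:R :> R.
Proof.
move=> j2 y0; set n0 := ((Q + z) %/ (3 * y))%N.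
have H n : tail_index i j Q n z y -> n = n0.
  move=> /and4P[h1 h2 h3 h4]; apply/eqP; rewrite eqn_leq /n0.
  have jy : (j * y <= 2 * y)%N by rewrite leq_mul2r j2 orbT.
  by apply/andP; split; [rewrite leq_divRL | rewrite -ltnS ltn_divLR]; lia.
have E : tail_cell i j Q z y = (2 <= n0)%N && tail_index i j Q n0 z y by [].
case T : (tail_cell i j Q z y); move: T; rewrite E.
  move=> /andP[n2 T].
  have nQ : (n0 < Q.+2)%N.
    rewrite /n0 ltn_divLR ?muln_gt0 //; move: T => /and4P[h1 _ _ _]; nia.
  rewrite (bigD1_seq n0) ?mem_index_iota ?iota_uniq ?n2 ?nQ //= T big1 ?addr0 // => n.
  by case T' : (tail_index i j Q n z y) => //; rewrite (H _ T') eqxx.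
move=> /negbT T; rewrite big_nat_cond big1 // => n /andP[/andP[n2 _] _].
case T' : (tail_index i j Q n z y) => //; move: T; rewrite -(H _ T') n2 T' //.
Qed.

(** Whether the constraint from [z] or the one from [z'] cuts first depends on the
sign of [2 * Q - h * y]; in both cases the admissible [z] form an interval of
length [tent Q h y]. *)
Lemma count_tail_index (i j Q d n y : nat) : (i <= 2)%N -> (j <= 2)%N -> (2 <= n)%N ->
  (0 < y)%N -> (0 < d)%N ->
  `|\sum_(1 <= z < Q.+1 | (3 * d %| z)%N) (tail_index i j Q n z y)%:R
    - tent Q%:R (3 * n + (i + j).+1)%:R y%:R / (3 * d%:R)|
  <= 2 * ((((3 * n + (i + j).+1).-1 * y <= 2 * Q)
           && (2 * Q <= (3 * n + (i + j).+1).+1 * y))%N)%:R :> R.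
Proof.
move=> i2 j2 n2 y0 d0; set h := (3 * n + (i + j).+1)%N.
have yp : (0 : R) <= y%:R by [].
have d3 : (0 < 3 * d)%N by lia.
case hs : (_ && _); last first.
  have -> : tent Q%:R h%:R y%:R = 0 :> R.
    apply/eqP; apply: contraFT hs => /tent_support; rewrite /h.
    by move=> /(_ isT)[-> ->].
  rewrite mul0r subr0 mulr0 big1 ?normr0 // => z _.
  case T : (tail_index i j Q n z y) => //; move: T hs => /and4P[h1 h2 h3 h4].
  by rewrite /h; nia.
rewrite mulr1; move/andP: hs => [s1 s2].
pose q : R := Q%:R; pose Y : R := y%:R; pose I : R := i%:R; pose J : R := j%:R; pose N3 : R := (3 * n)%:R.
have hE : h%:R = N3 + I + J + 1 :> R by rewrite /h addnS -natr1 (natrD _ (3 * n)) (natrD _ i) addrA.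
have {}s1 : (N3 + I + J) * Y <= 2 * q.
  have -> : (N3 + I + J) * Y = (h.-1 * y)%:R by rewrite natrM /h addnS /= (natrD _ (3 * n)) (natrD _ i) addrA.
  by rewrite -(natrM R 2) ler_nat.
have {}s2 : 2 * q <= (N3 + I + J + 2) * Y.
  have -> : (N3 + I + J + 2) * Y = (h.+1 * y)%:R by rewrite natrM -(natr1 h) hE; ring.
  by rewrite -(natrM R 2) ler_nat.
have Ib : 0 <= I <= 2 by rewrite /I ler0n (ler_nat R _ 2).
have Jb : 0 <= J <= 2 by rewrite /J ler0n (ler_nat R _ 2).
have Nb : 6 <= N3 by rewrite /N3 (ler_nat R 6); lia.
have tentE : tent q h%:R Y = Num.max 0 (Y - `|2 * q - h%:R * Y|) by [].
have Y6 : 6 * Y <= N3 * Y by rewrite ler_wpM2r.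
have IY : 0 <= I * Y <= 2 * Y by rewrite mulr_ge0 ?ler_wpM2r //; case/andP: Ib.
have JY : 0 <= J * Y <= 2 * Y by rewrite mulr_ge0 ?ler_wpM2r //; case/andP: Jb.
rewrite !mulrDl in s1 s2.
have hYE : h%:R * Y = N3 * Y + I * Y + J * Y + Y by rewrite hE; ring.
have TI z : tail_index i j Q n z y =
   [&& I * Y + z%:R <= q, q < I * Y + Y + z%:R,
       J * Y + N3 * Y <= q + z%:R & q + z%:R < J * Y + Y + N3 * Y].
  have e1 : (i * y + z)%:R = I * Y + z%:R :> R by rewrite natrD natrM.
  have e2 : (i.+1 * y + z)%:R = I * Y + Y + z%:R :> R by rewrite natrD natrM -(natr1 i) mulrDl mul1r.
  have e3 : (j * y + 3 * n * y)%:R = J * Y + N3 * Y :> R.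
    by rewrite natrD (natrM _ j) (natrM _ (3 * n)).
  have e4 : (j.+1 * y + 3 * n * y)%:R = J * Y + Y + N3 * Y :> R.
    by rewrite natrD (natrM _ j.+1) (natrM _ (3 * n)) -(natr1 j) mulrDl mul1r.
  have e5 : (Q + z)%:R = q + z%:R :> R by rewrite natrD.
  by rewrite /tail_index -!(ltr_nat R) -!(ler_nat R) e1 e2 e3 e4 e5.
rewrite -(natrM R 3 d); case: (lerP 0 (2 * q - h%:R * Y)) => hc.
  have -> : tent q h%:R Y = (q - I * Y - (2 * q - h%:R * Y)) - (q - I * Y - Y).
    rewrite tentE (ger0_norm hc); rewrite hYE in hc *.
    by case: (lerP 0 (Y - _)) => h1; lra.
  rewrite hYE in hc *.
  apply: count_between => //.
  - by lra.
  - by rewrite -/q; lra.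
  - by move=> z; rewrite TI => /and4P[h1 h2 h3 h4]; lra.
  - by move=> z hz; rewrite TI; apply/and4P; split; lra.
have -> : tent q h%:R Y = (q - I * Y) - (q - I * Y - (2 * q - h%:R * Y) - Y).
  rewrite tentE (ltr0_norm hc); rewrite hYE in hc *.
  by case: (lerP 0 (Y - _)) => h1; lra.
rewrite hYE in hc *.
apply: count_between => //.
- by lra.
- by rewrite -/q; lra.
- by move=> z; rewrite TI => /and4P[h1 h2 h3 h4]; lra.
- by move=> z hz; rewrite TI; apply/and4P; split; lra.
Qed.
End TailCells.

Section TailCounts.
Variable R : realType.

Lemma sqrt_cut (e Q : nat) : (0 < e)%N -> exists K, (K ^ 2 * e <= Q < K.+1 ^ 2 * e)%N.
Proof.
move=> e0; have ex : exists K, (K ^ 2 * e <= Q)%N by exists 0%N.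
have bd K : (K ^ 2 * e <= Q)%N -> (K <= Q)%N.
  by case: K => // K; rewrite -[(_ ^ 2)%N]/(K.+1 * K.+1)%N; nia.
case: (ex_maxnP ex bd) => K hK maxK; exists K; rewrite hK /= ltnNge.
by apply/negP => /maxK; rewrite ltnn.
Qed.

(** Each triangle is counted with an error proportional to [h * e ^ 2], which is
acceptable only for indices [n] up to about [K = sqrt (Q / e)].  The triangles of
larger index lie in a strip [y <= 2 * Q / (3 * K)] and are disjoint, so their
total contribution is at most [e * Q], like the remainder of the series of
areas. *)
Lemma tent_total (s Q e : nat) (S : R) : (1 <= s <= 5)%N -> tail_series s S -> (0 < e)%N ->
  `|e%:R * (\sum_(1 <= y < Q.+1 | (e %| y)%N) \sum_(2 <= n < Q.+2) tent Q%:R (3 * n + s)%:R y%:R)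
     - Q%:R ^+ 2 * S| <= 46 * e%:R * Q%:R.
Proof.
move=> /andP[s1 s5] hS e0; have [K /andP[K1 K2]] := sqrt_cut Q e0.
have ep : (0 : R) < e%:R by rewrite ltr0n.
have q0 : (0 : R) <= Q%:R by [].
have KQ : (K <= Q)%N by case: K K1 {K2} => // K; rewrite -[(_ ^ 2)%N]/(K.+1 * K.+1)%N; nia.
have e0q : 0 <= e%:R * Q%:R :> R by rewrite mulr_ge0 // ltW.
set Kp : R := K.+1%:R.
have Kp1 : (1 : R) <= Kp by rewrite /Kp ler1n.
have k2 : Q%:R <= Kp ^+ 2 * e%:R by rewrite /Kp -natrX -natrM ler_nat ltnW.
have Kp2 : 0 < Kp ^+ 2 by rewrite exprn_gt0 // (lt_le_trans ltr01).
pose M := K.+2.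
have MQ : (M <= Q.+2)%N by [].
have A1 : `|e%:R * (\sum_(2 <= n < M) \sum_(1 <= y < Q.+1 | (e %| y)%N) tent Q%:R (3 * n + s)%:R y%:R)
   - Q%:R ^+ 2 * \sum_(2 <= n < M) tri_area (3 * n + s)%:R| <= 44 * (e%:R * Q%:R) :> R.
  rewrite !mulr_sumr -sumrB; apply: le_trans (ler_norm_sum _ _ _) _.
  case: (posnP K) => [K0|K0]; first by rewrite /M K0 big_geq // mulr_ge0.
  have eQ : (0 < e <= Q)%N by rewrite e0 /=; apply: leq_trans K1; rewrite leq_pmull // expn_gt0 K0.
  apply: le_trans (_ : \sum_(2 <= n < M) 44 * K%:R * e%:R ^+ 2 <= _).
    rewrite big_nat_cond [leRHS]big_nat_cond; apply: ler_sum => n /andP[/andP[n2 nM] _].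
    apply: le_trans (tent_sum R eQ _) _; first by lia.
    apply: ler_wpM2r; first by rewrite exprn_ge0.
    rewrite -(natrM R 4) -(natrM R 44) ler_nat.
    by move: nM; rewrite /M; lia.
  rewrite sumr_const_nat -[leLHS]mulr_natr.
  have -> : (M - 2 = K)%N by rewrite /M; lia.
  have -> : 44 * K%:R * e%:R ^+ 2 * K%:R = 44 * (e%:R * (K ^ 2 * e)%:R) :> R.
    by rewrite natrM natrX; ring.
  by rewrite ler_pM2l // ler_pM2l // ler_nat.
have A2 : 0 <= (e%:R * (\sum_(1 <= y < Q.+1 | (e %| y)%N) \sum_(M <= n < Q.+2) tent Q%:R (3 * n + s)%:R y%:R) : R)
     <= e%:R * Q%:R.
  apply/andP; split.
    apply: mulr_ge0 => //; apply: sumr_ge0 => y _; apply: sumr_ge0 => n _.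
    by have /andP[] := tent_le Q%:R (3 * n + s)%:R (ler0n R y).
  pose J := (2 * Q %/ (3 * M * e))%N.
  have JM : (3 * M * (e * J) <= 2 * Q)%N.
    by have := leq_divM (2 * Q) (3 * M * e); rewrite -/J; lia.
  have JQ : (J <= Q %/ e)%N by rewrite leq_divRL //; rewrite /M in JM; nia.
  have B y : (0 < y)%N -> (e %| y)%N -> \sum_(M <= n < Q.+2) tent Q%:R (3 * n + s)%:R y%:R
      <= (y %/ e <= J)%N%:R * y%:R :> R.
    move=> y0 ey; case: leqP => hy.
      rewrite mul1r -[leRHS]mulr1; apply: le_trans (ler_wpM2l (ler0n R y) (tent_disjoint R Q M Q.+2 s1 y0)).
      rewrite mulr_sumr; apply: ler_sum => n _.
      have [->|/(tent_support s1) [-> ->]] := eqVneq (tent Q%:R (3 * n + s)%:R y%:R : R) 0.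
        by rewrite mulr_ge0.
      by rewrite mulr1; have /andP[] := tent_le Q%:R (3 * n + s)%:R (ler0n R y).
    rewrite mul0r big_nat_cond big1 // => n /andP[/andP[nM _] _].
    apply/eqP; apply/contraT => /(tent_support s1)[h _].
    have : (y %/ e * (3 * M * e) <= 2 * Q)%N.
      have -> : (y %/ e * (3 * M * e) = 3 * M * y)%N by rewrite mulnC -mulnA (mulnC e) divnK.
      by apply: leq_trans h; rewrite leq_mul2r; apply/orP; right; move: nM s1; clear; lia.
    by rewrite -leq_divRL ?muln_gt0 // -/J leqNgt hy.
  apply: le_trans (_ : e%:R * (e%:R * J%:R ^+ 2) <= _).
    rewrite ler_pM2l //.
    apply: le_trans (_ : \sum_(1 <= y < Q.+1 | (e %| y)%N) (y %/ e <= J)%N%:R * y%:R <= _).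
      rewrite big_nat_cond [leRHS]big_nat_cond; apply: ler_sum => y /andP[/andP[y0 _] ey].
      exact: B.
    rewrite sum_multiples //.
    under eq_bigr => i _ do rewrite mulKn //.
    rewrite sum_le_cut //.
    elim: (J) => [|J' IH]; first by rewrite big_geq // expr0n mulr0.
    rewrite big_nat_recr //=; apply: le_trans (lerD IH (lexx _)) _.
    rewrite natrM -mulrDr ler_pM2l // -natr1; have := ler0n R J'; rewrite !expr2; nra.
  rewrite -(ler_pM2l Kp2).
  apply: le_trans (_ : Q%:R * Q%:R <= _); last by have := ler_wpM2r q0 k2; lra.
  have -> : Kp ^+ 2 * (e%:R * (e%:R * J%:R ^+ 2)) = (K.+1 * (e * J))%:R * (K.+1 * (e * J))%:R.
    by rewrite /Kp !natrM; ring.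
  by rewrite -!natrM ler_nat leq_mul //; move: JM; rewrite /M; move: (e * J)%N => x; clear; nia.
have A3 : 0 <= Q%:R ^+ 2 * (S - \sum_(2 <= n < M) tri_area (3 * n + s)%:R) <= e%:R * Q%:R.
  have /andP[h1 h2] := hS M isT; rewrite mulr_ge0 ?exprn_ge0 //=.
  apply: le_trans (ler_wpM2l _ h2) _; first by rewrite exprn_ge0.
  rewrite ler_pdivrMr ?exprn_gt0 ?ltr0n //.
  apply: le_trans (_ : e%:R * Q%:R * Kp ^+ 2 <= _); first by have := ler_wpM2r q0 k2; rewrite expr2; lra.
  apply: ler_wpM2l => //; rewrite ler_sqr ?nnegrE ?ler0n //.
  by rewrite /Kp ler_nat.
have -> : \sum_(1 <= y < Q.+1 | (e %| y)%N) \sum_(2 <= n < Q.+2) tent Q%:R (3 * n + s)%:R y%:R =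
   \sum_(2 <= n < M) \sum_(1 <= y < Q.+1 | (e %| y)%N) tent Q%:R (3 * n + s)%:R y%:R +
   \sum_(1 <= y < Q.+1 | (e %| y)%N) \sum_(M <= n < Q.+2) tent Q%:R (3 * n + s)%:R y%:R :> R.
  by rewrite [X in _ = X + _]exchange_big /= -big_split; apply: eq_bigr => y _; rewrite -big_cat_nat.
rewrite mulrBr in A3; move: A1 A2 A3; rewrite mulrDr;
  rewrite !ler_norml; lra.
Qed.

Lemma lattice_count_tail (i j Q d : nat) (S : R) : (i <= 2)%N -> (j <= 2)%N ->
  tail_series (i + j).+1 S -> (0 < d <= Q)%N -> ~~ (3 %| d)%N ->
  `|lattice_count R Q d (tail_cell i j Q) - 2 / 9 * S * Q%:R ^+ 2 / d%:R ^+ 2| <= 64 * Q%:R / d%:R.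
Proof.
move=> i2 j2 hS /andP[d0 dQ] d3.
have dp : (0 : R) < d%:R by rewrite ltr0n.
have q0 : (0 : R) <= Q%:R by [].
have s5 : (1 <= (i + j).+1 <= 5)%N by lia.
pose T e := \sum_(1 <= y < Q.+1 | (e %| y)%N) \sum_(2 <= n < Q.+2) tent Q%:R (3 * n + (i + j).+1)%:R y%:R : R.
have H1 := @tent_total _ Q d S s5 hS d0; have d30 : (0 < 3 * d)%N by lia.
have H2 := @tent_total _ Q (3 * d) S s5 hS d30.
rewrite -/(T d) -/(T (3 * d)%N) in H1 H2.
have D : `|lattice_count R Q d (tail_cell i j Q) - (T d - T (3 * d)%N) / (3 * d%:R)| <= 2 * (Q%:R / d%:R).
  have -> : T d - T (3 * d)%N = \sum_(1 <= y < Q.+1 | (d %| y)%N && ~~ (3 %| y)%N)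
     \sum_(2 <= n < Q.+2) tent Q%:R (3 * n + (i + j).+1)%:R y%:R.
    rewrite /T [X in X - _]big_mkcond [X in _ - X]big_mkcond -sumrB [RHS]big_mkcond /=; apply: eq_bigr => y _.
    rewrite Gauss_dvd ?prime_coprime //.
    by case: (3 %| y)%N; case: (d %| y)%N; rewrite /= ?subr0 ?subrr.
  rewrite /lattice_count exchange_big /= mulr_suml -sumrB.
  apply: le_trans (ler_norm_sum _ _ _) _.
  apply: le_trans (_ : \sum_(1 <= y < Q.+1 | (d %| y)%N && ~~ (3 %| y)%N) 2 <= _); last first.
    apply: le_trans (_ : \sum_(1 <= y < Q.+1 | (d %| y)%N) 2 <= _).
      rewrite big_mkcond [leRHS]big_mkcond; apply: ler_sum => y _.
      by case: (d %| y)%N; case: (3 %| y)%N.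
    rewrite sum_multiples // sumr_const_nat subn1 /= -[leLHS]mulr_natr ler_pM2l //.
    by rewrite ler_pdivlMr // -natrM ler_nat leq_divM.
  rewrite big_nat_cond [leRHS]big_nat_cond; apply: ler_sum => y /andP[/andP[y0 yQ] _].
  under eq_bigr => z _ do rewrite tail_cell_index //.
  rewrite exchange_big /= mulr_suml -sumrB.
  apply: le_trans (ler_norm_sum _ _ _) _.
  rewrite -[leRHS]mulr1; apply: le_trans (ler_wpM2l (ler0n R 2) (@tent_disjoint R (i + j).+1 Q 2 Q.+2 y isT y0)).
  rewrite mulr_sumr big_nat_cond [leRHS]big_nat_cond; apply: ler_sum => n /andP[/andP[n2 _] _].
  exact: count_tail_index.
set L := lattice_count _ _ _ _ in D *.
have -> : L - 2 / 9 * S * Q%:R ^+ 2 / d%:R ^+ 2 = (L - (T d - T (3 * d)%N) / (3 * d%:R))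
  + (d%:R * T d - Q%:R ^+ 2 * S) / (3 * d%:R ^+ 2)
  - ((3 * d)%:R * T (3 * d)%N - Q%:R ^+ 2 * S) / (9 * d%:R ^+ 2).
  by rewrite natrM; field; rewrite gt_eqF.
have k1 : 0 <= (3 * d%:R ^+ 2)^-1 :> R by rewrite invr_ge0 mulr_ge0 ?exprn_ge0.
have k2 : 0 <= (9 * d%:R ^+ 2)^-1 :> R by rewrite invr_ge0 mulr_ge0 ?exprn_ge0.
apply: le_trans (ler_normB _ _) _.
apply: le_trans (lerD (ler_normD _ _) (lexx _)) _.
rewrite (normrM (d%:R * T d - _)) (normrM ((3 * d)%:R * _ - _)) (ger0_norm k1) (ger0_norm k2).
apply: le_trans (lerD (lerD D (ler_wpM2r k1 H1)) (ler_wpM2r k2 H2)) _.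
have -> : 2 * (Q%:R / d%:R) + 46 * d%:R * Q%:R / (3 * d%:R ^+ 2) + 46 * (3 * d)%:R * Q%:R / (9 * d%:R ^+ 2)
  = (98 / 3) * (Q%:R / d%:R) :> R by rewrite natrM; field; rewrite gt_eqF.
by rewrite -[leRHS]mulrA; apply: ler_wpM2r; [rewrite divr_ge0 // ltW | lra].
Qed.

Lemma card_pairs_tail (i j Q : nat) (S : R) : (i <= 2)%N -> (j <= 2)%N ->
  tail_series (i + j).+1 S -> (0 < Q)%N ->
  `| #|pairs Q (tail_cell i j Q)|%:R - 2 / 9 * S * Q%:R ^+ 2 * mobius_density R Q|
  <= 64 * Q%:R * (1 + ln Q%:R).
Proof.
move=> i2 j2 hS Q0; apply: card_pairs_approx => //.
- move=> y; apply/negbTE/negP => /and5P[n2 _ h3 _ _].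
  move: n2; case: y h3 => [|y] h3; first by rewrite muln0 divn0.
  by rewrite leq_divRL ?muln_gt0 //; nia.
- by move=> d dQ d3; apply: lattice_count_tail.
Qed.
End TailCounts.

(** * Tables of trapezoids with constant gap length *)

(** The inequalities for [hits Q z y] to have first term [a] and second term [k],
cleared of divisions. *)
Definition hits_are (Q z y a k : nat) : bool :=
  [&& (a * z + y <= Q)%N, (Q < a.+1 * z + y)%N,
      (2 * k * z + 2 * y <= Q + z)%N & (Q + z < 2 * k.+1 * z + 2 * y)%N].

Lemma hits_areE (Q z y a k : nat) : (0 < z)%N -> hits_are Q z y a k -> hits Q z y = (a + k)%N.
Proof.
move=> z0 /and4P[h1 h2 h3 h4]; rewrite /hits; congr (_ + _)%N.
  by apply/eqP; rewrite eqn_leq -ltnS ltn_divLR // leq_divRL //; lia.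
set x := ((Q - 2 * y) %/ z)%N.
have x1 : (x < (2 * k).+1)%N by rewrite /x ltn_divLR //; lia.
have x2 : (2 * k <= x.+1)%N.
  by case: k h3 {h4 x1} => // k h3; rewrite mulnS ltnS /x leq_divRL //; lia.
by apply/eqP; rewrite eqn_leq leq_uphalf_double geq_uphalf_double -!muln2; lia.
Qed.

(** Half of the part of the window where the gap goes through [2 * y - z]. *)
Definition upper_region (Q z y : nat) : bool :=
  [&& (Q + z < 3 * y)%N, (3 * y <= Q + 2 * z)%N & (z < y)%N].

(** Half of the part of the window where the gap ends at [3 * y - z]. *)
Definition lower_region (Q z y : nat) : bool :=
  [&& (3 * y <= Q + z)%N, (2 * z < 3 * y)%N & (Q < z + 3 * y)%N].

(** The values of the terms of [hits] on both sides of the fraction of denominator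
[y]; on the upper region the second side has a single intermediate fraction,
which the profile encodes by [a' + k' = 1]. *)
Definition profile := (nat * nat * nat * nat)%type.

Definition upper_profile (Q z y : nat) (h : profile) : bool :=
  let: (a, k, a', k') := h in
  [&& (0 < z)%N, upper_region Q z y, hits_are Q z y a k & (a' + k' == 1)%N].

Definition lower_profile (Q z y : nat) (h : profile) : bool :=
  let: (a, k, a', k') := h in
  [&& (0 < z)%N, lower_region Q z y, hits_are Q z y a k & hits_are Q (3 * y - z) y a' k'].

Definition label (h : profile) : nat := let: (a, k, a', k') := h in (a + k + a' + k').+1.

Lemma upper_profileE (Q z y : nat) (h : profile) : upper_profile Q z y h -> gaplen Q z y = label h.
Proof.
case: h => [[[a k] a'] k'] /and4P[z0 /and3P[r1 r2 r3] hh /eqP e].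
by rewrite /gaplen leqNgt r1 /= r3 (hits_areE z0 hh) /label -addnA e addn1.
Qed.

Lemma lower_profileE (Q z y : nat) (h : profile) : lower_profile Q z y h -> gaplen Q z y = label h.
Proof.
case: h => [[[a k] a'] k'] /and4P[z0 /and3P[r1 r2 r3] h1 h2].
have n1 : ((Q + z) %/ (3 * y) = 1)%N.
  by apply/eqP; rewrite eqn_leq -ltnS ltn_divLR ?leq_divRL; lia.
rewrite /gaplen r1 n1 muln1 (hits_areE z0 h1) (hits_areE _ h2) /label ?addnA //; lia.
Qed.

(** [(e, f, g)] is the line [e * y = f * Q + g * z]. *)
Definition line := (int * int * int)%type.
Definition under (l : line) (Q z y : nat) : bool :=
  let: (e, f, g) := l in e * y%:Z <= f * Q%:Z + g * z%:Z.

(** A vertical slab, cut into trapezoids by lines of increasing height above the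
bottom line; each line comes with the profile of the trapezoid just below it. *)
Record slab := Slab { zleft : int * int; zright : int * int; bottom : line;
  steps : seq (profile * line) }.

Definition in_slab (s : slab) (Q z : nat) : bool :=
  ((zleft s).1 * Q%:Z < (zleft s).2 * z%:Z) && ((zright s).2 * z%:Z <= (zright s).1 * Q%:Z).

Definition mk_cell (zl zr : int * int) (l l' : line) : cell :=
  Cell zl.2 zl.1 zr.2 zr.1 l.1.1 l.1.2 l.2 l'.1.1 l'.1.2 l'.2.

Fixpoint stack (zl zr : int * int) (l : line) (st : seq (profile * line)) : seq (nat * cell) :=
  if st is (h, l') :: st' then (label h, mk_cell zl zr l l') :: stack zl zr l' st' else [::].

Definition slab_cells (s : slab) := stack (zleft s) (zright s) (bottom s) (steps s).
Definition top (s : slab) : line := last (bottom s) (map snd (steps s)).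

(** Pointwise soundness of a slab: at [(z, y)] the lines are in increasing order
and the profile between two successive lines is the actual one. *)
Fixpoint stack_ok (chk : profile -> bool) (Q z y : nat) (l : line) (st : seq (profile * line)) : Prop :=
  if st is (h, l') :: st' then
    [/\ under l Q z y -> under l' Q z y, ~~ under l Q z y -> under l' Q z y -> chk h
      & stack_ok chk Q z y l' st'] else True.

Lemma incell_mk (zl zr : int * int) (l l' : line) (Q z y : nat) :
  incell (mk_cell zl zr l l') Q z y =
  [&& zl.1 * Q%:Z < zl.2 * z%:Z, zr.2 * z%:Z <= zr.1 * Q%:Z, ~~ under l Q z y & under l' Q z y].
Proof. by case: l l' => [[e f] g] [[e' f'] g']; rewrite /incell /= -ltNge. Qed.

Lemma stack_count (zl zr : int * int) (chk : profile -> bool) (Q z y rho r : nat) (l : line) st :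
  (zl.1 * Q%:Z < zl.2 * z%:Z) && (zr.2 * z%:Z <= zr.1 * Q%:Z) ->
  (forall h, chk h -> rho = label h) -> stack_ok chk Q z y l st ->
  (\sum_(p <- stack zl zr l st | p.1 == r) incell p.2 Q z y =
   [&& ~~ under l Q z y, under (last l (map snd st)) Q z y & rho == r])%N.
Proof.
move=> /andP[z1 z2] hchk; elim: st l => [|[h l'] st IH] l /=.
  by rewrite big_nil; case: (under l Q z y).
move=> [mono ch ok]; rewrite big_cons IH //= incell_mk z1 z2 /=.
have last_mono l1 st1 : stack_ok chk Q z y l1 st1 -> under l1 Q z y -> under (last l1 (map snd st1)) Q z y.
  elim: st1 l1 => [|[h1 l2] st1 IH1] l1 //= [m1 _ ok1] u1; apply: IH1 => //; exact: m1.
have := last_mono _ _ ok; case u' : (under l' Q z y) in mono ch * => /=.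
  move=> -> //; case u : (under l Q z y) in mono ch * => /=; first by case: eqP.
  by have /hchk -> := ch isT isT; case: eqP.
case u : (under l Q z y) in mono ch *; first by have := mono isT.
by move=> _ /=; case: eqP.
Qed.

Lemma stack_outside (zl zr : int * int) (Q z y r : nat) (l : line) st :
  (zl.1 * Q%:Z < zl.2 * z%:Z) && (zr.2 * z%:Z <= zr.1 * Q%:Z) = false ->
  (\sum_(p <- stack zl zr l st | p.1 == r) incell p.2 Q z y = 0)%N.
Proof.
move=> h; elim: st l => [|[hh l'] st IH] l /=; first by rewrite big_nil.
by rewrite big_cons IH incell_mk andbA h /= if_same.
Qed.

Definition table_cells (tbl : seq slab) : seq (nat * cell) := flatten (map slab_cells tbl).

Definition covers (tbl : seq slab) (Q z y : nat) : nat :=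
  (\sum_(s <- tbl) [&& in_slab s Q z, ~~ under (bottom s) Q z y & under (top s) Q z y])%N.

(** A point covered by a sound table lies in exactly one of its trapezoids, whose
label is the gap length at this point. *)
Lemma table_count (tbl : seq slab) (chk : profile -> bool) (Q z y rho r : nat) :
  (forall h, chk h -> rho = label h) ->
  foldr (fun s P => (in_slab s Q z -> stack_ok chk Q z y (bottom s) (steps s)) /\ P) True tbl ->
  (\sum_(p <- table_cells tbl | p.1 == r) incell p.2 Q z y =
   covers tbl Q z y * (rho == r))%N.
Proof.
move=> hchk; rewrite /covers /table_cells; elim: tbl => [|s tbl IH] /=.
  by rewrite !big_nil.
move=> [ok oks]; rewrite big_cat /= IH // big_cons mulnDl; congr (_ + _)%N.
case hs : (in_slab s Q z); last first.
  by rewrite /= /slab_cells stack_outside.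
rewrite (stack_count _ hs hchk (ok hs)) /= -/(top s).
by case: (under _ _ _ _) => //=; case: (under _ _ _ _) => //=; case: (rho == r).
Qed.

Lemma table_label (tbl : seq slab) (chk : profile -> bool) (Q z y rho : nat) :
  (forall h, chk h -> rho = label h) ->
  foldr (fun s P => (in_slab s Q z -> stack_ok chk Q z y (bottom s) (steps s)) /\ P) True tbl ->
  covers tbl Q z y = 1%N -> rho \in map fst (table_cells tbl).
Proof.
move=> hchk ok cov; have := table_count rho hchk ok; rewrite cov eqxx muln1.
by apply: contra_eqT; rewrite -has_pred1 has_map => h; rewrite big_hasC.
Qed.

(** The edges of the regions: [line_a] to [line_d] are [3 * y = Q - z],
[3 * y = 2 * z], [3 * y = Q + z] and [3 * y = Q + 2 * z], and [line_z] is
[y = z].  Across [first_line n] and [second_line n] a term of [hits Q z y]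
changes; across [line_4], [line_5] and [line_7] a term of
[hits Q (3 * y - z) y] does. *)
Definition line_a : line := (3, 1, -1).
Definition line_b : line := (3, 0, 2).
Definition line_c : line := (3, 1, 1).
Definition line_d : line := (3, 1, 2).
Definition line_z : line := (1, 0, 1).
Definition first_line (n : nat) : line := (1, 1, - n%:Z).
Definition second_line (n : nat) : line := (2, 1, - n%:Z).
Definition line_4 : line := (4, 1, 1).
Definition line_5 : line := (5, 1, 1).
Definition line_7 : line := (7, 1, 2).

(** The abscissa [z / Q = 2 / (12 * m + c)].  Increasing [m] by one adds 6 to
[Q / z], hence 4 to the first term and 1 to the second term of [hits Q z y] when
[3 * y] is close to [Q]: this is the period 5 of the final formulas. *)
Definition band_at (m c : nat) : int * int := (2, (12 * m + c)%N%:Z).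

(** The slabs end where a line [w n] or [v n] crosses the top or the bottom of the
region. *)
Definition upper_table (m : nat) : seq slab :=
  let w n := first_line (4 * m + n) in let v n := second_line (2 * m + n) in
  let h a k : profile := ((4 * m + a)%N, (m + k)%N, 1%N, 0%N) in
  [:: Slab (band_at m 14) (band_at m 13) line_c [:: (h 4 1, w 4); (h 3 1, v 1); (h 3 0, line_d)];
      Slab (band_at m 13) (band_at m 11) line_c [:: (h 3 1, v 1); (h 3 0, line_d)];
      Slab (band_at m 11) (band_at m 10) line_c [:: (h 3 1, v 1); (h 3 0, w 3); (h 2 0, line_d)];
      Slab (band_at m 10) (band_at m 8) line_c [:: (h 2 0, line_d)];
      Slab (band_at m 8) (band_at m 7) line_c [:: (h 2 0, w 2); (h 1 0, line_d)];
      Slab (band_at m 7) (band_at m 5) line_c [:: (h 1 0, line_d)];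
      Slab (band_at m 5) (band_at m 4) line_c [:: (h 1 0, w 1); (h 0 0, line_d)];
      Slab (band_at m 4) (band_at m 2) (if m == 0%N then line_z else line_c) [:: (h 0 0, line_d)]]%N.

Ltac stack_tac :=
  repeat match goal with
  | |- True => exact: I
  | |- and3 _ _ _ => split
  | |- _ /\ _ => split
  | |- is_true (in_slab _ _ _) -> _ => rewrite /in_slab /= => ?
  | |- _ => rewrite /under /upper_profile /lower_profile /upper_region /lower_region /hits_are /=; lia
  end.

(** All the conditions are linear once the band is fixed, with [m] as one more
integer variable. *)
Lemma upper_table_ok (m Q z y : nat) :
  foldr (fun s P => (in_slab s Q z -> stack_ok (upper_profile Q z y) Q z y (bottom s) (steps s)) /\ P)
    True (upper_table m).
Proof. by case: m => [|m]; rewrite /upper_table /band_at /first_line /second_line; simpl foldr; stack_tac. Qed.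

Ltac decide_slabs :=
  repeat match goal with
  | |- context [in_slab ?s ?Q ?z] =>
    first [ have -> : in_slab s Q z = false by (rewrite /in_slab /=; lia)
          | have -> : in_slab s Q z = true by (rewrite /in_slab /=; lia) ]
  end; rewrite /= ?addn0 ?add0n.

Definition in_band (m Q z : nat) : bool :=
  (2 * Q < (12 * m + 14) * z)%N && ((12 * m + 2) * z <= 2 * Q)%N.

Ltac band_split l m Q z :=
  match l with
  | cons ?c ?l' => case: (leqP ((12 * m + c) * z)%N (2 * Q)%N) => ?; [idtac | band_split l' m Q z]
  | nil => idtac
  end.

Lemma upper_table_covers (m Q z y : nat) : (z <= Q)%N ->
  covers (upper_table m) Q z y = upper_region Q z y && in_band m Q z.
Proof.
move=> zQ; rewrite /covers /upper_table unlock /=.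
case: m => [|m] /=.
  by band_split [:: 14; 13; 11; 10; 8; 7; 5; 4; 2]%N 0%N Q z; decide_slabs;
    rewrite /top /= /under /upper_region /in_band /=; lia.
by band_split [:: 14; 13; 11; 10; 8; 7; 5; 4; 2]%N m.+1 Q z; decide_slabs;
  rewrite /top /= /under /upper_region /in_band /=; lia.
Qed.

(** For [7 * z <= Q] the second side of the gap is a pair of consecutive fractions,
so the profile ends with two zeros. *)
Definition lower_table (m : nat) : seq slab :=
  let w n := first_line (4 * m + n) in let v n := second_line (2 * m + n) in
  let h a k : profile := ((4 * m + a)%N, (m + k)%N, 0%N, 0%N) in
  [:: Slab (band_at m 14) (band_at m 13) line_a [:: (h 4 1, line_c)];
      Slab (band_at m 13) (band_at m 11) line_a [:: (h 4 1, w 4); (h 3 1, line_c)];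
      Slab (band_at m 11) (band_at m 10) line_a [:: (h 3 1, line_c)];
      Slab (band_at m 10) (band_at m 8) line_a [:: (h 3 1, w 3); (h 2 1, v 1); (h 2 0, line_c)];
      Slab (band_at m 8) (band_at m 7) line_a [:: (h 2 1, v 1); (h 2 0, line_c)];
      Slab (band_at m 7) (band_at m 6) line_a [:: (h 2 1, v 1); (h 2 0, w 2); (h 1 0, line_c)];
      Slab (band_at m 6) (band_at m 5) line_a [:: (h 2 1, w 2); (h 1 1, v 1); (h 1 0, line_c)];
      Slab (band_at m 5) (band_at m 4) line_a [:: (h 1 1, v 1); (h 1 0, line_c)];
      Slab (band_at m 4) (band_at m 2) line_a [:: (h 1 1, v 1); (h 1 0, w 1); (h 0 0, line_c)]]%N.

Lemma lower_table_ok (m Q z y : nat) : (0 < m)%N ->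
  foldr (fun s P => (in_slab s Q z -> stack_ok (lower_profile Q z y) Q z y (bottom s) (steps s)) /\ P)
    True (lower_table m).
Proof.
by case: m => // m _; rewrite /lower_table /band_at /first_line /second_line; simpl foldr; stack_tac.
Qed.

Lemma lower_table_covers (m Q z y : nat) : (0 < m)%N ->
  covers (lower_table m) Q z y = lower_region Q z y && in_band m Q z.
Proof.
case: m => // m _; rewrite /covers /lower_table unlock /=.
by band_split [:: 14; 13; 11; 10; 8; 7; 6; 5; 4; 2]%N m.+1 Q z; decide_slabs;
  rewrite /top /= /under /lower_region /in_band /=; lia.
Qed.

Definition ratio (a b : nat) : int * int := (a%:Z, b%:Z).

(** For [7 * z > Q] the lower region is cut by [line_4], the line
[4 * y = Q + z]: above it the second side of the gap has no intermediate
fraction. *)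
Definition wide_above_table : seq slab :=
  let w := first_line in let v := second_line 1 in
  let h a k : profile := (a, k, 0, 0) in
  [:: Slab (ratio 1 7) (ratio 2 13) line_4 [:: (h 4 1, line_c)];
      Slab (ratio 2 13) (ratio 3 17) line_4 [:: (h 4 1, w 4); (h 3 1, line_c)];
      Slab (ratio 3 17) (ratio 1 5) line_4 [:: (h 3 1, line_c)];
      Slab (ratio 1 5) (ratio 3 13) line_4 [:: (h 3 1, w 3); (h 2 1, v); (h 2 0, line_c)];
      Slab (ratio 3 13) (ratio 2 7) line_4 [:: (h 2 1, v); (h 2 0, line_c)];
      Slab (ratio 2 7) (ratio 1 3) line_4 [:: (h 2 1, v); (h 2 0, w 2); (h 1 0, line_c)];
      Slab (ratio 1 3) (ratio 1 2) line_4 [:: (h 1 0, line_c)];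
      Slab (ratio 1 2) (ratio 3 5) line_4 [:: (h 1 0, w 1); (h 0 0, line_c)];
      Slab (ratio 3 5) (ratio 1 1) line_b [:: (h 0 0, line_c)]]%N.

Definition wide_below_table : seq slab :=
  let w := first_line in let v := second_line 1 in
  let h a k a' k' : profile := (a, k, a', k') in
  [:: Slab (ratio 1 7) (ratio 3 17) line_a [:: (h 4 1 1 0, line_4)];
      Slab (ratio 3 17) (ratio 2 11) line_a [:: (h 4 1 1 0, w 4); (h 3 1 1 0, line_4)];
      Slab (ratio 2 11) (ratio 3 13) line_a [:: (h 3 1 1 0, line_4)];
      Slab (ratio 3 13) (ratio 1 4) line_a [:: (h 3 1 1 0, w 3); (h 2 1 1 0, line_4)];
      Slab (ratio 1 4) (ratio 4 13) line_a [:: (h 2 1 1 1, line_5); (h 2 1 1 0, line_4)];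
      Slab (ratio 4 13) (ratio 1 3) line_a [:: (h 2 1 2 1, line_7); (h 2 1 1 1, line_5); (h 2 1 1 0, line_4)];
      Slab (ratio 1 3) (ratio 4 11) line_b
        [:: (h 2 1 2 1, line_7); (h 2 1 1 1, line_5); (h 2 1 1 0, w 2); (h 1 1 1 0, v); (h 1 0 1 0, line_4)];
      Slab (ratio 4 11) (ratio 3 8) line_b
        [:: (h 2 1 2 1, line_7); (h 2 1 1 1, w 2); (h 1 1 1 1, line_5); (h 1 1 1 0, v); (h 1 0 1 0, line_4)];
      Slab (ratio 3 8) (ratio 3 7) line_b [:: (h 1 1 1 1, line_5); (h 1 1 1 0, v); (h 1 0 1 0, line_4)];
      Slab (ratio 3 7) (ratio 3 5) line_b [:: (h 1 0 1 0, line_4)]]%N.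

Lemma wide_above_ok (Q z y : nat) :
  foldr (fun s P => (in_slab s Q z -> stack_ok (lower_profile Q z y) Q z y (bottom s) (steps s)) /\ P)
    True wide_above_table.
Proof. rewrite /wide_above_table /first_line /second_line; simpl foldr; stack_tac. Qed.

Lemma wide_below_ok (Q z y : nat) :
  foldr (fun s P => (in_slab s Q z -> stack_ok (lower_profile Q z y) Q z y (bottom s) (steps s)) /\ P)
    True wide_below_table.
Proof. rewrite /wide_below_table /first_line /second_line; simpl foldr; stack_tac. Qed.

Ltac ratio_split l Q z :=
  match l with
  | cons (?a, ?b) ?l' => case: (leqP (b * z)%N (a * Q)%N) => ?; [idtac | ratio_split l' Q z]
  | nil => idtac
  end.

Lemma wide_above_covers (Q z y : nat) : (z <= Q)%N ->
  covers wide_above_table Q z y = [&& lower_region Q z y, (Q < 7 * z)%N & (Q + z < 4 * y)%N].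
Proof.
move=> zQ; rewrite /covers /wide_above_table unlock /=.
by ratio_split [:: (1, 7); (2, 13); (3, 17); (1, 5); (3, 13); (2, 7); (1, 3); (1, 2); (3, 5)]%N Q z; decide_slabs;
  rewrite /top /= /under /lower_region /=; lia.
Qed.

Lemma wide_below_covers (Q z y : nat) : (z <= Q)%N ->
  covers wide_below_table Q z y = [&& lower_region Q z y, (Q < 7 * z)%N & (4 * y <= Q + z)%N].
Proof.
move=> zQ; rewrite /covers /wide_below_table unlock /=.
by ratio_split [:: (1, 7); (3, 17); (2, 11); (3, 13); (1, 4); (4, 13); (1, 3); (4, 11); (3, 8); (3, 7); (3, 5)]%N Q z; decide_slabs;
  rewrite /top /= /under /lower_region /=; lia.
Qed.

(** The labels of [upper_table m] range over [5 * m + 2 .. 5 * m + 7] and those of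
[lower_table m] over [5 * m + 1 .. 5 * m + 6], so a gap length [r] meets only two
consecutive bands. *)
Definition tables (r : nat) : seq slab :=
  let m := (r %/ 5)%N in
  upper_table m ++ (if (0 < m)%N then upper_table m.-1 else [::]) ++
  (if (0 < m)%N then lower_table m else [::]) ++ (if (1 < m)%N then lower_table m.-1 else [::]) ++
  wide_above_table ++ wide_below_table.

Definition half_cells (r : nat) : seq (nat * cell) := table_cells (tables r).

Lemma sum_cells_cat (t1 t2 : seq slab) (P : pred (nat * cell)) (F : nat * cell -> nat) :
  (\sum_(p <- table_cells (t1 ++ t2) | P p) F p =
   \sum_(p <- table_cells t1 | P p) F p + \sum_(p <- table_cells t2 | P p) F p)%N.
Proof. by rewrite /table_cells map_cat flatten_cat big_cat. Qed.

Lemma upper_labels (m l : nat) : l \in map fst (table_cells (upper_table m)) -> (5 * m + 2 <= l <= 5 * m + 7)%N.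
Proof. rewrite /= !inE; lia. Qed.

Lemma lower_labels (m l : nat) : l \in map fst (table_cells (lower_table m)) -> (5 * m + 1 <= l <= 5 * m + 6)%N.
Proof. rewrite /= !inE; lia. Qed.

Lemma in_band_ex (Q z : nat) : (0 < z <= Q)%N -> exists m, in_band m Q z.
Proof.
move=> /andP[z0 zQ]; exists (((2 * Q) %/ z - 2) %/ 12)%N; rewrite /in_band.
have N2 : (2 <= (2 * Q) %/ z)%N by rewrite leq_divRL //; lia.
have := leq_divM (2 * Q) z; have := ltn_ceil (2 * Q) z0.
set N := ((2 * Q) %/ z)%N in N2 * => h1 h2.
have := leq_divM (N - 2) 12; have := @ltn_ceil (N - 2) 12 isT.
set m := ((N - 2) %/ 12)%N => h3 h4; apply/andP; split.
  by apply: leq_trans h1 _; rewrite leq_mul2r; lia.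
by apply: leq_trans h2; rewrite leq_mul2r; lia.
Qed.

(** Each point lies in a single band, and the bounds on the labels show that this
band is one of those listed in [tables r] whenever its gap length is [r]. *)
Lemma half_count (Q z y r : nat) : (z <= Q)%N ->
  (\sum_(p <- half_cells r | p.1 == r) incell p.2 Q z y =
   (upper_region Q z y || lower_region Q z y) && (gaplen Q z y == r))%N.
Proof.
move=> zQ; pose rho := gaplen Q z y.
have U m := table_count r (@upper_profileE Q z y) (upper_table_ok m Q z y).
have L m m0 := table_count r (@lower_profileE Q z y) (@lower_table_ok m Q z y m0).
have A := table_count r (@lower_profileE Q z y) (wide_above_ok Q z y).
have B := table_count r (@lower_profileE Q z y) (wide_below_ok Q z y).
rewrite /half_cells /tables; set m := (r %/ 5)%N.
have Up : (\sum_(p <- table_cells (if (0 < m)%N then upper_table m.-1 else [::]) | p.1 == r)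
    incell p.2 Q z y = [&& (0 < m)%N, upper_region Q z y, in_band m.-1 Q z & rho == r])%N.
  case m0 : (0 < m)%N; last by rewrite big_nil.
  by rewrite U upper_table_covers // mulnb -andbA.
have Lo : (\sum_(p <- table_cells (if (0 < m)%N then lower_table m else [::]) | p.1 == r)
    incell p.2 Q z y = [&& (0 < m)%N, lower_region Q z y, in_band m Q z & rho == r])%N.
  case m0 : (0 < m)%N; last by rewrite big_nil.
  by rewrite (L _ m0) lower_table_covers // mulnb -andbA.
have Lp : (\sum_(p <- table_cells (if (1 < m)%N then lower_table m.-1 else [::]) | p.1 == r)
    incell p.2 Q z y = [&& (1 < m)%N, lower_region Q z y, in_band m.-1 Q z & rho == r])%N.
  case m0 : (1 < m)%N; last by rewrite big_nil.
  have m1 : (0 < m.-1)%N by lia.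
  by rewrite (L _ m1) lower_table_covers // mulnb -andbA.
rewrite !sum_cells_cat Up Lo Lp A B U.
rewrite upper_table_covers // wide_above_covers // wide_below_covers // -/rho !mulnb.
case: (eqVneq rho r) => [er|]; last by rewrite !andbF.
rewrite !andbT.
case u : (upper_region Q z y) => /=.
  have -> : lower_region Q z y = false by move: u; rewrite /upper_region /lower_region; lia.
  have z0 : (0 < z <= Q)%N by move: u; rewrite /upper_region; lia.
  have [M bM] := in_band_ex z0.
  have := table_label (@upper_profileE Q z y) (upper_table_ok M Q z y).
  rewrite upper_table_covers // u bM => /(_ erefl) /upper_labels; rewrite -/rho er => lab.
  have uniq_band m' : in_band m' Q z -> m' = M.
    by move: bM; rewrite /in_band => /andP[b1 b2] /andP[b3 b4]; nia.
  rewrite /= !andbF !addn0.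
  have [Mm|Mm] : M = m \/ (M = m.-1 /\ 0 < m)%N by rewrite /m; lia.
    rewrite -Mm bM; case b : (in_band M.-1 Q z); last by rewrite andbF.
    by have := uniq_band _ b; case: (posnP M) => [->|]; lia.
  case: Mm => Mm m0; rewrite -Mm bM m0.
  by case b : (in_band m Q z) => //; have := uniq_band _ b; lia.
case l : (lower_region Q z y) => /=; last by rewrite !andbF.
have z0 : (0 < z <= Q)%N by move: l; rewrite /lower_region; case: (posnP z) => //; lia.
rewrite andbF /= !add0n.
case: (ltnP Q (7 * z)) => hz /=.
  have nb m' : (0 < m')%N -> in_band m' Q z = false.
    by move=> m0; apply/negP; rewrite /in_band => /andP[b1 b2]; nia.
  have -> : (0 < m)%N && in_band m Q z = false by case: (posnP m) => //= m0; rewrite nb.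
  have -> : (1 < m)%N && in_band m.-1 Q z = false.
    by case: (ltnP 1 m) => //= m1; rewrite nb //; lia.
  by case: ltnP.
rewrite ?andbF ?addn0.
have [M bM] := in_band_ex z0.
have M0 : (0 < M)%N by case: M bM => //; rewrite /in_band; lia.
have := table_label (@lower_profileE Q z y) (lower_table_ok Q z y M0).
rewrite lower_table_covers // l bM => /(_ erefl) /lower_labels; rewrite -/rho er => lab.
have uniq_band m' : in_band m' Q z -> m' = M.
  by move: bM; rewrite /in_band => /andP[b1 b2] /andP[b3 b4]; nia.
have [Mm|[Mm m1]] : M = m \/ (M = m.-1 /\ 1 < m)%N by rewrite /m; lia.
  rewrite -Mm bM M0 /=; case b : (in_band M.-1 Q z); last by rewrite andbF.
  by have := uniq_band _ b; lia.
rewrite -Mm bM m1; case b : (in_band m Q z); last by rewrite andbF.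
by have := uniq_band _ b; lia.
Qed.

(** * Gap length near the corner and reduction to half of the window *)

(** The part of the window where the gap ends at [3 * n * y - z] with
[n >= 2]. *)
Definition tail_region (Q z y : nat) : bool := (6 * y <= Q + z)%N && (Q < z + 3 * y)%N.

(** On these small triangles the interval next to [z], respectively to
[3 * n * y - z], contains one fraction more than [i], respectively [j].  The
bound [Q + z < 9 * y] in the second definition says that [n = 2], the only value
for which this happens. *)
Definition extra (Q z y : nat) : bool := tail_region Q z y && (2 * z + y <= Q)%N.
Definition extra_mirror (Q z y : nat) : bool :=
  [&& tail_region Q z y, (Q + z < 9 * y)%N & (2 * (6 * y - z) + y <= Q)%N].

Lemma tail_cell_out (i j Q z y : nat) : (i <= 2)%N -> (j <= 2)%N ->
  tail_cell i j Q z y -> tail_region Q z y && (z <= Q)%N.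
Proof.
move=> i2 j2 /and5P[n2 h1 h2 h3 h4]; rewrite /tail_region.
case: (posnP y) => y0; first by move: n2; rewrite y0 muln0 divn0.
move: n2; rewrite leq_divRL ?muln_gt0 // => n2.
have : (i.+1 * y <= 3 * y)%N by rewrite leq_mul2r; lia.
by lia.
Qed.

(** On this region the interval next to a denominator [w] has room only for the
denominators [w + y] and [w + 2 * y], counted by [(Q - w) %/ y], and
[2 * w + y]. *)
Lemma tail_gaplen (Q z y : nat) : (z <= Q)%N -> tail_region Q z y ->
  exists i j : nat, [/\ (i <= 2)%N, (j <= 2)%N,
    forall i' j', tail_cell i' j' Q z y = (i' == i) && (j' == j),
    gaplen Q z y = (i + j + extra Q z y + extra_mirror Q z y).+1 &
    (extra Q z y -> [/\ i = 2, j = 0 & extra_mirror Q z y = false]%N) /\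
    (extra_mirror Q z y -> [/\ i = 0, j = 2 & extra Q z y = false]%N)].
Proof.
move=> zQ tr; have /andP[r1 r2] := tr.
have y0 : (0 < y)%N by lia.
have z0 : (0 < z)%N by lia.
pose n := ((Q + z) %/ (3 * y))%N.
have n2 : (2 <= n)%N by rewrite leq_divRL ?muln_gt0 //; lia.
have [n3 n4] : (n * (3 * y) <= Q + z)%N /\ (Q + z < n.+1 * (3 * y))%N.
  by split; [exact: leq_divM | apply: ltn_ceil; rewrite muln_gt0].
have [N eN] : exists N, N = (n * y)%N by exists (n * y)%N.
have {}n3 : (3 * N <= Q + z)%N by lia.
have {}n4 : (Q + z < 3 * N + 3 * y)%N by lia.
have nN : n = 2%N /\ N = (2 * y)%N \/ (9 * y <= 3 * N)%N.
  by case: (ltnP 2 n) => n5; [right; nia | left; nia].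
have [z' zz'] : exists z', (z + z' = 3 * N)%N by exists (3 * N - z)%N; lia.
have z'0 : (0 < z')%N by lia.
have ediv (x i : nat) : (i * y <= x < i.+1 * y)%N -> (x %/ y = i)%N.
  by move=> /andP[h1 h2]; apply/eqP; rewrite eqn_leq -ltnS ltn_divLR // leq_divRL // h1 h2.
have tc i' j' : tail_cell i' j' Q z y = (i' == (Q - z) %/ y)%N && (j' == (Q - z') %/ y)%N.
  rewrite /tail_cell -/n n2 /=.
  have -> : (j' * y + 3 * n * y <= Q + z)%N = (j' * y <= Q - z')%N by lia.
  have -> : (Q + z < j'.+1 * y + 3 * n * y)%N = (Q - z' < j'.+1 * y)%N by lia.
  have -> : (i' * y + z <= Q)%N = (i' * y <= Q - z)%N by lia.
  have -> : (Q < i'.+1 * y + z)%N = (Q - z < i'.+1 * y)%N by lia.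
  have sq (x k : nat) : (k * y <= x)%N && (x < k.+1 * y)%N = (k == x %/ y)%N.
    apply/idP/eqP => [/ediv //|->]; rewrite leq_divM; exact: ltn_ceil.
  by rewrite andbA sq sq.
exists ((Q - z) %/ y)%N, ((Q - z') %/ y)%N.
have gl : gaplen Q z y = (hits Q z y + hits Q z' y).+1.
  rewrite /gaplen -/n; have -> : (3 * y <= Q + z)%N by lia.
  by congr (_ + hits Q _ _).+1; lia.
have H w : (0 < w <= Q)%N -> (Q < w + 3 * y)%N -> (6 * y <= Q + w)%N ->
  hits Q w y = ((Q - w) %/ y + (2 * w + y <= Q))%N.
  move=> /andP[w0 wQ] h1 h2.
  have [c1|c1] := leqP (w + 2 * y)%N Q.
    rewrite (@ediv (Q - w)%N 2%N); last by lia.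
    have [c2|c2] := leqP (2 * w + y)%N Q.
      by rewrite (@hits_areE Q w y 2 1) // /hits_are; lia.
    by rewrite (@hits_areE Q w y 1 1) // /hits_are; lia.
  have [c2|c2] := leqP (w + y)%N Q.
    rewrite (@ediv (Q - w)%N 1%N); last by lia.
    rewrite (@hits_areE Q w y 1 0) // /hits_are; try lia.
  rewrite (@ediv (Q - w)%N 0%N); last by lia.
  rewrite (@hits_areE Q w y 0 0) // /hits_are; lia.
have ex : extra Q z y = (2 * z + y <= Q)%N by rewrite /extra tr.
have ex' : extra_mirror Q z y = (2 * z' + y <= Q)%N.
  by rewrite /extra_mirror tr /=; case: nN => [[_ e]|]; lia.
split=> //.
- by rewrite -ltnS ltn_divLR //; lia.
- by rewrite -ltnS ltn_divLR //; lia.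
- rewrite gl (H z) ?(H z') ?ex ?ex' //; lia.
rewrite ex ex'; split=> e.
  by split; [apply: ediv; lia | apply: ediv; lia | lia].
by split; [apply: ediv; lia | apply: ediv; lia | lia].
Qed.

Definition tail_indices : seq (nat * nat) :=
  [:: (0, 0); (0, 1); (1, 0); (0, 2); (1, 1); (2, 0); (1, 2); (2, 1); (2, 2)]%N.

(** The extra triangles have [(i, j)] equal to [(2, 0)] or [(0, 2)], which would
give gap length 3; they actually have gap length 4. *)
Lemma tail_count (Q z y r : nat) : (z <= Q)%N ->
  ((tail_region Q z y && (gaplen Q z y == r)) + (r == 3) * (extra Q z y + extra_mirror Q z y) =
   \sum_(p <- tail_indices | (p.1 + p.2).+1 == r) tail_cell p.1 p.2 Q z y
   + (r == 4) * (extra Q z y + extra_mirror Q z y))%N.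
Proof.
move=> zQ; case tr : (tail_region Q z y); last first.
  have -> : extra Q z y = false by rewrite /extra tr.
  have -> : extra_mirror Q z y = false by rewrite /extra_mirror tr.
  have T i j : (i <= 2)%N -> (j <= 2)%N -> tail_cell i j Q z y = false.
    by move=> i2 j2; apply/negP => /(tail_cell_out i2 j2); rewrite tr.
  by rewrite !muln0 /= big_mkcond /tail_indices unlock /= !T // !if_same.
have [i [j [i2 j2 T -> [E1 E2]]]] := tail_gaplen zQ tr.
have -> : (\sum_(p <- tail_indices | (p.1 + p.2).+1 == r) tail_cell p.1 p.2 Q z y
   = ((i + j).+1 == r))%N.
  rewrite big_mkcond /tail_indices unlock /= !T.
  by case: i i2 {T E1 E2} => [|[|[|//]]] _; case: j j2 => [|[|[|//]]] _; rewrite /= ?if_same ?addn0 ?add0n; case: eqP.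
case e : (extra Q z y) in E1 E2 *.
  have [-> -> ->] := E1 isT; rewrite /=; lia.
case e' : (extra_mirror Q z y) in E1 E2 *.
  have [-> -> _] := E2 isT; rewrite /=; lia.
by rewrite /= !addn0 !muln0 addn0.
Qed.

Lemma card_pairsE (Q : nat) (P : nat -> nat -> bool) : #|pairs Q P| =
  (\sum_(p : 'I_Q.+1 * 'I_Q.+1 | (3 %| p.1) && coprime p.1 p.2) P p.1 p.2)%N.
Proof.
rewrite -sum1_card [LHS]big_mkcond [RHS]big_mkcond; apply: eq_bigr => p _.
by rewrite inE andbA; case: (_ && coprime _ _); case: (P _ _).
Qed.

Lemma eq_card_pairs (Q : nat) (P P' : nat -> nat -> bool) :
  (forall z y, (z <= Q)%N -> P z y = P' z y) -> #|pairs Q P| = #|pairs Q P'|.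
Proof.
move=> H; congr #|pred_of_set _|; apply/setP => p; rewrite !inE H //.
by rewrite -ltnS.
Qed.

Lemma card_pairs_le (Q : nat) (P P' : nat -> nat -> bool) (f g : nat -> nat -> nat) :
  (forall z y, (z <= Q)%N -> (y <= Q)%N -> (3 %| z)%N -> coprime z y -> P z y ->
    [/\ (f z y <= Q)%N, (g z y <= Q)%N, (3 %| f z y)%N & coprime (f z y) (g z y)] /\
    [/\ P' (f z y) (g z y), f (f z y) (g z y) = z & g (f z y) (g z y) = y]) ->
  (#|pairs Q P| <= #|pairs Q P'|)%N.
Proof.
move=> H; pose F (p : 'I_Q.+1 * 'I_Q.+1) : 'I_Q.+1 * 'I_Q.+1 :=
  (inord (f p.1 p.2), inord (g p.1 p.2)).
have HF p : p \in pairs Q P ->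
    [/\ F p \in pairs Q P', (F p).1 = f p.1 p.2 :> nat, (F p).2 = g p.1 p.2 :> nat,
      f (f p.1 p.2) (g p.1 p.2) = p.1 & g (f p.1 p.2) (g p.1 p.2) = p.2].
  rewrite inE => /and3P[h1 h2 h3].
  have z1 : (p.1 <= Q)%N by rewrite -ltnS.
  have y1 : (p.2 <= Q)%N by rewrite -ltnS.
  have [[a1 a2 a3 a4] [a5 a6 a7]] := H _ _ z1 y1 h1 h2 h3.
  by rewrite /F inE /= !inordK ?ltnS // a3 a4 a5.
rewrite -(@card_in_imset _ _ F); last first.
  move=> p q /HF[_ p1 p2 p3 p4] /HF[_ q1 q2 q3 q4] e.
  have e1 : f p.1 p.2 = f q.1 q.2 by rewrite -p1 -q1 e.
  have e2 : g p.1 p.2 = g q.1 q.2 by rewrite -p2 -q2 e.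
  rewrite [p]surjective_pairing [q]surjective_pairing; congr (_, _); apply: val_inj => /=.
    by rewrite -p3 -q3 e1 e2.
  by rewrite -p4 -q4 e1 e2.
by apply/subset_leq_card/fintype.subsetP => q /imsetP[p /HF[h _ _ _ _] ->].
Qed.

(** The images of [upper_region] and [lower_region] under reversal of the gap: the
right end becomes the left one, so [(z, y)] is replaced by
[(3 * y - 2 * z, 2 * y - z)], respectively by [(3 * y - z, y)]. *)
Definition upper_mirror (Q z y : nat) : bool :=
  [&& (Q + z < 3 * y)%N, (3 * y <= Q + 2 * z)%N & (y < z)%N].

Definition lower_mirror (Q z y : nat) : bool :=
  [&& (3 * y <= Q + z)%N, (3 * y < 2 * z)%N & (Q + z < 6 * y)%N].

Lemma coprime_lin (a b z y : nat) : coprime z y ->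
  (forall k, (k %| a)%N -> (k %| b)%N -> (k %| z)%N /\ (k %| y)%N) -> coprime a b.
Proof.
move=> cop h; rewrite /coprime; have [h1 h2] := h _ (dvdn_gcdl a b) (dvdn_gcdr a b).
by have := dvdn_gcd (gcdn a b) z y; rewrite h1 h2 (eqP cop) dvdn1.
Qed.

Lemma gaplen_upper (Q z y : nat) : upper_region Q z y -> gaplen Q z y = (hits Q z y).+2.
Proof. by move=> /and3P[h1 h2 h3]; rewrite /gaplen leqNgt h1 /= h3. Qed.

Lemma gaplen_upper_mirror (Q z y : nat) : upper_mirror Q z y ->
  gaplen Q z y = (hits Q (3 * y - 2 * z) (2 * y - z)).+2.
Proof. by move=> /and3P[h1 h2 h3]; rewrite /gaplen leqNgt h1 /= ltnNge ltnW. Qed.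

Lemma gaplen_lower (Q z y : nat) : (3 * y <= Q + z)%N -> (Q + z < 6 * y)%N ->
  gaplen Q z y = (hits Q z y + hits Q (3 * y - z) y).+1.
Proof.
move=> h1 h2; have n1 : ((Q + z) %/ (3 * y) = 1)%N.
  by apply/eqP; rewrite eqn_leq -ltnS ltn_divLR ?leq_divRL; lia.
by rewrite /gaplen h1 n1 muln1.
Qed.

Lemma card_upper_mirror (Q r : nat) :
  #|pairs Q (fun z y => upper_mirror Q z y && (gaplen Q z y == r))| =
  #|pairs Q (fun z y => upper_region Q z y && (gaplen Q z y == r))|.
Proof.
have cop z y : (2 * z <= 3 * y)%N -> (z <= 2 * y)%N -> coprime z y -> coprime (3 * y - 2 * z) (2 * y - z).
  move=> h1 h2; move/coprime_lin; apply=> // k k1 k2; split.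
    have -> : z = (3 * (2 * y - z) - 2 * (3 * y - 2 * z))%N by lia.
    by apply: dvdn_sub; apply: dvdn_mull.
  have -> : y = (2 * (2 * y - z) - (3 * y - 2 * z))%N by lia.
  by apply: dvdn_sub => //; apply: dvdn_mull.
apply/eqP; rewrite eqn_leq; apply/andP; split.
  apply: (@card_pairs_le _ _ _ (fun z y => 3 * y - 2 * z)%N (fun z y => 2 * y - z)%N).
  move=> z y zQ yQ z3 c /andP[um /eqP gl]; have /and3P[h1 h2 h3] := um.
  split; split; try lia; first by apply: cop => //; lia.
  have u : upper_region Q (3 * y - 2 * z) (2 * y - z) by rewrite /upper_region; lia.
  by rewrite u -gl (gaplen_upper u) (gaplen_upper_mirror um) eqxx.
apply: (@card_pairs_le _ _ _ (fun z y => 3 * y - 2 * z)%N (fun z y => 2 * y - z)%N).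
move=> z y zQ yQ z3 c /andP[um /eqP gl]; have /and3P[h1 h2 h3] := um.
split; split; try lia; first by apply: cop => //; lia.
have u : upper_mirror Q (3 * y - 2 * z) (2 * y - z) by rewrite /upper_mirror; lia.
rewrite u -gl (gaplen_upper um) (gaplen_upper_mirror u).
have -> : (3 * (2 * y - z) - 2 * (3 * y - 2 * z) = z)%N by lia.
have -> : (2 * (2 * y - z) - (3 * y - 2 * z) = y)%N by lia.
by rewrite eqxx.
Qed.

Lemma coprime_reflect (n z y : nat) : (z <= n * y)%N -> coprime z y -> coprime (n * y - z) y.
Proof.
move=> h /coprime_lin; apply => k k1 k2; split => //.
have -> : z = (n * y - (n * y - z))%N by lia.
by apply: dvdn_sub => //; apply: dvdn_mull.
Qed.

Lemma card_lower_mirror (Q r : nat) :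
  #|pairs Q (fun z y => lower_mirror Q z y && (gaplen Q z y == r))| =
  #|pairs Q (fun z y => lower_region Q z y && (gaplen Q z y == r))|.
Proof.
apply/eqP; rewrite eqn_leq; apply/andP; split.
  apply: (@card_pairs_le _ _ _ (fun z y => 3 * y - z)%N (fun z y => y)).
  move=> z y zQ yQ z3 c /andP[/and3P[h1 h2 h3] /eqP gl].
  split; split; try lia; first by apply: coprime_reflect => //; lia.
  have -> : lower_region Q (3 * y - z) y by rewrite /lower_region; lia.
  have E : (3 * y - (3 * y - z) = z)%N by lia.
  by rewrite -gl (gaplen_lower h1 h3) gaplen_lower; [rewrite E addnC eqxx | lia | lia].
apply: (@card_pairs_le _ _ _ (fun z y => 3 * y - z)%N (fun z y => y)).
move=> z y zQ yQ z3 c /andP[/and3P[h1 h2 h3] /eqP gl].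
split; split; try lia; first by apply: coprime_reflect => //; lia.
have -> : lower_mirror Q (3 * y - z) y by rewrite /lower_mirror; lia.
have E : (3 * y - (3 * y - z) = z)%N by lia.
have g1 : (3 * y <= Q + z)%N by lia.
have g2 : (Q + z < 6 * y)%N by lia.
by rewrite -gl (gaplen_lower g1 g2) gaplen_lower; [rewrite E addnC eqxx | lia | lia].
Qed.

Lemma card_extra_mirror (Q : nat) : #|pairs Q (extra_mirror Q)| = #|pairs Q (extra Q)|.
Proof.
apply/eqP; rewrite eqn_leq; apply/andP; split;
  apply: (@card_pairs_le _ _ _ (fun z y => 6 * y - z)%N (fun z y => y)) => z y zQ yQ z3 c.
  rewrite /extra_mirror /tail_region => h.
  split; split; try lia; first by apply: coprime_reflect => //; lia.
  by rewrite /extra /tail_region; lia.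
rewrite /extra /tail_region => h.
split; split; try lia; first by apply: coprime_reflect => //; lia.
by rewrite /extra_mirror /tail_region; lia.
Qed.

(** The fixed line of the reversal on the lower part; by coprimality it carries at
most the pair [(3, 2)]. *)
Definition middle (Q r z y : nat) : bool :=
  [&& (3 * y <= Q + z)%N, (3 * y == 2 * z)%N, (Q < z + 3 * y)%N & gaplen Q z y == r].

Lemma card_middle (Q r : nat) : (#|pairs Q (middle Q r)| <= 1)%N.
Proof.
have key (p : 'I_Q.+1 * 'I_Q.+1) : p \in pairs Q (middle Q r) -> p.1 = 3%N :> nat /\ p.2 = 2%N :> nat.
  rewrite inE => /and3P[h1 h2 /and4P[h3 /eqP h4 h5 _]].
  have d1 : (p.1 %| 3)%N by rewrite -(Gauss_dvdl 3 h2) h4 dvdn_mull.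
  have n1 : p.1 != 1%N :> nat by apply: contraTneq h1 => ->.
  have e3 := prime_nt_dvdP (isT : prime 3) n1 d1.
  by split => //; lia.
rewrite leqNgt; apply/negP => /card_gt1P[p [q [/key[p1 p2] /key[q1 q2] /negP]]]; apply; apply/eqP.
by rewrite [p]surjective_pairing [q]surjective_pairing; congr (_, _); apply: val_inj; rewrite /= ?p1 ?p2 ?q1 ?q2.
Qed.

Lemma window_split (Q r z y : nat) : (z <= Q)%N -> (3 %| z)%N -> coprime z y ->
  (window Q z y && (gaplen Q z y == r) : nat) =
  ((upper_region Q z y && (gaplen Q z y == r)) + (upper_mirror Q z y && (gaplen Q z y == r)) +
   (lower_region Q z y && (gaplen Q z y == r)) + (lower_mirror Q z y && (gaplen Q z y == r)) +
   middle Q r z y + (tail_region Q z y && (gaplen Q z y == r)))%N.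
Proof.
move=> zQ z3 c.
have zy : z != y.
  apply: contraTneq c => zy; rewrite /coprime -zy gcdnn; lia.
rewrite /middle; case: (gaplen Q z y == r); last by rewrite !andbF.
rewrite !andbT /window /upper_region /upper_mirror /lower_region /lower_mirror /tail_region.
lia.
Qed.

(** The decomposition of the window, with the extra triangles moved from gap length
3 to gap length 4. *)
Lemma card_gap (Q r : nat) :
  (N_gap Q r 3 0 + 2 * (r == 3) * #|pairs Q (extra Q)| =
   2 * (\sum_(p <- half_cells r | p.1 == r) #|pairs Q (incell p.2 Q)|)
   + #|pairs Q (middle Q r)|
   + \sum_(p <- tail_indices | (p.1 + p.2).+1 == r) #|pairs Q (tail_cell p.1 p.2 Q)|
   + 2 * (r == 4) * #|pairs Q (extra Q)|)%N.
Proof.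
rewrite N_gap_pairs.
have -> : (\sum_(p <- half_cells r | p.1 == r) #|pairs Q (incell p.2 Q)| =
   #|pairs Q (fun z y => upper_region Q z y && (gaplen Q z y == r))| +
   #|pairs Q (fun z y => lower_region Q z y && (gaplen Q z y == r))|)%N.
  under eq_bigr => p _ do rewrite card_pairsE.
  rewrite exchange_big /= !card_pairsE -big_split; apply: eq_bigr => -[z y] _ /=.
  have zQ : (z <= Q)%N by rewrite -ltnS.
  rewrite (half_count y r zQ); case: (gaplen _ _ _ == r); rewrite ?andbF // !andbT.
  by rewrite /upper_region /lower_region; lia.
have T : (#|pairs Q (fun z y => tail_region Q z y && (gaplen Q z y == r))| +
    2 * (r == 3) * #|pairs Q (extra Q)| =
    \sum_(p <- tail_indices | (p.1 + p.2).+1 == r) #|pairs Q (tail_cell p.1 p.2 Q)| +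
    2 * (r == 4) * #|pairs Q (extra Q)|)%N.
  have E : (2 * #|pairs Q (extra Q)| = \sum_(p : 'I_Q.+1 * 'I_Q.+1 | (3 %| p.1) && coprime p.1 p.2)
     (extra Q p.1 p.2 + extra_mirror Q p.1 p.2))%N.
    by rewrite big_split /= -!card_pairsE card_extra_mirror mul2n -addnn.
  under [X in _ = (X + _)%N]eq_bigr => p _ do rewrite card_pairsE.
  rewrite exchange_big /= ![(2 * _)%N]mulnC -!mulnA E !big_distrr card_pairsE -!big_split.
  apply: eq_bigr => -[z y] _ /=; apply: tail_count; by rewrite -ltnS.
have W : #|pairs Q (fun z y => window Q z y && (gaplen Q z y == r))| =
  (#|pairs Q (fun z y => upper_region Q z y && (gaplen Q z y == r))| +
   #|pairs Q (fun z y => upper_mirror Q z y && (gaplen Q z y == r))| +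
   #|pairs Q (fun z y => lower_region Q z y && (gaplen Q z y == r))| +
   #|pairs Q (fun z y => lower_mirror Q z y && (gaplen Q z y == r))| +
   #|pairs Q (middle Q r)| +
   #|pairs Q (fun z y => tail_region Q z y && (gaplen Q z y == r))|)%N.
  rewrite !card_pairsE -!big_split; apply: eq_bigr => -[z y] /= /andP[z3 c].
  by apply: window_split => //; rewrite -ltnS.
by rewrite W card_upper_mirror card_lower_mirror; lia.
Qed.

(** * Areas of the tables *)
Section Areas.
Variable R : realType.

(** The cell lies in the unit square at the abscissa [u / v]. *)
Definition inside (c : cell) (u v : int) : bool :=
  [&& 0 <= fy1 c * v + gy1 c * u,
      (fy1 c * v + gy1 c * u) * ey2 c <= (fy2 c * v + gy2 c * u) * ey1 c
    & fy2 c * v + gy2 c * u <= ey2 c * v].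

(** A decidable form of [good_cell]: by affinity, the inequalities on the bottom and
top lines need only be checked at the two ends of the slab. *)
Definition well_formed (c : cell) : bool :=
  [&& (0 < cz1 c), (0 < cz2 c), (0 < ey1 c), (0 < ey2 c), (0 <= dz1 c),
      (dz1 c * cz2 c <= dz2 c * cz1 c), (dz2 c <= cz2 c),
      inside c (dz1 c) (cz1 c) & inside c (dz2 c) (cz2 c)].

Lemma affine_ge0 (l r x p q : R) : l <= x <= r -> 0 <= p + q * l -> 0 <= p + q * r -> 0 <= p + q * x.
Proof.
move=> /andP[lx xr] h1 h2; case: (lerP 0 q) => q0.
  by have := ler_wpM2l q0 lx; lra.
by have := ler_wnM2l (ltW q0) xr; lra.
Qed.

Lemma well_formed_good (c : cell) : well_formed c -> good_cell R c.
Proof.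
case/and5P=> c1 c2 e1 e2 /and5P[d1 lr r1 i1 i2].
split; first by split.
have c1r : (0 : R) < (cz1 c)%:~R by rewrite ltr0z.
have c2r : (0 : R) < (cz2 c)%:~R by rewrite ltr0z.
have e1r : (0 : R) < (ey1 c)%:~R by rewrite ltr0z.
have e2r : (0 : R) < (ey2 c)%:~R by rewrite ltr0z.
split.
- by rewrite /left /right ler_pdivrMr // mulrAC ler_pdivlMr // -!rmorphM /= ler_int.
- by rewrite /right ler_pdivrMr // mul1r ler_int.
have I (u v : int) : 0 < v -> inside c u v -> [/\ 0 <= low c (u%:~R / v%:~R : R),
    low c (u%:~R / v%:~R : R) <= high c (u%:~R / v%:~R) & high c (u%:~R / v%:~R : R) <= 1].
  move=> v0 /and3P[h1 h2 h3].
  have vr : (0 : R) < v%:~R by rewrite ltr0z.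
  have lowE : low c (u%:~R / v%:~R) = (fy1 c * v + gy1 c * u)%:~R / (v * ey1 c)%:~R :> R.
    by rewrite /low intrD !intrM; field; rewrite !gt_eqF.
  have highE : high c (u%:~R / v%:~R) = (fy2 c * v + gy2 c * u)%:~R / (v * ey2 c)%:~R :> R.
    by rewrite /high intrD !intrM; field; rewrite !gt_eqF.
  have ve1 : (0 : R) < (v * ey1 c)%:~R by rewrite ltr0z mulr_gt0.
  have ve2 : (0 : R) < (v * ey2 c)%:~R by rewrite ltr0z mulr_gt0.
  have n1 : (0 : R) <= (fy1 c * v + gy1 c * u)%:~R by rewrite ler0z.
  rewrite lowE highE; split.
  - by rewrite divr_ge0 // ltW.
  - rewrite ler_pdivrMr // mulrAC ler_pdivlMr // -!intrM ler_int.
    by move: (ler_wpM2l (ltW v0) h2); clear; lia.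
  - by rewrite ler_pdivrMr // mul1r ler_int [leRHS]mulrC.
have [l1 l2 l3] := I _ _ c1 i1; have [r1' r2 r3] := I _ _ c2 i2.
move=> x hx.
have E (y : R) : low c y = (fy1 c)%:~R / (ey1 c)%:~R + (gy1 c)%:~R / (ey1 c)%:~R * y.
  by rewrite /low; field; rewrite gt_eqF.
have E' (y : R) : high c y = (fy2 c)%:~R / (ey2 c)%:~R + (gy2 c)%:~R / (ey2 c)%:~R * y.
  by rewrite /high; field; rewrite gt_eqF.
rewrite !E !E' in l1 l2 l3 r1' r2 r3 *; split.
- exact: affine_ge0 hx l1 r1'.
- have := @affine_ge0 _ _ _ ((fy2 c)%:~R / (ey2 c)%:~R - (fy1 c)%:~R / (ey1 c)%:~R)
    ((gy2 c)%:~R / (ey2 c)%:~R - (gy1 c)%:~R / (ey1 c)%:~R) hx.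
  by rewrite !mulrBl => H; have := H ltac:(rewrite /left; lra) ltac:(rewrite /right; lra); lra.
- have := @affine_ge0 _ _ _ (1 - (fy2 c)%:~R / (ey2 c)%:~R) (- ((gy2 c)%:~R / (ey2 c)%:~R)) hx.
  by rewrite !mulNr => H; have := H ltac:(rewrite /left; lra) ltac:(rewrite /right; lra); lra.
Qed.

Lemma upper_well_formed (m : nat) : all (fun p => well_formed p.2) (table_cells (upper_table m)).
Proof. by case: m => [|m]; rewrite /= /well_formed /inside /=; lia. Qed.

Lemma lower_well_formed (m : nat) : (0 < m)%N ->
  all (fun p => well_formed p.2) (table_cells (lower_table m)).
Proof. by case: m => // m _; rewrite /= /well_formed /inside /=; lia. Qed.

Lemma wide_above_well_formed : all (fun p => well_formed p.2) (table_cells wide_above_table).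
Proof. by []. Qed.

Lemma wide_below_well_formed : all (fun p => well_formed p.2) (table_cells wide_below_table).
Proof. by []. Qed.

Definition area_at (t : seq slab) (r : nat) : R :=
  \sum_(p <- table_cells t | p.1 == r) area R p.2.

(** Selects the trapezoids of the requested label in a table with parameter [m]; the
remaining identity between rational functions of [m] is left to [field]. *)
Ltac pick_cells :=
  repeat match goal with
  | |- context [if (?a == ?b)%N then _ else _] =>
    first [ have -> : (a == b)%N = false by lia | have -> : (a == b)%N = true by lia ]
  end.

Lemma affine_intr (a m c : nat) : (a * m + c)%N%:~R = a%:R * m%:R + c%:R :> R.
Proof. by rewrite -pmulrn natrD natrM. Qed.

Ltac eval_area n :=
  rewrite /area_at /table_cells !big_mkcond unlock /=; pick_cells; rewrite ?addr0 ?add0r;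
  rewrite /area /left /right /= ?mulrNz ?affine_intr;
  let x := fresh "x" in have := ler0n R n; move: (n%:R : R) => x ?; field;
  repeat (apply/andP; split); apply/eqP; lra.

Lemma upper_area3 (m : nat) : 4 * area_at (upper_table m) (5 * m + 3) = Pterm R 3 1 m.
Proof. rewrite /Pterm; eval_area m. Qed.

Lemma upper_area4 (m : nat) : 4 * area_at (upper_table m) (5 * m + 4) = Pterm R 4 1 m.
Proof. rewrite /Pterm; eval_area m. Qed.

Lemma upper_area5 (m : nat) : 4 * area_at (upper_table m) (5 * m + 5) = Pterm R 0 2 m.+1.
Proof. rewrite /Pterm -(natr1 m); eval_area m. Qed.

Lemma upper_area6 (m : nat) : 4 * area_at (upper_table m) (5 * m + 6) = Pterm R 1 2 m.+1.
Proof. rewrite /Pterm -(natr1 m); eval_area m. Qed.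

Lemma upper_area2 (m : nat) : let x : R := m.+1%:R in
  4 * area_at (upper_table m.+1) (5 * m.+1 + 2) =
  2 * (15 * x + 4) / (3 * (3 * x + 1) * (6 * x + 1) ^+ 2 * (12 * x + 5)).
Proof. eval_area m.+1. Qed.

Lemma upper_area7 (m : nat) : let x : R := m%:R + 1 in
  4 * area_at (upper_table m) (5 * m + 7) = 2 / (3 * (6 * x + 1) ^+ 2 * (12 * x + 1)).
Proof. eval_area m. Qed.

(** The trapezoids of [upper_table m.+1] with the smallest label and those of
[upper_table m] with the largest one meet along the line between the two bands;
only the sum of their areas is a term of the final formula. *)
Lemma upper_area27 (m : nat) : 4 * (area_at (upper_table m.+1) (5 * m.+1 + 2) +
   area_at (upper_table m) (5 * m + 7)) = Pterm R 2 1 m.+1.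
Proof.
rewrite mulrDr upper_area2 upper_area7 /Pterm -(natr1 m).
have := ler0n R m; move: (m%:R : R) => x ?; field.
by repeat (apply/andP; split); apply/eqP; lra.
Qed.

Lemma lower_area1 (m : nat) : let x : R := m.+1%:R in
  4 * area_at (lower_table m.+1) (5 * m.+1 + 1) = 2 / (3 * (3 * x + 1) * (6 * x + 1) ^+ 2).
Proof. eval_area m.+1. Qed.

Lemma lower_area6 (m : nat) : let x : R := m%:R + 1 in
  4 * area_at (lower_table m) (5 * m + 6) =
  4 * (48 * x + 5) / (3 * (6 * x + 1) ^+ 2 * (12 * x - 1) * (12 * x + 1)).
Proof. eval_area m. Qed.

Lemma lower_area16 (m : nat) : 4 * (area_at (lower_table m.+1) (5 * m.+1 + 1) +
   area_at (lower_table m) (5 * m + 6)) = Pterm R 1 1 m.+1.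
Proof.
rewrite mulrDr lower_area1 lower_area6 /Pterm -(natr1 m).
have := ler0n R m; move: (m%:R : R) => x ?; field.
by repeat (apply/andP; split); apply/eqP; lra.
Qed.

Lemma lower_area2 (m : nat) : 4 * area_at (lower_table m) (5 * m + 2) = Pterm R 2 2 m.
Proof. rewrite /Pterm; eval_area m. Qed.

Lemma lower_area3 (m : nat) : 4 * area_at (lower_table m) (5 * m + 3) = Pterm R 3 2 m + Pterm R 3 3 m.
Proof. rewrite /Pterm; eval_area m. Qed.

Lemma lower_area4 (m : nat) : 4 * area_at (lower_table m) (5 * m + 4) = Pterm R 4 2 m.
Proof. rewrite /Pterm; eval_area m. Qed.

Lemma lower_area5 (m : nat) : 4 * area_at (lower_table m) (5 * m + 5) = Pterm R 0 1 m.+1.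
Proof. rewrite /Pterm -(natr1 m); eval_area m. Qed.

Lemma area_at_out (t : seq slab) (r : nat) : r \notin map fst (table_cells t) -> area_at t r = 0.
Proof. by rewrite -has_pred1 has_map /area_at => h; rewrite big_hasC. Qed.

Definition half_area (r : nat) : R := \sum_(p <- half_cells r | p.1 == r) area R p.2.

Lemma area_at_cat (t1 t2 : seq slab) (r : nat) : area_at (t1 ++ t2) r = area_at t1 r + area_at t2 r.
Proof. by rewrite /area_at /table_cells map_cat flatten_cat big_cat. Qed.

Lemma half_areaE (r : nat) : let m := (r %/ 5)%N in
  half_area r = area_at (upper_table m) r
   + (if (0 < m)%N then area_at (upper_table m.-1) r + area_at (lower_table m) r else 0)
   + (if (1 < m)%N then area_at (lower_table m.-1) r else 0)
   + (area_at wide_above_table r + area_at wide_below_table r).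
Proof.
move=> m; rewrite /half_area /half_cells /tables -/m -[LHS]/(area_at _ r) !area_at_cat.
have nil0 : area_at [::] r = 0 by rewrite /area_at big_nil.
by case: (0 < m)%N; case: (1 < m)%N; rewrite ?nil0 ?add0r ?addr0 ?addrA.
Qed.

Lemma above_below_label (r : nat) : (8 <= r)%N -> area_at wide_above_table r + area_at wide_below_table r = 0.
Proof. by move=> r8; rewrite !area_at_out ?addr0 //= !inE; lia. Qed.

Lemma half_area_large (m i : nat) : (i <= 4)%N -> (8 <= 5 * m + i)%N ->
  4 * half_area (5 * m + i) = \sum_(1 <= j < (nterms i).+1) Pterm R i j m.
Proof.
move=> i4 r8; rewrite half_areaE above_below_label // addr0.
have -> : ((5 * m + i) %/ 5 = m)%N by lia.
have uo k l : ~~ (5 * k + 2 <= l <= 5 * k + 7)%N -> area_at (upper_table k) l = 0.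
  by move=> h; apply: area_at_out; apply: contra h => /upper_labels.
have lo k l : ~~ (5 * k + 1 <= l <= 5 * k + 6)%N -> area_at (lower_table k) l = 0.
  by move=> h; apply: area_at_out; apply: contra h => /lower_labels.
have S2 (F : nat -> R) : \sum_(1 <= j < 3) F j = F 1%N + F 2%N by rewrite big_ltn // big_nat1.
have S3 (F : nat -> R) : \sum_(1 <= j < 4) F j = F 1%N + (F 2%N + F 3%N).
  by rewrite big_ltn // big_ltn // big_nat1.
case: m r8 => [|m] r8; first by lia.
have P0 : (0 < m.+1)%N = true by [].
have PS : m.+1.-1 = m by [].
case: i i4 r8 => [|[|[|[|[|//]]]]] _ r8; rewrite ?S2 ?S3 P0 PS.
- rewrite [area_at (upper_table m.+1) _]uo ?[area_at (lower_table m.+1) _]lo; try lia.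
  have -> : (1 < m.+1)%N by lia.
  have -> : (5 * m.+1 + 0 = 5 * m + 5)%N by lia.
  by rewrite add0r addr0 mulrDr upper_area5 lower_area5 addrC.
- rewrite [area_at (upper_table m.+1) _]uo; try lia.
  have -> : (1 < m.+1)%N by lia.
  have e : (5 * m.+1 + 1 = 5 * m + 6)%N by lia.
  rewrite add0r {1}e -addrA mulrDr upper_area6 -lower_area16 -e addrC.
  by rewrite [LHS]addrC.
- have -> : (1 < m.+1)%N by lia.
  rewrite [area_at (lower_table m) _]lo; try lia.
  have e : (5 * m.+1 + 2 = 5 * m + 7)%N by lia.
  by rewrite addr0 addrA mulrDr lower_area2 [X in area_at (upper_table m) X]e upper_area27.
- rewrite [area_at (upper_table m) _]uo ?[area_at (lower_table m) _]lo; try lia.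
  by rewrite add0r if_same addr0 mulrDr upper_area3 lower_area3.
- rewrite [area_at (upper_table m) _]uo ?[area_at (lower_table m) _]lo; try lia.
  by rewrite add0r if_same addr0 mulrDr upper_area4 lower_area4.
Qed.

(** Numerals [12 * m + c], [4 * m + c] and [2 * m + c] of the tables at [m = 1],
evaluated without unfolding the large ones. *)
Lemma small_sums : ((12 + 2 = 14)%N * (12 + 4 = 16)%N * (12 + 5 = 17)%N * (12 + 6 = 18)%N * (12 + 7 = 19)%N * (12 + 8 = 20)%N * (12 + 10 = 22)%N * (12 + 11 = 23)%N * (12 + 13 = 25)%N * (12 + 14 = 26)%N * (4 + 1 = 5)%N * (4 + 2 = 6)%N * (4 + 3 = 7)%N * (4 + 4 = 8)%N * (2 + 1 = 3)%N)%type.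
Proof. by []. Qed.

Ltac small_area k := rewrite /half_area; let v := fresh "v" in set v := (X in _ = X);
  rewrite /half_cells /tables (_ : (_ %/ 5)%N = k) // /table_cells big_mkcond unlock /= /area /left /right /= /v ?muln0 ?muln1 ?add0n ?small_sums; lra.

Lemma half_area1 : half_area 1 = 1 / 30. Proof. small_area 0%N. Qed.
Lemma half_area2 : half_area 2 = 11 / 140. Proof. small_area 0%N. Qed.
Lemma half_area3 : half_area 3 = 1 / 28. Proof. small_area 0%N. Qed.
Lemma half_area4 : half_area 4 = 263 / 20020%N%:R. Proof. small_area 0%N. Qed.
Lemma half_area5 : half_area 5 = 19169%N%:R / 1361360%N%:R. Proof. small_area 1%N. Qed.
Lemma half_area6 : half_area 6 = 3089%N%:R / 85085%N%:R / 4. Proof. small_area 1%N. Qed.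
Lemma half_area7 : half_area 7 = 54097%N%:R / 3879876%N%:R / 4. Proof. small_area 1%N. Qed.
End Areas.

(** * The series of the corner *)
Section AlphaSeries.
Variable R : realType.
Implicit Types x : R.

(** A primitive of the partial sums of [(1 - x) / (1 - x ^ 3)]. *)
Fixpoint atan_poly (N : nat) (x : R) : R :=
  if N is M.+1 then atan_poly M x + (x ^+ (3 * M).+1 / (3 * M).+1%:R - x ^+ (3 * M).+2 / (3 * M).+2%:R) else 0.

Lemma is_derive_power (n : nat) (x : R) :
  is_derive x (1 : R) (fun y : R => y ^+ n.+1 / n.+1%:R) (x ^+ n).
Proof.
rewrite (_ : (fun y : R => _) = n.+1%:R^-1 *: (@id R ^+ n.+1)); last first.
  by apply/funext => y /=; rewrite mulrC; congr (_ * _); elim: n => [|n IH]; rewrite ?expr1 // exprS IH [in RHS]exprS.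
apply: is_derive_eq.
by rewrite /= -[_ *: 1]/(_ * 1) mulr1 -[_ *: _]/(_ * _) mulrA mulVf ?mul1r // pnatr_eq0.
Qed.

Lemma is_derive_atan_poly (N : nat) (x : R) :
  is_derive x (1 : R) (atan_poly N) (\sum_(k < N) (x ^+ (3 * k) - x ^+ (3 * k).+1)).
Proof.
elim: N => [|N IH]; first by rewrite big_ord0; exact: is_derive_cst.
rewrite big_ord_recr /=.
have P1 := is_derive_power (3 * N) x; have P2 := is_derive_power (3 * N).+1 x.
exact: (is_deriveD IH (is_deriveB P1 P2)).
Qed.

Lemma geometric3 (N : nat) (x : R) : 0 <= x ->
  \sum_(k < N) (x ^+ (3 * k) - x ^+ (3 * k).+1) = (1 - x ^+ (3 * N)) / (1 + x + x ^+ 2).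
Proof.
move=> x0; have d0 : 1 + x + x ^+ 2 != 0 by rewrite gt_eqF // !ltr_wpDr ?exprn_ge0.
elim: N => [|N IH]; first by rewrite big_ord0 expr0 subrr mul0r.
rewrite big_ord_recr /= IH; have -> : (3 * N.+1 = (3 * N).+3)%N by lia.
by rewrite !exprS; field.
Qed.

(** A primitive of [1 / (1 + x + x ^ 2)]. *)
Definition atan_line (y : R) : R := 2 / Num.sqrt 3 * atan ((2 * y + 1) / Num.sqrt 3).

Lemma is_derive_atan_line (x : R) : is_derive x (1 : R) atan_line ((1 + x + x ^+ 2)^-1).
Proof.
have s0 : Num.sqrt 3 != 0 :> R by rewrite gt_eqF // sqrtr_gt0.
have s2 : Num.sqrt 3 ^+ 2 = 3 :> R by rewrite sqr_sqrtr.
pose g : R -> R := (2 / Num.sqrt 3) *: id + cst (1 / Num.sqrt 3).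
have dg : is_derive x (1 : R) g (2 / Num.sqrt 3).
  by apply: is_derive_eq; rewrite /= addr0 -[_ *: _]/(_ * _) mulr1.
rewrite (_ : atan_line = (2 / Num.sqrt 3) *: (atan \o g)); last first.
  apply/funext => y; rewrite -[RHS]/(2 / Num.sqrt 3 * atan (2 / Num.sqrt 3 * y + 1 / Num.sqrt 3)).
  by congr (_ * atan _); field.
have := is_deriveZ (2 / Num.sqrt 3) (is_derive1_comp (is_derive1_atan (g x)) dg) => dc.
apply: (is_derive_eq dc).
have gx : g x = (2 * x + 1) / Num.sqrt 3.
  by rewrite -[LHS]/(2 / Num.sqrt 3 * x + 1 / Num.sqrt 3); field.
rewrite gx -[_ *: _]/(_ * _); set s := Num.sqrt 3 in s0 s2 *.
have d0 : 1 + x + x ^+ 2 != 0 by rewrite gt_eqF //; nra.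
have -> : 1 + ((2 * x + 1) / s) ^+ 2 = 4 * (1 + x + x ^+ 2) / 3.
  by rewrite expr_div_n s2; field.
have -> : 2 / s * ((4 * (1 + x + x ^+ 2) / 3)^-1 * (2 / s)) = 3 / s ^+ 2 / (1 + x + x ^+ 2).
  by field; rewrite s0 d0.
by rewrite s2 divff // div1r.
Qed.

(** The derivative of the difference of the two primitives is
[x ^ (3 * N) / (1 + x + x ^ 2)], between [0] and [x ^ (3 * N)]. *)
Lemma atan_line_diff (N : nat) :
  0 <= atan_line 1 - atan_line 0 - (atan_poly N 1 - atan_poly N 0) <= (3 * N).+1%:R^-1.
Proof.
pose D y := atan_line y - atan_poly N y.
have dD (y : R) : 0 <= y -> is_derive y (1 : R) D (y ^+ (3 * N) / (1 + y + y ^+ 2)).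
  move=> y0; have := is_deriveB (is_derive_atan_line y) (is_derive_atan_poly N y).
  rewrite geometric3 // => h; apply: is_derive_eq h _.
  have d0 : 1 + y + y ^+ 2 != 0 by rewrite gt_eqF // !ltr_wpDr ?exprn_ge0.
  by field.
pose E y := D y - y ^+ (3 * N).+1 / (3 * N).+1%:R.
have dE (y : R) : 0 <= y -> is_derive y (1 : R) E (y ^+ (3 * N) / (1 + y + y ^+ 2) - y ^+ (3 * N)).
  by move=> y0; exact: (is_deriveB (dD y y0) (is_derive_power (3 * N) y)).
have D01 : D 0 <= D 1.
  apply: (@ger0_derive1_ndecr _ D 0 1 _ _ _ 0 1 (lexx _) ler01 (lexx _)).
  - by move=> y; rewrite in_itv /= => /andP[/ltW y0 _]; have [] := dD y y0.
  - move=> y; rewrite in_itv /= => /andP[/ltW y0 _]; have h := dD y y0.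
    by rewrite derive1E derive_val divr_ge0 ?exprn_ge0 // !addr_ge0 ?exprn_ge0.
  - apply: derivable_within_continuous => y; rewrite in_itv /= => /andP[y0 _].
    by have [] := dD y y0.
have E01 : E 1 <= E 0.
  apply: (@ler0_derive1_nincr _ E 0 1 _ _ _ 0 1 (lexx _) ler01 (lexx _)).
  - by move=> y; rewrite in_itv /= => /andP[/ltW y0 _]; have [] := dE y y0.
  - move=> y; rewrite in_itv /= => /andP[/ltW y0 _]; have h := dE y y0.
    rewrite derive1E derive_val subr_le0 ler_pdivrMr; last by rewrite !ltr_wpDr ?exprn_ge0.
    by rewrite ler_peMr ?exprn_ge0 // -addrA lerDl addr_ge0 // exprn_ge0.
  - apply: derivable_within_continuous => y; rewrite in_itv /= => /andP[y0 _].
    by have [] := dE y y0.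
move: D01 E01; rewrite /E /D expr1n expr0n /= mul0r subr0 div1r.
move: (_^-1) (atan_poly N 1) (atan_poly N 0) (atan_line 1) (atan_line 0) => ? ? ? ? ? ? ?; lra.
Qed.

(** The angle [a] satisfies [cos (3 * a) = 0] by the triple angle formula, and lies
between [0] and [pi / 4]. *)
Lemma atan_inv_sqrt3 : atan ((Num.sqrt 3)^-1) = pi / 6 :> R.
Proof.
have s0 : 0 < Num.sqrt 3 :> R by rewrite sqrtr_gt0.
have s2 : Num.sqrt 3 ^+ 2 = 3 :> R by rewrite sqr_sqrtr.
set a := atan _.
have a0 : 0 < a by rewrite -(atan0 R) lt_atan // invr_gt0.
have a4 : a < pi / 4.
  rewrite -atan1 lt_atan // invf_lt1 //; have := s2; have := s0; nra.
have c2 : cos a ^+ 2 = 3 / 4.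
  have h : 1 + (Num.sqrt 3)^-1 ^+ 2 = 4 / 3 :> R by rewrite exprVn s2; field.
  by rewrite cos_atan h exprVn sqr_sqrtr; [field | lra].
have c3 : cos (a + a + a) = 0.
  rewrite !cosD sinD; have := cos2Dsin2 a; rewrite c2 => s.
  have -> : (cos a * cos a - sin a * sin a) * cos a - (sin a * cos a + cos a * sin a) * sin a =
     cos a * (cos a ^+ 2 - 3 * sin a ^+ 2) by ring.
  have s3 : sin a ^+ 2 = 1 / 4 by lra.
  have z0 : 3 / 4 - 3 * (1 / 4) = 0 :> R by lra.
  by rewrite c2 s3 z0 mulr0.
have e : a + a + a = pi / 2.
  apply: cos_inj; rewrite ?in_itv /=.
  - have := pi_gt0 R; lra.
  - have := pi_gt0 R; lra.
  - by rewrite c3 cos_pihalf.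
lra.
Qed.

Lemma atan_sqrt3 : atan (Num.sqrt 3) = pi / 3 :> R.
Proof.
have s0 : 0 < Num.sqrt 3 :> R by rewrite sqrtr_gt0.
have s2 : Num.sqrt 3 ^+ 2 = 3 :> R by rewrite sqr_sqrtr.
have p0 := pi_gt0 R.
have c6 : cos (pi / 6) != 0 :> R.
  by rewrite gt_eqF // cos_gt0_pihalf //; apply/andP; split; lra.
have c3 : cos (pi / 6 + pi / 6) != 0 :> R.
  by rewrite gt_eqF // cos_gt0_pihalf //; apply/andP; split; lra.
have t6 : tan (pi / 6) = (Num.sqrt 3)^-1 :> R by rewrite -atan_inv_sqrt3 atanK.
have e : pi / 3 = pi / 6 + pi / 6 :> R by lra.
rewrite -[RHS]tanK; last by rewrite in_itv /=; apply/andP; split; lra.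
congr atan; rewrite e tanD // t6 -expr2 exprVn s2.
have s1 : Num.sqrt 3 != 0 :> R by rewrite gt_eqF.
have -> : (Num.sqrt 3)^-1 = Num.sqrt 3 / 3 :> R by rewrite -[RHS](_ : Num.sqrt 3 / Num.sqrt 3 ^+ 2 = _); [field | rewrite s2].
by field.
Qed.

Definition alpha (N : nat) : R := \sum_(0 <= k < N) ((3 * k + 1)%:R^-1 - (3 * k + 2)%:R^-1).

Lemma alpha_bound (N : nat) : 0 <= pi / (3 * Num.sqrt 3) - alpha N <= (3 * N).+1%:R^-1.
Proof.
have := atan_line_diff N; rewrite /atan_line.
have s0 : Num.sqrt 3 != 0 :> R by rewrite gt_eqF // sqrtr_gt0.
have e3 : 2 * 1 + 1 = Num.sqrt 3 ^+ 2 :> R by rewrite sqr_sqrtr //; lra.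
have -> : (2 * 1 + 1) / Num.sqrt 3 = Num.sqrt 3 :> R by rewrite e3 expr2 mulfK.
have -> : (2 * 0 + 1) / Num.sqrt 3 = (Num.sqrt 3)^-1 :> R by rewrite mulr0 add0r div1r.
rewrite atan_sqrt3 atan_inv_sqrt3.
have -> : atan_poly N 1 = alpha N.
  rewrite /alpha; elim: N => [|N IH]; first by rewrite big_geq.
  by rewrite big_nat_recr //= -IH !expr1n !div1r addn1 addn2.
have -> : atan_poly N 0 = 0.
  by elim: N => //= N ->; rewrite !expr0n /= !mul0r subrr addr0.
have -> : 2 / Num.sqrt 3 * (pi / 3) - 2 / Num.sqrt 3 * (pi / 6) = pi / (3 * Num.sqrt 3) :> R.
  by field; rewrite gt_eqF // sqrtr_gt0.
by rewrite subr0.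
Qed.
End AlphaSeries.

Section BetaSeries.
Variable R : realType.

(** Comparison of [1 / n] with [ln ((n + 1) / n)] on both sides. *)
Lemma harmonic_log (N j : nat) : (0 < N)%N ->
  (@ln R ((N + j).+1%:R / N.+1%:R)) <= \sum_(N <= i < N + j) (i.+1%:R)^-1 <= @ln R ((N + j)%:R / N%:R).
Proof.
move=> N0; have np : (0 : R) < N%:R by rewrite ltr0n.
elim: j => [|j IH]; first by rewrite addn0 big_geq // !divff ?pnatr_eq0 ?gt_eqF // ln1 lexx.
rewrite addnS big_nat_recr ?leq_addr //=; set n := (N + j)%N in IH *.
have n0 : (0 : R) < n%:R by rewrite ltr0n /n addn_gt0 N0.
have n1 : (0 : R) < n.+1%:R by [].
have n2 : (0 : R) < n.+2%:R by [].
have N1 : (0 : R) < N.+1%:R by [].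
case/andP: IH => h1 h2; apply/andP; split.
  have -> : n.+2%:R / N.+1%:R = n.+1%:R / N.+1%:R * (1 + n.+1%:R^-1) :> R.
    by rewrite -(natr1 n.+1); field; rewrite !gt_eqF.
  rewrite lnM ?posrE ?divr_gt0 // ?addr_gt0 ?invr_gt0 // lerD //.
  by apply: le_ln1Dx; apply: lt_trans (_ : 0 < _); rewrite ?invr_gt0 // oppr_lt0.
have -> : n.+1%:R / N%:R = n%:R / N%:R * (1 - n.+1%:R^-1)^-1 :> R.
  by rewrite -(natr1 n); field; repeat (apply/andP; split); apply/eqP; lra.
have u0 : 0 < 1 - n.+1%:R^-1 :> R.
  by rewrite subr_gt0 invf_lt1 // ltr1n /n ltnS addn_gt0 N0.
rewrite lnM ?posrE ?divr_gt0 ?invr_gt0 // lerD // lnV ?posrE //.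
rewrite lerNr; apply: le_ln1Dx; rewrite ltrN2 invf_lt1 // ltr1n ltnS /n addn_gt0 N0 //.
Qed.

Definition beta (N : nat) : R :=
  \sum_(0 <= k < N) ((3 * k + 1)%:R^-1 + (3 * k + 2)%:R^-1 - 2 / (3 * k + 3)%:R).

(** The [-2 / (3 * k + 3)] turn the harmonic sum up to [3 * N] into its part beyond
[N]. *)
Lemma beta_harmonic (N : nat) : beta N = \sum_(N <= i < N + 2 * N) (i.+1%:R)^-1.
Proof.
elim: N => [|N IH]; first by rewrite /beta !big_geq.
rewrite /beta big_nat_recr //= -/(beta N) IH.
have -> : (N.+1 + 2 * N.+1 = (N + 2 * N).+3)%N by lia.
have e1 : (3 * N + 1 = (N + 2 * N).+1)%N by lia.
have e2 : (3 * N + 2 = (N + 2 * N).+2)%N by lia.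
have e3 : (3 * N + 3 = (N + 2 * N).+3)%N by lia.
rewrite e1 e2 e3.
have e4 : (N.+1%:R)^-1 = 3 / (N + 2 * N).+3%:R :> R.
  have -> : ((N + 2 * N).+3 = 3 * N.+1)%N by lia.
  by rewrite natrM invfM mulrA mulfV ?mul1r // pnatr_eq0.
have {e1 e2 e3} : \sum_(N <= i < (N + 2 * N).+3) (i.+1%:R)^-1 =
    \sum_(N <= i < N + 2 * N) (i.+1%:R)^-1 + (N + 2 * N).+1%:R^-1
    + (N + 2 * N).+2%:R^-1 + (N + 2 * N).+3%:R^-1 :> R.
  by rewrite !big_nat_recr //=; lia.
rewrite [X in X = _ -> _]big_ltn; last by lia.
rewrite e4; set a := \sum_(_ <= _ < _) _; set b := \sum_(_ <= _ < _) _.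
by move: (_.+1%:R^-1) (_.+2%:R^-1) (_.+3%:R^-1) => x y z; lra.
Qed.

Lemma beta_bound (N : nat) : (0 < N)%N -> 0 <= ln 3 - beta N <= 2 / N%:R.
Proof.
move=> N0; have np : (0 : R) < N%:R by rewrite ltr0n.
have := harmonic_log (2 * N) N0; rewrite -beta_harmonic => /andP[h1 h2].
have e : (N + 2 * N)%:R / N%:R = 3 :> R.
  by rewrite (_ : (N + 2 * N = 3 * N)%N) ?natrM ?mulfK ?gt_eqF //; lia.
rewrite e in h2; rewrite subr_ge0 h2 /=.
have e2 : 3 = (N + 2 * N).+1%:R / N.+1%:R * (1 + 2 / (N + 2 * N).+1%:R) :> R.
  have -> : (N + 2 * N)%N = (3 * N)%N by lia.
  rewrite -(natr1 (3 * N)) natrM -(natr1 N); field.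
  by apply/andP; split; apply/eqP; lra.
have n1 : (0 : R) < (N + 2 * N).+1%:R by [].
have n2 : (0 : R) < N.+1%:R by [].
have d0 : 0 < 2 / (N + 2 * N).+1%:R :> R by rewrite divr_gt0.
rewrite {1}e2 lnM ?posrE ?divr_gt0 ?addr_gt0 //.
have h3 : ln (1 + 2 / (N + 2 * N).+1%:R) <= 2 / (N + 2 * N).+1%:R :> R.
  by apply: le_ln1Dx; apply: lt_trans d0; lra.
have h4 : 2 / (N + 2 * N).+1%:R <= 2 / N%:R :> R.
  by rewrite ler_pM2l // lef_pV2 ?posrE // ler_nat; lia.
move: h1 h3 h4; move: (2 / _) (2 / _) (ln _) (ln (1 + _)) (beta N) => a b c d f; lra.
Qed.

(** With [h >= 3 * n + 1] the area is at most [4 / (27 * n ^ 3)], less than the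
difference of the inverse squares. *)
Lemma tri_area_bounds (s n : nat) : (1 <= s)%N -> (2 <= n)%N ->
  0 <= (tri_area (3 * n + s)%:R : R) <= (n%:R ^+ 2)^-1 - (n.+1%:R ^+ 2)^-1.
Proof.
move=> s1 n2; have n0 : (2 : R) <= n%:R by rewrite (ler_nat R 2).
have h1 : 3 * n%:R + 1 <= (3 * n + s)%:R :> R by rewrite -(natrM R 3) natr1 ler_nat; lia.
rewrite /tri_area -(natr1 n); move: ((3 * n + s)%:R) h1 => h h1; set x : R := n%:R in n0 h1 *.
have a1 : 3 * x <= h - 1 by lra.
have x3 : 0 < 3 * x by lra.
have p1 : 0 < (h - 1) * h * (h + 1) by rewrite !mulr_gt0 //; lra.
have p2 : (3 * x) * (3 * x) * (3 * x) <= (h - 1) * h * (h + 1).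
  by apply: ler_pM; rewrite ?mulr_ge0 //; try lra; apply: ler_pM; lra.
apply/andP; split; first by apply: divr_ge0 => //; exact: ltW.
apply: le_trans (_ : 4 / ((3 * x) * (3 * x) * (3 * x)) <= _).
  by rewrite ler_pM2l // lef_pV2 ?posrE //; rewrite !mulr_gt0 //; lra.
have -> : (x ^+ 2)^-1 - ((x + 1) ^+ 2)^-1 = (2 * x + 1) / (x ^+ 2 * (x + 1) ^+ 2).
  by field; apply/andP; split; apply/eqP; lra.
rewrite -subr_ge0.
have -> : (2 * x + 1) / (x ^+ 2 * (x + 1) ^+ 2) - 4 / (3 * x * (3 * x) * (3 * x)) =
    (27 * x * (2 * x + 1) - 4 * (x + 1) ^+ 2) / (27 * x ^+ 3 * (x + 1) ^+ 2).
  by field; apply/andP; split; apply/eqP; lra.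
apply: divr_ge0; first by rewrite expr2; nra.
by rewrite !mulr_ge0 ?exprn_ge0 //; lra.
Qed.

(** Any convergence rate [C / N] identifies the sum; the sharper rate required by
[tail_series] then follows from telescoping [tri_area_bounds]. *)
Lemma tail_series_of_approx (s : nat) (S C : R) : (1 <= s)%N ->
  (forall N, (2 <= N)%N -> `|S - \sum_(2 <= n < N) tri_area (3 * n + s)%:R| <= C / N%:R) ->
  tail_series s S.
Proof.
move=> s1 H M M2; pose T N : R := \sum_(2 <= n < N) tri_area (3 * n + s)%:R.
have TD N : (M <= N)%N -> 0 <= T N - T M <= (M%:R ^+ 2)^-1 - (N%:R ^+ 2)^-1.
  move=> MN; rewrite -(subnKC MN); elim: (N - M)%N => [|j IH]; first by rewrite addn0 !subrr lexx.
  have n2 : (2 <= M + j)%N by lia.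
  have E : T (M + j).+1 = T (M + j)%N + tri_area (3 * (M + j) + s)%:R by rewrite /T big_nat_recr.
  rewrite addnS E; have := tri_area_bounds s1 n2.
  move: IH; move: (T _) (T M) (tri_area _) (_ ^-1) (_ ^-1) (_ ^-1) => a b c d e f /andP[h1 h2] /andP[h3 h4].
  by apply/andP; split; lra.
have small (x : R) : (forall N, (M <= N)%N -> x <= C / N%:R) -> x <= 0.
  move=> h; rewrite leNgt; apply/negP => x0.
  have C0 : 0 <= C / x.
    have := h M (leqnn M); rewrite ler_pdivlMr ?ltr0n; last by lia.
    move=> h1; apply: divr_ge0; last exact: ltW.
    by apply: le_trans h1; rewrite mulr_ge0 // ltW.
  have := h (maxn M (Num.truncn (C / x)).+1) (leq_maxl _ _).
  rewrite ler_pdivlMr ?ltr0n; last by rewrite leq_max ltn0Sn orbT.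
  rewrite leNgt => /negP; apply.
  rewrite -ltr_pdivrMl // mulrC.
  have /andP[_ h2] := truncn_itv C0; apply: lt_le_trans h2 _.
  by rewrite ler_nat leq_maxr.
rewrite -/(T M); apply/andP; split.
  rewrite -oppr_le0; apply: small => N MN.
  have h := H N (leq_trans M2 MN); rewrite -/(T N) ler_norml in h.
  have := TD N MN; lra.
rewrite -subr_le0; apply: small => N MN.
have h := H N (leq_trans M2 MN); rewrite -/(T N) ler_norml in h.
have q : 0 <= (N%:R ^+ 2)^-1 :> R by rewrite invr_ge0 exprn_ge0.
have := TD N MN; lra.
Qed.
End BetaSeries.

Section TailSums.
Variable R : realType.

Let T s N : R := \sum_(2 <= n < N) tri_area (3 * n + s)%:R.

Lemma tail_partial_ind (s : nat) (F : nat -> R) : F 2%N = 0 ->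
  (forall n, (2 <= n)%N -> F n.+1 - F n = tri_area (3 * n + s)%:R) ->
  forall N, (2 <= N)%N -> T s N = F N.
Proof.
move=> F2 FS N N2; rewrite -(subnKC N2); elim: (N - 2)%N => [|j IH].
  by rewrite addn0 F2 /T big_geq.
rewrite addnS /T big_nat_recr /=; last by [].
by rewrite -/(T s (2 + j)) IH -FS // addrC subrK.
Qed.

Lemma alphaS (N : nat) : alpha R N.+1 = alpha R N + ((3 * N + 1)%:R^-1 - (3 * N + 2)%:R^-1).
Proof. by rewrite /alpha big_nat_recr. Qed.

Lemma betaS (N : nat) : beta R N.+1 = beta R N + ((3 * N + 1)%:R^-1 + (3 * N + 2)%:R^-1 - 2 / (3 * N + 3)%:R).
Proof. by rewrite /beta big_nat_recr. Qed.

Lemma alpha2 : alpha R 2 = 11 / 20.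
Proof. by rewrite !alphaS /alpha big_geq // muln0 muln1 !add0n (_ : (3 + 1 = 4)%N) // (_ : (3 + 2 = 5)%N) //; lra. Qed.

Lemma beta2 : beta R 2 = 19 / 20.
Proof. by rewrite !betaS /beta big_geq // muln0 muln1 !add0n (_ : (3 + 1 = 4)%N) // (_ : (3 + 2 = 5)%N) // (_ : (3 + 3 = 6)%N) //; lra. Qed.

(** Partial fractions: [4 / ((h - 1) * h * (h + 1))] is
[2 / (h - 1) - 4 / h + 2 / (h + 1)], one reciprocal from each class modulo 3,
which is a combination of terms of [alpha] and [beta] up to a shift of the
index.  The constants account for the terms before [n = 2]. *)
Lemma tail_partial1 (N : nat) : (2 <= N)%N ->
  T 1 N = - 3 * alpha R N - beta R N + 44 / 15 - 2 / (3 * N%:R).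
Proof.
move: N; apply: tail_partial_ind; first by rewrite alpha2 beta2; lra.
move=> n n2; have : (2 : R) <= n%:R by rewrite (ler_nat R 2).
rewrite alphaS betaS /tri_area -(natr1 n) !(natrD R (3 * n)) (natrM R 3 n); move: (alpha R n) (beta R n) (n%:R : R) => a b x x2.
by field; repeat (apply/andP; split); apply/eqP; lra.
Qed.

Lemma tail_partial2 (N : nat) : (2 <= N)%N -> T 2 N = 3 * alpha R N - beta R N - 7 / 10.
Proof.
move: N; apply: tail_partial_ind; first by rewrite alpha2 beta2; lra.
move=> n n2; have : (2 : R) <= n%:R by rewrite (ler_nat R 2).
rewrite alphaS betaS /tri_area !(natrD R (3 * n)) (natrM R 3 n); move: (alpha R n) (beta R n) (n%:R : R) => a b x x2.
by field; repeat (apply/andP; split); apply/eqP; lra.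
Qed.

Lemma tail_partial3 (N : nat) : (2 <= N)%N ->
  T 3 N = 2 * beta R N + 2 / (3 * N%:R + 1) - 153%N%:R / 70.
Proof.
move: N; apply: tail_partial_ind; first by rewrite beta2 (_ : 3 * 2%:R + 1 = 7 :> R); lra.
move=> n n2; have : (2 : R) <= n%:R by rewrite (ler_nat R 2).
rewrite betaS /tri_area -(natr1 n) !(natrD R (3 * n)) (natrM R 3 n); move: (beta R n) (n%:R : R) => b x x2.
by field; repeat (apply/andP; split); apply/eqP; lra.
Qed.

Lemma tail_shift (s N : nat) : (2 <= N)%N ->
  T (3 + s) N = T s N.+1 - tri_area (6 + s)%:R.
Proof.
move=> N2; rewrite /T [X in _ = X - _]big_ltn // addrC addKr big_add1 /=.
by apply: eq_bigr => n _; congr (tri_area _%:R); lia.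
Qed.

Let a : R := pi / (3 * Num.sqrt 3).
Let b : R := ln 3.

Lemma tail_series1 : tail_series 1 (- 3 * a - b + 44 / 15).
Proof.
apply: (@tail_series_of_approx R 1 _ 4) => // N N2; rewrite -/(T 1 N) tail_partial1 //.
have N0 : (0 < N)%N by lia.
have np : (0 : R) < N%:R by rewrite ltr0n.
have /andP[a1 a2] := alpha_bound R N; have /andP[b1 b2] := beta_bound R N0.
rewrite -/a in a1 a2; rewrite -/b in b1 b2.
have a3 : (3 * N).+1%:R^-1 <= 1 / 3 * N%:R^-1 :> R.
  by rewrite div1r -invfM lef_pV2 ?posrE ?mulr_gt0 // -(natrM R 3) ler_nat.
have e : 2 / (3 * N%:R) = 2 / 3 * N%:R^-1 :> R by rewrite invfM mulrA.
have i0 : 0 <= N%:R^-1 :> R by rewrite invr_ge0.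
rewrite e; move: a1 a2 a3 b1 b2 i0; move: (_.+1%:R^-1) (N%:R^-1) (alpha R N) (beta R N) => u v p q *.
by rewrite ler_norml; lra.
Qed.

Lemma tail_series2 : tail_series 2 (3 * a - b - 7 / 10).
Proof.
apply: (@tail_series_of_approx R 2 _ 4) => // N N2; rewrite -/(T 2 N) tail_partial2 //.
have N0 : (0 < N)%N by lia.
have np : (0 : R) < N%:R by rewrite ltr0n.
have /andP[a1 a2] := alpha_bound R N; have /andP[b1 b2] := beta_bound R N0.
rewrite -/a in a1 a2; rewrite -/b in b1 b2.
have a3 : (3 * N).+1%:R^-1 <= 1 / 3 * N%:R^-1 :> R.
  by rewrite div1r -invfM lef_pV2 ?posrE ?mulr_gt0 // -(natrM R 3) ler_nat.
have i0 : 0 <= N%:R^-1 :> R by rewrite invr_ge0.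
move: a1 a2 a3 b1 b2 i0; move: (_.+1%:R^-1) (N%:R^-1) (alpha R N) (beta R N) => u v p q *.
by rewrite ler_norml; lra.
Qed.

Lemma tail_series3 : tail_series 3 (2 * b - 153%N%:R / 70).
Proof.
apply: (@tail_series_of_approx R 3 _ 5) => // N N2; rewrite -/(T 3 N) tail_partial3 //.
have N0 : (0 < N)%N by lia.
have np : (0 : R) < N%:R by rewrite ltr0n.
have /andP[b1 b2] := beta_bound R N0; rewrite -/b in b1 b2.
have a3 : (3 * N%:R + 1)^-1 <= 1 / 3 * N%:R^-1 :> R.
  by rewrite div1r -invfM lef_pV2 ?posrE; lra.
have a4 : 0 <= (3 * N%:R + 1)^-1 :> R by rewrite invr_ge0; lra.
have i0 : 0 <= N%:R^-1 :> R by rewrite invr_ge0.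
move: a3 a4 b1 b2 i0; move: ((3 * _ + 1)^-1) (N%:R^-1) (beta R N) => u v q *.
by rewrite ler_norml; lra.
Qed.

Lemma tail_series_shift (s : nat) (S : R) : tail_series s S ->
  (1 <= s)%N -> tail_series (3 + s) (S - tri_area (6 + s)%:R).
Proof.
move=> hS s1 M M2; rewrite -/(T _ _) tail_shift //.
have := hS M.+1 (leqW M2); rewrite -/(T _ _) => /andP[h1 h2]; apply/andP; split; first by lra.
have m0 : (0 : R) < M%:R by rewrite ltr0n; lia.
have : (M.+1%:R ^+ 2)^-1 <= (M%:R ^+ 2)^-1 :> R.
  by rewrite lef_pV2 ?posrE ?exprn_gt0 // ler_sqr ?nnegrE ?ler_nat.
by move: h2; move: (_^-1) (_^-1) (tri_area _) (T _ _) => u v w x; lra.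
Qed.
End TailSums.

(** * The limit and the rate of convergence *)
Section Densities.
Variable R : realType.
Implicit Types (f g : nat -> nat) (A B C : R).

(** Main term and error term of a count; [A] is the area of the region. *)
Definition has_density f A C : Prop := forall Q, (0 < Q)%N ->
  `|(f Q)%:R - 2 / 9 * A * Q%:R ^+ 2 * mobius_density R Q| <= C * (Q%:R * (1 + ln Q%:R)).

Lemma error_ge1 (Q : nat) : (0 < Q)%N -> 1 <= Q%:R * (1 + ln Q%:R) :> R.
Proof.
move=> Q0; have Q1 : (1 : R) <= Q%:R by rewrite (ler_nat R 1).
by rewrite -[leLHS]mulr1 ler_pM // lerDl ln_ge0.
Qed.

Lemma has_density_add f g A B C C' : has_density f A C -> has_density g B C' ->
  has_density (fun Q => f Q + g Q)%N (A + B) (C + C').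
Proof.
move=> hf hg Q Q0; rewrite [leRHS]mulrDl; apply: le_trans (lerD (hf Q Q0) (hg Q Q0)).
apply: le_trans (ler_normD _ _); rewrite natrD le_eqVlt; apply/orP; left; apply/eqP; congr `|_|; ring.
Qed.

Lemma has_density_mul (k : nat) f A C : has_density f A C ->
  has_density (fun Q => k * f Q)%N (k%:R * A) (k%:R * C).
Proof.
move=> hf Q Q0; rewrite -[leRHS]mulrA; have h := ler_wpM2l (ler0n R k) (hf Q Q0); apply: le_trans h.
rewrite -[X in X * `|_|](normr_nat R k) -normrM natrM le_eqVlt; apply/orP; left; apply/eqP; congr `|_|; ring.
Qed.

Lemma has_density_sum (T : Type) (s : seq T) (P : pred T) (f : T -> nat -> nat) (A : T -> R) C :
  0 <= C -> all (fun p => `[< P p -> has_density (f p) (A p) C >]) s ->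
  has_density (fun Q => \sum_(p <- s | P p) f p Q)%N (\sum_(p <- s | P p) A p) ((size s)%:R * C).
Proof.
move=> C0; elim: s => [|p s IH] /=.
  by move=> _ Q Q0; rewrite !big_nil !(mulr0, mul0r) subr0 normr0.
move=> /andP[/asboolP hp /IH hs] Q Q0; rewrite !big_cons.
have E : (size s).+1%:R * C = C + (size s)%:R * C by rewrite -natr1; ring.
case: (P p) hp => [hp|_]; rewrite E.
  by have := has_density_add (hp isT) hs Q0.
apply: le_trans (hs Q Q0) _; rewrite [leRHS]mulrDl lerDr mulr_ge0 //.
by apply: le_trans (error_ge1 Q0).
Qed.

Lemma has_density_cell (c : cell) : well_formed c ->
  has_density (fun Q => #|pairs Q (incell c Q)|) (area R c) 4.
Proof. by move=> /(well_formed_good R) gc Q Q0; rewrite mulrA; exact: card_pairs_cell. Qed.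

Lemma has_density_bounded f : (forall Q, f Q <= 1)%N -> has_density f 0 1.
Proof.
move=> f1 Q Q0; rewrite mulr0 !mul0r subr0 normr_nat mul1r.
by apply: le_trans (error_ge1 Q0); rewrite (ler_nat R _ 1).
Qed.

Lemma eq_has_density f g A C : f =1 g -> has_density f A C -> has_density g A C.
Proof. by move=> e h Q Q0; rewrite -e; exact: h. Qed.

(** The window is a single trapezoid, a triangle of area [1/2]. *)
Lemma has_density_window : has_density (fun Q => N_cong Q 3 0) (1 / 2) 4.
Proof.
pose c := mk_cell (0, 1) (1, 1) (3, 1, -1) (3, 1, 2).
have -> : 1 / 2 = area R c by rewrite /area /left /right /=; lra.
have h : well_formed c by [].
apply: eq_has_density (has_density_cell h) => Q.
rewrite N_cong_pairs; apply: eq_card_pairs => z y zQ; rewrite /incell /window /=; lia.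
Qed.

(** The triangle of vertices [(1/3, 2/9)], [(5/13, 3/13)] and [(2/5, 1/5)], cut at
the abscissa [5/13]. *)
Lemma has_density_extra : has_density (fun Q => #|pairs Q (extra Q)|) (1 / 1170%N%:R) 8.
Proof.
pose c1 := mk_cell (1, 3) (5, 13) (3, 1, -1) (6, 1, 1).
pose c2 := mk_cell (5, 13) (2, 5) (3, 1, -1) (1, 1, -2).
have h1 : well_formed c1 by [].
have h2 : well_formed c2 by [].
have -> : 1 / 1170%N%:R = area R c1 + area R c2 by rewrite /area /left /right /=; lra.
have -> : 8 = 4 + 4 :> R by lra.
apply: eq_has_density (has_density_add (has_density_cell h1) (has_density_cell h2)) => Q.
rewrite !card_pairsE -big_split; apply: eq_bigr => -[z y] _ /=.
by rewrite /incell /extra /tail_region /=; lia.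
Qed.

(** The sum over [n >= 2] of [tri_area (3 * n + s)]; the indices [4] and [5] are
the residues [1] and [2] without their first term. *)
Definition tail_area (s : nat) : R :=
  let a := pi / (3 * Num.sqrt 3) in let b := ln 3 in
  match s with
  | 1%N => - 3 * a - b + 44 / 15
  | 2%N => 3 * a - b - 7 / 10
  | 3%N => 2 * b - 153%N%:R / 70
  | 4%N => - 3 * a - b + 44 / 15 - tri_area 7
  | 5%N => 3 * a - b - 7 / 10 - tri_area 8
  | _ => 0
  end.

Lemma tail_areaP (s : nat) : (1 <= s <= 5)%N -> tail_series s (tail_area s).
Proof.
case: s => [|[|[|[|[|[|//]]]]]] // _.
- exact: tail_series1.
- exact: tail_series2.
- exact: tail_series3.
- exact: (tail_series_shift (@tail_series1 R)).
- exact: (tail_series_shift (@tail_series2 R)).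
Qed.

Lemma has_density_tail (i j : nat) : (i <= 2)%N -> (j <= 2)%N ->
  has_density (fun Q => #|pairs Q (tail_cell i j Q)|) (tail_area (i + j).+1) 64.
Proof.
move=> i2 j2 Q Q0; rewrite mulrA; apply: card_pairs_tail => //; apply: tail_areaP; lia.
Qed.

Definition tail_part (r : nat) : R := \sum_(p <- tail_indices | (p.1 + p.2).+1 == r) tail_area (p.1 + p.2).+1.

(** Area of the part of the window where the gap length is [r]. *)
Definition gap_area (r : nat) : R :=
  2 * half_area R r + tail_part r + (2 * (r == 4))%:R / 1170%N%:R - (2 * (r == 3))%:R / 1170%N%:R.

Lemma well_formed_half_cells (r : nat) : all (fun p => well_formed p.2) (half_cells r).
Proof.
have cat t1 t2 (P : pred (nat * cell)) :
    all P (table_cells (t1 ++ t2)) = all P (table_cells t1) && all P (table_cells t2).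
  by rewrite /table_cells map_cat flatten_cat all_cat.
have cond (b : bool) t : (b -> all (fun p => well_formed p.2) (table_cells t)) ->
    all (fun p => well_formed p.2) (table_cells (if b then t else [::])) by case: b => h; [exact: h|].
rewrite /half_cells /tables !cat upper_well_formed wide_above_well_formed wide_below_well_formed.
set m := (r %/ 5)%N.
have -> := cond (0 < m)%N _ (fun _ => upper_well_formed m.-1).
have -> := cond (0 < m)%N _ (@lower_well_formed m).
by have -> := cond (1 < m)%N (lower_table m.-1) ltac:(by move=> m1; apply: lower_well_formed; lia).
Qed.

(** A bound independent of [r]: it makes the error term uniform. *)
Lemma size_half_cells (r : nat) : (size (half_cells r) <= 200)%N.
Proof.
have cat t1 t2 : size (table_cells (t1 ++ t2)) = (size (table_cells t1) + size (table_cells t2))%N.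
  by rewrite /table_cells map_cat flatten_cat size_cat.
rewrite /half_cells /tables !cat.
have U m : (size (table_cells (upper_table m)) <= 20)%N by case: m.
have L m : (size (table_cells (lower_table m)) <= 20)%N by case: m.
have A : (size (table_cells wide_above_table) <= 30)%N by [].
have B : (size (table_cells wide_below_table) <= 30)%N by [].
have Z : size (table_cells [::]) = 0%N by [].
have := U (r %/ 5)%N; have := U (r %/ 5).-1; have := L (r %/ 5)%N; have := L (r %/ 5).-1.
by case: (0 < _)%N; case: (1 < _)%N; rewrite ?Z; lia.
Qed.

Lemma has_density_weaken f A C C' : C <= C' -> has_density f A C -> has_density f A C'.
Proof.
move=> CC h Q Q0; apply: le_trans (h Q Q0) _; rewrite ler_wpM2r //.
by apply: le_trans (error_ge1 Q0).
Qed.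

Lemma has_density_gap (r : nat) : has_density (fun Q => N_gap Q r 3 0) (gap_area r) 2300.
Proof.
(* 2300 exceeds 2 * (200 * 4) + 1 + 9 * 64 + 16 + 16. *)
have D1 : has_density (fun Q => \sum_(p <- half_cells r | p.1 == r) #|pairs Q (incell p.2 Q)|)%N
    (half_area R r) 800.
  apply: (@has_density_weaken _ _ ((size (half_cells r))%:R * 4)).
    have := size_half_cells r; rewrite -(ler_nat R); lra.
  apply: has_density_sum => //; apply: sub_all (well_formed_half_cells r) => p wf.
  by apply/asboolP => _; exact: has_density_cell.
have D2 : has_density (fun Q => \sum_(p <- tail_indices | (p.1 + p.2).+1 == r)
    #|pairs Q (tail_cell p.1 p.2 Q)|)%N (tail_part r) 576.
  have -> : 576 = (size tail_indices)%:R * 64 :> R by rewrite -(natrM R 9 64).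
  apply: has_density_sum => //.
  have : all (fun p => (p.1 <= 2) && (p.2 <= 2))%N tail_indices by [].
  by apply: sub_all => p /andP[i2 j2]; apply/asboolP => _; exact: has_density_tail.
have D3 : has_density (fun Q => #|pairs Q (middle Q r)|) 0 1.
  by apply: has_density_bounded => Q; exact: card_middle.
have D4 k : (k <= 2)%N -> has_density (fun Q => k * #|pairs Q (extra Q)|)%N (k%:R / 1170%N%:R) 16.
  move=> k2; apply: (@has_density_weaken _ _ (k%:R * 8)).
    by move: k2; rewrite -(ler_nat R); lra.
  by have := has_density_mul k has_density_extra; rewrite mulrA mulr1.
have D5 := has_density_add (has_density_add (has_density_add (has_density_mul 2 D1) D3) D2)
   (D4 (2 * (r == 4))%N ltac:(by case: (r == 4))).
have D6 := D4 (2 * (r == 3))%N ltac:(by case: (r == 3)).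
move=> Q Q0; have := D5 Q Q0; have := D6 Q Q0; rewrite -card_gap natrD /gap_area.
have := error_ge1 Q0; set e := _ * (1 + _) => e1.
move: (mobius_density R Q) ((N_gap Q r 3 0)%:R) ((_ * #|_|)%:R : R) => M n x.
move: (half_area R r) (tail_part r) ((2 * (r == 4))%:R / 1170%N%:R) ((2 * (r == 3))%:R / 1170%N%:R) => h t u v d6 d5.
have -> : n - 2 / 9 * (2 * h + t + u - v) * Q%:R ^+ 2 * M =
  (n + x - 2 / 9 * (2%:R * h + 0 + t + u) * Q%:R ^+ 2 * M) - (x - 2 / 9 * v * Q%:R ^+ 2 * M) by ring.
apply: le_trans (ler_normB _ _) _; apply: le_trans (lerD d5 d6) _.
by rewrite -mulrDl ler_wpM2r //; lra.
Qed.

(** The main terms [2 / 9 * A * Q ^ 2 * mobius_density Q] and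
[2 / 9 * (1 / 2) * Q ^ 2 * mobius_density Q] have ratio [2 * A].  The comparison
[f <= g] bounds [|A|] by 1, so the constant depends on [C] only. *)
Lemma density_ratio (f g : nat -> nat) (A C : R) (Q : nat) : 1 <= C -> (0 < Q)%N ->
  (forall q, (f q <= g q)%N) -> has_density f A C -> has_density g (1 / 2) C ->
  288 * C * (1 + ln Q%:R) <= Q%:R ->
  `|(f Q)%:R / (g Q)%:R - 2 * A| <= 216 * C * ((1 + ln Q%:R) / Q%:R).
Proof.
move=> C1 Q0 fg /(_ Q Q0) hf /(_ Q Q0) hg big.
have x1 : (1 : R) <= Q%:R by rewrite (ler_nat R 1).
have M4 := mobius_density_ge R Q0; have {}fg : (f Q)%:R <= (g Q)%:R :> R by rewrite ler_nat.
have f0 : 0 <= (f Q)%:R :> R by [].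
have L1 : 1 <= 1 + ln Q%:R :> R by rewrite lerDl ln_ge0.
move: (mobius_density R Q) (Q%:R : R) (1 + ln Q%:R : R) ((f Q)%:R : R) ((g Q)%:R : R) M4 L1 fg f0 x1 hf hg big.
move=> M x L F G M4 L1 FG F0 x1 hf hg big.
have e' : 2 / 9 * (1 / 2) * x ^+ 2 * M = 2 / 9 * x ^+ 2 * M / 2 by field.
rewrite {}e' in hg.
have e : 2 / 9 * A * x ^+ 2 * M = A * (2 / 9 * x ^+ 2 * M) by ring.
rewrite {}e in hf; set K := 2 / 9 * x ^+ 2 * M in hf hg.
have x0 : 0 < x by lra.
have Kx : x ^+ 2 / 18 <= K by rewrite /K; have := ler_wpM2l (ltW (exprn_gt0 2 x0)) M4; lra.
set E := C * (x * L) in hf hg.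
have Ex : 288 * E <= x ^+ 2.
  by rewrite /E expr2; have := ler_wpM2l (ltW x0) big; lra.
have E0 : 0 <= E by rewrite /E !mulr_ge0 //; lra.
have x2 : 0 < x ^+ 2 by rewrite exprn_gt0.
move: (hf) (hg); rewrite 2!(ler_norml _ E) => /andP[f1 f2] /andP[g1 g2].
have A1 : `|A| <= 1.
  have K0 : 0 < K by lra.
  by rewrite ler_norml -(ler_pM2r K0) -[A <= 1](ler_pM2r K0); lra.
have Gx : x ^+ 2 / 72 <= G by lra.
have G0 : 0 < G by lra.
have -> : F / G - 2 * A = (F - 2 * A * G) / G by field; rewrite gt_eqF.
rewrite normrM [X in _ * X]gtr0_norm ?invr_gt0 // ler_pdivrMr //.
have -> : F - 2 * A * G = (F - A * K) + 2 * A * (K / 2 - G) by field.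
have h : `|F - A * K + 2 * A * (K / 2 - G)| <= 3 * E.
  apply: le_trans (ler_normD _ _) _; have h1 : `|F - A * K| <= E by rewrite ler_norml; lra.
  have h2 : `|2 * A * (K / 2 - G)| <= 2 * E.
    rewrite -mulrA normrM [X in X * _]ger0_norm // ler_pM2l // normrM -[leRHS]mul1r ler_pM //.
    by rewrite ler_norml; lra.
  by lra.
have C0 : 0 <= C by lra.
have L0 : 0 <= L by lra.
have i0 : 0 <= C * (L / x) by rewrite mulr_ge0 // divr_ge0 // ltW.
have e : C * (L / x) * (x ^+ 2 / 72) = E / 72 by rewrite /E; field; rewrite gt_eqF.
have h2 := ler_wpM2l i0 Gx; rewrite {}e in h2.
rewrite -(mulrA 216 C (L / x)); move: (C * (L / x)) h2 => u h2.
by move: h h2; move: (`|_|) => w; clear; lra.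
Qed.

Lemma gap_le_cong (Q r : nat) : (N_gap Q r 3 0 <= N_cong Q 3 0)%N.
Proof.
rewrite N_gap_pairs N_cong_pairs; apply/subset_leq_card/fintype.subsetP => p.
by rewrite !inE => /and3P[-> -> /andP[-> _]].
Qed.

(** The tangent of [ln] at [2 / e] has slope [e / 2]. *)
Lemma log_small (e : R) : 0 < e -> \forall Q \near \oo, ln Q%:R <= e * Q%:R.
Proof.
move=> e0; near=> Q.
have Q0 : (0 : R) < Q%:R by rewrite ltr0n; near: Q; exact: nbhs_infty_gt.
have d0 : 0 < e / 2 by lra.
have h1 : ln (e / 2 * Q%:R) <= e / 2 * Q%:R - 1.
  by have := @le_ln1Dx R (e / 2 * Q%:R - 1); rewrite addrCA subrr addr0; apply; have := mulr_gt0 d0 Q0; lra.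
rewrite lnM ?posrE // in h1.
have h2 : - ln (e / 2) / (e / 2) <= Q%:R by near: Q; exact: nbhs_infty_ger.
rewrite ler_pdivrMr // in h2.
by lra.
Unshelve. all: by end_near. Qed.

Lemma gap_ratio : exists C : R, \forall Q \near \oo, forall r : nat,
  `|nuQ R Q r 3 0 - 2 * gap_area r| <= C * (ln Q%:R / Q%:R).
Proof.
have [C C4 hC] : exists2 C : R, 4 <= C & forall r, has_density (fun Q => N_gap Q r 3 0) (gap_area r) C.
  by exists 2300; [lra | exact: has_density_gap].
(* For Q >= 4, 1 + ln Q is at most 3 * ln Q; whence 216 * C * 3 and 864 = 288 * 3. *)
have D0 : 0 < 864%N%:R * C by rewrite mulr_gt0 ?ltr0n //; lra.
exists (216 * C * 3); near=> Q => r.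
have Q4 : (4 <= Q)%N by near: Q; exact: nbhs_infty_ge.
have Q0 : (0 < Q)%N by apply: leq_trans Q4.
have x0 : (0 : R) < Q%:R by rewrite ltr0n.
have x4 : (4 : R) <= Q%:R by rewrite (ler_nat R 4).
have l4 : 1 / 2 <= ln Q%:R :> R.
  have h : ln (1 + (- (3 / 4))) <= - (3 / 4) :> R by apply: le_ln1Dx; lra.
  have e4 : 1 + (- (3 / 4)) = 4^-1 :> R by lra.
  rewrite e4 lnV ?posrE // in h.
  apply: le_trans (_ : ln 4 <= _); first by lra.
  by rewrite ler_ln ?posrE.
have lQ : 864%N%:R * C * ln Q%:R <= Q%:R.
  rewrite -ler_pdivlMl //; near: Q; apply: log_small; rewrite invr_gt0; exact: D0.
have C1 : 1 <= C by lra.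
have := density_ratio C1 Q0 (fun q => gap_le_cong q r) (hC r) (has_density_weaken C4 has_density_window).
have l3 : 1 + ln Q%:R <= 3 * ln Q%:R :> R by lra.
have {l3} l3 : C * (1 + ln Q%:R) <= C * (3 * ln Q%:R) by rewrite ler_wpM2l //; lra.
rewrite /nuQ => H; apply: le_trans (H _) _; first by lra.
have i0 : 0 <= Q%:R^-1 :> R by rewrite invr_ge0 ltW.
by have := ler_wpM2r i0 l3; move: (Q%:R^-1) (ln Q%:R) => v l; lra.
Unshelve. all: by end_near. Qed.

Lemma cvg_nuQ (r : nat) : nuQ R Q r 3 0 @[Q --> \oo] --> 2 * gap_area r.
Proof.
have [C HC] := gap_ratio.
have C1 : 0 < `|C| + 1 by have := normr_ge0 C; lra.
apply/cvgrPdist_le => e e0; near=> Q.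
have Q0 : (0 : R) < Q%:R by rewrite ltr0n; near: Q; exact: nbhs_infty_gt.
have Q1 : (1 : R) <= Q%:R by rewrite (ler_nat R 1) -(ltr_nat R).
rewrite distrC; apply: le_trans (_ : C * (ln Q%:R / Q%:R) <= _).
  by have := near HC Q; apply.
have l0 : 0 <= ln Q%:R / Q%:R :> R by rewrite divr_ge0 ?ln_ge0 // ltW.
apply: le_trans (_ : (`|C| + 1) * (ln Q%:R / Q%:R) <= _).
  by rewrite ler_wpM2r //; have := ler_norm C; lra.
rewrite -ler_pdivlMl // ler_pdivrMr //; near: Q.
by apply: filterS (log_small (_ : 0 < (`|C| + 1)^-1 * e)) => [Q|]; rewrite ?mulr_gt0 ?invr_gt0 // => ?; lra.
Unshelve. all: by end_near. Qed.

Lemma nuE (r : nat) : nu R r 3 0 = 2 * gap_area r.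
Proof. exact: (cvg_lim (@Rhausdorff R) (@cvg_nuQ r)). Qed.
End Densities.

Section Values.
Variable R : realType.
Local Notation t := (pi / Num.sqrt 3).

Lemma third_pi_sqrt3 : pi / (3 * Num.sqrt 3) = t / 3 :> R.
Proof. by rewrite invfM [_^-1 * _]mulrC mulrA. Qed.

Lemma tail_area1 : tail_area R 1 = - t - ln 3 + 44 / 15.
Proof. by rewrite -[LHS]/(- 3 * (pi / (3 * Num.sqrt 3)) - ln 3 + 44 / 15 : R) third_pi_sqrt3; lra. Qed.

Lemma tail_area2 : tail_area R 2 = t - ln 3 - 7 / 10.
Proof. by rewrite -[LHS]/(3 * (pi / (3 * Num.sqrt 3)) - ln 3 - 7 / 10 : R) third_pi_sqrt3; lra. Qed.

Lemma tail_area3 : tail_area R 3 = 2 * ln 3 - 153%N%:R / 70.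
Proof. by []. Qed.

Lemma tail_area4 : tail_area R 4 = tail_area R 1 - 1 / 84.
Proof.
congr (_ - _); rewrite /tri_area (_ : (7 - 1) * 7 * (7 + 1) = 336%N%:R :> R); last by lra.
by lra.
Qed.

Lemma tail_area5 : tail_area R 5 = tail_area R 2 - 1 / 126.
Proof.
congr (_ - _); rewrite /tri_area (_ : (8 - 1) * 8 * (8 + 1) = 504%N%:R :> R); last by lra.
by lra.
Qed.

Lemma tail_part_small (r : nat) : tail_part R r =
  match r with
  | 1%N => tail_area R 1
  | 2%N => 2 * tail_area R 2
  | 3%N => 3 * tail_area R 3
  | 4%N => 2 * tail_area R 4
  | 5%N => tail_area R 5
  | _ => 0
  end.
Proof.
rewrite /tail_part big_mkcond /tail_indices unlock.
by case: r => [|[|[|[|[|[|r]]]]]]; rewrite /= ?addr0 ?add0r //; ring.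
Qed.

Lemma gap_area_small (r : nat) : gap_area R r = 2 * half_area R r +
  match r with
  | 1%N => tail_area R 1
  | 2%N => 2 * tail_area R 2
  | 3%N => 3 * tail_area R 3 - 2 / 1170%N%:R
  | 4%N => 2 * tail_area R 4 + 2 / 1170%N%:R
  | 5%N => tail_area R 5
  | _ => 0
  end.
Proof.
rewrite /gap_area tail_part_small; move: (1170%N%:R : R) => q.
by case: r => [|[|[|[|[|[|r]]]]]]; set h := half_area R _; rewrite /= ?muln0 ?muln1; lra.
Qed.
End Values.

Theorem theorem1 (R : realType) :
  [/\ (* the limit defining nu(r; 3, 0) exists *)
      forall r : nat, (1 <= r)%N ->
        cvgn (fun Q : nat => nuQ R Q r 3 0),
      (* asymptotic formula, with an absolute constant C *)
      exists C : R, forall r : nat -> nat,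
        (forall Q, (1 <= r Q)%N) ->
        (fun Q : nat => ((r Q)%:R : R^o)) =o_\oo
          (fun Q : nat => ((Q%:R / ln Q%:R) `^ 3^-1 : R^o)) ->
        \forall Q \near \oo,
          `| nuQ R Q (r Q) 3 0 - nu R (r Q) 3 0 | <= C * (ln Q%:R / Q%:R),
      (* values for 1 <= r <= 7 *)
      [/\ nu R 1 3 0 = 6 - 2 * (pi / Num.sqrt 3 + ln 3),
          nu R 2 3 0 = 4 * (pi / Num.sqrt 3 - ln 3) - 87%N%:R / 35%N%:R,
          nu R 3 3 0 = 12 * ln 3 - 53132%N%:R / 4095%N%:R
        & nu R 4 3 0 = 528904%N%:R / 45045%N%:R - 4 * (pi / Num.sqrt 3 + ln 3)],
      [/\ nu R 5 3 0 = 2 * (pi / Num.sqrt 3 - ln 3) - 4164383%N%:R / 3063060%N%:R,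
          nu R 6 3 0 = 3089%N%:R / 85085%N%:R
        & nu R 7 3 0 = 54097%N%:R / 3879876%N%:R]
    & (* values for r >= 8 *)
      forall m i : nat, (1 <= m)%N -> (i <= 4)%N -> (8 <= 5 * m + i)%N ->
        nu R (5 * m + i) 3 0 = \sum_(1 <= j < (nterms i).+1) Pterm R i j m].
Proof.
split.
- by move=> r _; apply: cvgP; exact: cvg_nuQ.
- have [C HC] := gap_ratio R; exists C => r _ _; near=> Q.
  by rewrite nuE; apply: (near HC Q).
- rewrite !nuE !gap_area_small tail_area4 tail_area1 tail_area2 tail_area3; lazy iota.
  by rewrite half_area1 half_area2 half_area3 half_area4; split; lra.
- rewrite !nuE !gap_area_small tail_area5 tail_area2 half_area5 half_area6 half_area7; lazy iota.
  by split; lra.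
move=> m i _ i4 r8; rewrite nuE gap_area_small -half_area_large //.
by case: (5 * m + i)%N r8 => [|[|[|[|[|[|r]]]]]] // _; rewrite addr0; lra.
Unshelve. all: by end_near. Qed.
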